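(* Let $S^2\subset\mathbb{R}^3$ be the unit sphere, $e_3=(0,0,1)$, $\theta\in(0,\pi/2]$, $B_\theta=\{x\in S^2:x\cdot e_3>\cos\theta\}$, and let $f$ be an infinitely differentiable function on $S^2$ with $\operatorname{supp}f\subset B_\theta$. For $x\in S^2$, $t\in(-1,1)$, let $(Mf)(x,t)=\frac{(1-t^2)^{-1/2}}{2\pi}\int_{\{y\in S^2:\,x\cdot y=t\}}f(y)\,d\sigma(y)$. Then for $x=(x',x_3)\in B_\theta$, $$f(x)=\frac{x_3}{2\pi\sin\theta}\,\Delta_{x'}\int_{\partial B_\theta}\int_{-1}^1(Mf)(\xi,\tau)\log|\tau-\xi\cdot x|\,d\tau\,d\xi.$$
   Context: $d\sigma$ is arc-length measure on the circle $\{x\cdot y=t\}$ and $d\xi$ is arc-length measure on $\partial B_\theta$. Points of the upper hemisphere are written $x=(x',x_3)$ with $x'\in\mathbb{R}^2$, $x_3=\sqrt{1-|x'|^2}$, and the right-hand side is regarded as a function of $x'$; $\Delta_{x'}$ is the Laplacian in $x'$. *)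

(* Defs.v *)
From HB Require Import structures.
From mathcomp Require Import all_boot all_order all_algebra.
From mathcomp Require Import all_classical all_reals all_analysis.
Set Implicit Arguments. Unset Strict Implicit. Unset Printing Implicit Defensive.
Import Order.TTheory GRing.Theory Num.Theory.
Import numFieldNormedType.Exports.
Local Open Scope classical_set_scope.
Local Open Scope ring_scope.

Section Defs.
Variable R : realType.

Definition vec3 (a b c : R) : 'rV[R]_3 :=
  \row_(i < 3) (if (i : nat) == 0%N then a else if (i : nat) == 1%N then b else c).
Definition vec2 (a b : R) : 'rV[R]_2 :=
  \row_(i < 2) (if (i : nat) == 0%N then a else b).

Definition dot (n : nat) (x y : 'rV[R]_n) : R := \sum_(i < n) x ord0 i * y ord0 i.

Definition e3 : 'rV[R]_3 := vec3 0 0 1.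

Definition S2 : set 'rV[R]_3 := [set x | dot x x = 1].

Definition Bcap (theta : R) : set 'rV[R]_3 :=
  [set x | S2 x /\ cos theta < dot x e3].

Definition hlift (x' : 'rV[R]_2) : 'rV[R]_3 :=
  vec3 (x' ord0 ord0) (x' ord0 (inord 1)) (Num.sqrt (1 - dot x' x')).

Definition open_disc : set 'rV[R]_2 := [set x' | dot x' x' < 1].

Fixpoint iterD (n : nat) (vs : seq 'rV[R]_n) (g : 'rV[R]_n -> R) : 'rV[R]_n -> R :=
  match vs with
  | [::] => g
  | v :: vs' => fun x => derive (iterD vs' g) x v
  end.

Definition smooth_on (n : nat) (U : set 'rV[R]_n) (g : 'rV[R]_n -> R) :=
  forall (vs : seq 'rV[R]_n) (x : 'rV[R]_n), U x -> differentiable (iterD vs g) x.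

(* f : S^2 -> R (given as a function on R^3, only its values on S^2 matter)
   is C^infty on S^2 with supp f (closure in S^2 = closure in R^3, since S^2
   is closed) contained in B_theta.  Since B_theta lies in the open upper
   hemisphere, smoothness on S^2 amounts to smoothness of f in the
   graph chart of the upper hemisphere (f vanishes near every other point). *)
Definition supp_in (f : 'rV[R]_3 -> R) (A : set 'rV[R]_3) :=
  closure [set y | S2 y /\ f y != 0] `<=` A.

Definition smooth_on_S2_supp_upper (f : 'rV[R]_3 -> R) :=
  smooth_on open_disc (fun x' => f (hlift x')).

Definition frame (x : 'rV[R]_3) : 'rV[R]_3 * 'rV[R]_3 :=
  xget (0, 0) [set uv | dot uv.1 uv.1 = 1 /\ dot uv.2 uv.2 = 1 /\
                        dot uv.1 uv.2 = 0 /\ dot uv.1 x = 0 /\ dot uv.2 x = 0].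

(* integral w.r.t. arc-length measure over the circle {y in S^2 : x.y = t}
   (x unit, |t| <= 1): centre t x, radius r = sqrt(1-t^2), unit-speed
   parametrisation phi |-> t x + r (cos phi u + sin phi v), d sigma = r d phi *)
Definition circle_int (g : 'rV[R]_3 -> R) (x : 'rV[R]_3) (t : R) : R :=
  let r := Num.sqrt (1 - t ^+ 2) in
  (\int[lebesgue_measure]_(phi in `[0, 2 * pi]) 
     (g (t *: x + r *: (cos phi *: (frame x).1 + sin phi *: (frame x).2)) * r))%R.

Definition Mop (f : 'rV[R]_3 -> R) (x : 'rV[R]_3) (t : R) : R :=
  (Num.sqrt (1 - t ^+ 2))^-1 / (2 * pi) * circle_int f x t.

(* the function of x' inside the Laplacian:
   int_{dB_theta} int_{-1}^1 (Mf)(xi,tau) log|tau - xi . x| dtau dxi,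
   where dB_theta = {xi in S^2 : xi . e3 = cos theta} and x = lift x'. *)
Definition potential (f : 'rV[R]_3 -> R) (theta : R) (x' : 'rV[R]_2) : R :=
  circle_int
    (fun xi => (\int[lebesgue_measure]_(tau in `[-1, 1])
                  (Mop f xi tau * ln `|tau - dot xi (hlift x')|))%R)
    e3 (cos theta).

Definition x3 (x : 'rV[R]_3) : R := x ord0 (inord 2).

Definition e1' : 'rV[R]_2 := vec2 1 0.
Definition e2' : 'rV[R]_2 := vec2 0 1.

Definition laplacian2 (F : 'rV[R]_2 -> R) (x' : 'rV[R]_2) : R :=
  derive (fun y => derive F y e1') x' e1' + derive (fun y => derive F y e2') x' e2'.

End Defs.

(* Main.v *)
(** Writing the inner integral over the sphere in the graph chart of the upper
    hemisphere, the potential at [x'] becomes an integral over a point [w] of the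
    disc, with density [g w = f(w, w3) / w3], of the average over [xi] of
    [log |xi . (w, w3) - xi . x|].  For [xi] on the boundary of the cap this argument
    is [A cos t + B sin t + b] with [A^2 + B^2 = sin^2 theta |w - x'|^2], and
    [|b| <= sqrt (A^2 + B^2)] because both points lie in the cap.  The average over [t]
    of [log |A cos t + B sin t + b|] is then [log (sqrt (A^2 + B^2) / 2)], whatever [b]:
    it equals [log (sin theta |w - x'| / 2)].  So the potential is, up to a constant,
    [sin theta] times the planar logarithmic potential of [g], whose Laplacian is
    [2 pi sin theta g x']. *)

Require Import Defs.
From HB Require Import structures.
From mathcomp Require Import all_boot all_order all_algebra.
From mathcomp Require Import all_classical all_reals all_analysis.
From mathcomp Require Import measurable_realfun ring lra.
Import Order.TTheory GRing.Theory Num.Theory.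
Import numFieldNormedType.Exports.
Local Open Scope classical_set_scope.
Local Open Scope ring_scope.
Set Implicit Arguments. Unset Strict Implicit. Unset Printing Implicit Defensive.

(** The logarithm is infinite along a whole circle of the sphere, and that circle moves with [xi],
    so neither a change of variables nor an exchange of integrals is free. Substitutions are
    therefore proved for nonnegative extended-real functions, where Tonelli needs only
    measurability, and [integral_transfer] carries them to signed integrands. All of them reduce to
    affine substitutions on the line: polar coordinates come from averaging over rotations, the
    sphere from a shell. The exchange of the integrals over [xi] and [w] needs absolute
    integrability, which is drawn from the exact average itself through [|ln y| <= 2 y - ln y]. For
    the Laplacian, the point is moved into the density by translation, so derivatives never touch
    the logarithm; integration by parts then leaves the gradient against [z / |z|^2], a radial
    derivative in polar coordinates, and no small disc has to be cut out. Compactness of the support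
    inside the open cap keeps the density away from the unit circle, where [1 / w3] blows up; this
    covers [theta = pi / 2] as well. *)

Section measurability.
Variable R : realType.

Lemma measurable_sqrt : measurable_fun [set: R] (@Num.sqrt R).
Proof.
apply: nondecreasing_measurable; first exact: measurableT.
by move=> x y; exact: ler_wsqrtr.
Qed.

Lemma measurable_inv : measurable_fun [set: R] (@GRing.inv R).
Proof.
have -> : [set: R] = [set 0] `|` [set x : R | x != 0].
  apply/seteqP; split => // x _; have [->|x0] := eqVneq x 0; first by left.
  by right.
have o : open [set x : R | x != 0].
  have -> : [set x : R | x != 0] = ~` [set 0].
    by apply/seteqP; split => x /= /eqP.
  by apply: closed_openC; exact: closed_eq.
apply/measurable_funU => //; first exact: open_measurable.
split; first exact: measurable_fun_set1.
apply: open_continuous_measurable_fun => // x.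
by rewrite inE /= => x0; exact: inv_continuous.
Qed.

Lemma measurable_cos : measurable_fun [set: R] (@cos R).
Proof. by apply: continuous_measurable_fun; exact: continuous_cos. Qed.

Lemma measurable_sin : measurable_fun [set: R] (@sin R).
Proof. by apply: continuous_measurable_fun; exact: continuous_sin. Qed.

End measurability.

Ltac meas1 := match goal with
  | H : ?G |- ?G => exact: H
  | |- measurable_fun _ (fun _ => ?c) => exact: measurable_cst
  | |- measurable_fun _ (Order.lt ?a) => apply: (@measurable_fun_ltr _ _ _ _ (fun=> a) id)
  | |- measurable_fun _ (Order.le ?a) => apply: (@measurable_fun_ler _ _ _ _ (fun=> a) id)
  | |- measurable_fun _ (GRing.mul ?a) => exact: mulrl_measurable
  | |- measurable_fun _ cos => exact: measurable_cos
  | |- measurable_fun _ sin => exact: measurable_sin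
  | |- measurable_fun _ Num.sqrt => exact: measurable_sqrt
  | |- measurable_fun _ (@ln _) => exact: measurable_ln
  | |- measurable_fun _ GRing.opp => exact: oppr_measurable
  | |- measurable_fun _ GRing.inv => exact: measurable_inv
  | |- measurable_fun _ Num.norm => exact: normr_measurable
  | |- measurable_fun _ (fun x => x) => exact: measurable_id
  | |- measurable_fun _ fst => exact: measurable_fst
  | |- measurable_fun _ snd => exact: measurable_snd
  | |- measurable_fun _ (fun x => x.1) => exact: measurable_fst
  | |- measurable_fun _ (fun x => x.2) => exact: measurable_snd
  | |- measurable_fun _ (fun x => (@?f x).1) => apply: (measurableT_comp (@measurable_fst _ _ _ _))
  | |- measurable_fun _ (fun x => (@?f x).2) => apply: (measurableT_comp (@measurable_snd _ _ _ _))
  | |- measurable_fun _ (fun x => (@?f x, @?g x)) => apply: measurable_fun_pair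
  | |- measurable_fun _ (fun x => (@?f x + - @?g x)%R) => apply: measurable_funB
  | |- measurable_fun _ (fun x => (@?f x + @?g x)%R) => apply: measurable_funD
  | |- measurable_fun _ (fun x => (@?f x * @?g x)%R) => apply: measurable_funM
  | |- measurable_fun _ (fun x => (- @?f x)%R) => apply: (measurableT_comp (@oppr_measurable _ _))
  | |- measurable_fun _ (fun x => (@?f x ^+ _)%R) => apply: measurable_funX
  | |- measurable_fun _ (fun x => ((@?f x)^-1)%R) => apply: (measurableT_comp (@measurable_inv _))
  | |- measurable_fun _ (fun x => (Num.sqrt (@?f x))%R) => apply: (measurableT_comp (@measurable_sqrt _))
  | |- measurable_fun _ (fun x => (cos (@?f x))%R) => apply: (measurableT_comp (@measurable_cos _))
  | |- measurable_fun _ (fun x => (sin (@?f x))%R) => apply: (measurableT_comp (@measurable_sin _))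
  | |- measurable_fun _ (fun x => (ln (@?f x))%R) => apply: (measurableT_comp (@measurable_ln _))
  | |- measurable_fun _ (fun x => (`| @?f x |)%R) => apply: (measurableT_comp (@normr_measurable _ _))
  | |- measurable_fun _ (fun x => (`| @?f x |)%E) => apply: (measurableT_comp (@abse_measurable _ _))
  | |- measurable_fun _ (fun x => ((@?f x)%:E)) => apply/measurable_EFinP
  | |- measurable_fun _ (fun x => (@?f x * @?g x)%E) => apply: emeasurable_funM
  | |- measurable_fun _ (fun x => (@?f x + @?g x)%E) => apply: emeasurable_funD
  | |- measurable_fun _ (fun x => @?f x && @?g x) => apply: measurable_and
  | |- measurable_fun _ (fun x => (@?f x < @?g x)%R) => apply: measurable_fun_ltr
  | |- measurable_fun _ (fun x => (@?f x <= @?g x)%R) => apply: measurable_fun_ler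
  | H : measurable_fun setT ?F |- measurable_fun _ (fun x => ?F (@?g x)) => apply: (measurableT_comp H)
  | |- measurable_fun _ _ => first [apply: measurable_fun_ifT | apply: emeasurable_funD]
  end.
Ltac meas := repeat meas1.

(** * Linear substitutions in dimensions one, two and three *)

Section change_of_variables.
Variable R : realType.
Local Notation mu := (@lebesgue_measure R).
Implicit Type F : R -> \bar R.

(** Uniqueness of Lebesgue measure: [|a|] times the pushforward gives every []c, d]] its length. For
    negative [a] the preimage is half-open on the other side, hence the two cases. *)
Lemma ge0_integral_affine F (a b : R) : measurable_fun setT F ->
  (forall x, 0 <= F x)%E -> a != 0 ->
  (\int[mu]_x F (a * x + b)%R = (`|a|^-1)%:E * \int[mu]_x F x)%E.
Proof.
move=> mF F0 a0.
have na0 : 0 < `|a| by rewrite normr_gt0.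
pose phi : measurableTypeR R -> measurableTypeR R := fun x => a * x + b.
have mphi : measurable_fun setT phi by rewrite /phi; meas.
pose k : {nonneg R} := NngNum (normr_ge0 a).
have -> : (\int[mu]_x F x = \int[mscale k (pushforward mu phi)]_x F x)%E.
  move=> m; apply: eq_measure_integral => A mA _.
  apply: (lebesgue_measure_unique (mu := mscale k (pushforward mu phi))) => //.
  move=> _ [[c d]] _ <-.
  change (mu `]c, d]%classic = (`|a|%:E * mu (phi @^-1` `]c, d]%classic))%E).
  have [a_gt0|a_lt0|aE] := ltgtP 0 a; last by rewrite -aE eqxx in a0.
  - have -> : phi @^-1` `]c, d]%classic = `](c - b) / a, (d - b) / a]%classic.
      apply/seteqP; split => x /=; rewrite !in_itv /= /phi ltr_pdivrMr // ler_pdivlMr //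
       ltrBlDr lerBrDr mulrC //.
    rewrite !lebesgue_measure_itv /= !lte_fin ltr_pM2r ?invr_gt0 // ltrD2r.
    case: ifP => _; last by rewrite mule0.
    rewrite -!EFinD -EFinM gtr0_norm //; congr EFin.
    by field.
  - have -> : phi @^-1` `]c, d]%classic = `[(d - b) / a, (c - b) / a[%classic.
      apply/seteqP; split => x /=; rewrite !in_itv /= /phi ltr_ndivlMr // ler_ndivrMr //
       ltrBlDr lerBrDr mulrC andbC //.
    rewrite !lebesgue_measure_itv /= !lte_fin ltr_nM2r ?invr_lt0 // ltrD2r.
    case: ifP => _; last by rewrite mule0.
    rewrite -!EFinD -EFinM ltr0_norm //; congr EFin.
    by field; rewrite lt_eqF.
rewrite ge0_integral_mscale //= ge0_integral_pushforward //=.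
by rewrite muleA -EFinM mulVf ?gt_eqF // mul1e preimage_setT.
Qed.

Lemma ge0_integral_affine_inv F (a b : R) : measurable_fun setT F ->
  (forall x, 0 <= F x)%E -> a != 0 ->
  (\int[mu]_x F x = \int[mu]_x (`|a|%:E * F (a * x + b)%R))%E.
Proof.
move=> mF F0 a0; rewrite ge0_integralZl_EFin //=; last by meas.
by rewrite ge0_integral_affine // muleA -EFinM mulfV ?normr_eq0 // mul1e.
Qed.

Lemma tonelli_swap (F : R * R -> \bar R) : measurable_fun setT F ->
  (forall x, 0 <= F x)%E ->
  (\int[mu]_x \int[mu]_y F (x, y) = \int[mu]_y \int[mu]_x F (x, y))%E.
Proof. by move=> mF F0; exact: fubini_tonelli. Qed.

Lemma measurable_tonelli d (T : measurableType d) (F : T -> R -> \bar R) :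
  measurable_fun setT (fun p : T * R => F p.1 p.2) -> (forall x y, 0 <= F x y)%E ->
  measurable_fun setT (fun x => \int[mu]_y F x y)%E.
Proof.
move=> mF F0.
exact: (@measurable_fun_fubini_tonelli_F _ _ _ _ _ mu (fun p : T * R => F p.1 p.2)).
Qed.

(** Elimination with pivot [a]: substituting in the first variable turns the first argument into [x]
    and leaves [(a d - b c) / a] as the slope of the second in [y]. The two one-dimensional
    Jacobians multiply to the determinant. *)
Let linear2_pivot (F : R * R -> \bar R) (a b c d p q : R) : measurable_fun setT F ->
  (forall x, 0 <= F x)%E -> a != 0 -> a * d - b * c != 0 ->
  (\int[mu]_x \int[mu]_y F (a * x + b * y + p, c * x + d * y + q)%R
   = (`|a * d - b * c|^-1)%:E * \int[mu]_x \int[mu]_y F (x, y))%E.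
Proof.
move=> mF F0 a0 D0.
rewrite (@tonelli_swap (fun z => F (a * z.1 + b * z.2 + p, c * z.1 + d * z.2 + q)));
  [|by meas|by []].
transitivity (\int[mu]_y \int[mu]_x ((`|a|^-1)%:E *
    F (x, c / a * x + ((a * d - b * c) / a * y + (q - c * p / a)))%R))%E.
  apply: eq_integral => y _.
  rewrite ge0_integralZl_EFin //=; [|by meas].
  rewrite -(@ge0_integral_affine _ a (b * y + p)) //; last by meas.
  apply: eq_integral => x _; congr (F (_, _)); first by ring.
  by field.
rewrite -(@tonelli_swap (fun z => (`|a|^-1)%:E *
    F (z.1, c / a * z.1 + ((a * d - b * c) / a * z.2 + (q - c * p / a)))%R)%E); last 2 first.
- by meas.
- by move=> x; rewrite mule_ge0 // lee_fin.
rewrite -[RHS]ge0_integralZl_EFin //=; last 2 first.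
- by move=> x _; exact: integral_ge0.
- by apply: (@measurable_tonelli _ R (fun x y => F (x, y))) => //; meas.
apply: eq_integral => x _.
rewrite ge0_integralZl_EFin //=; last by meas.
under eq_integral do rewrite addrCA.
rewrite (@ge0_integral_affine (fun y => F (x, y)) ((a * d - b * c) / a)
  (c / a * x + (q - c * p / a))) //; last by rewrite mulf_neq0 ?invr_eq0.
  rewrite muleA -EFinM; congr ((_)%:E * _)%E.
  by rewrite normf_div invf_div mulrA mulVf ?normr_eq0 // mul1r.
by meas.
Qed.

(** If [a = 0] the determinant forces [b != 0]; exchanging the variables makes [b] the pivot and
    only changes the sign of the determinant. *)
Lemma ge0_integral_linear2 (F : R * R -> \bar R) (a b c d p q : R) :
  measurable_fun setT F -> (forall x, 0 <= F x)%E -> a * d - b * c != 0 ->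
  (\int[mu]_x \int[mu]_y F (a * x + b * y + p, c * x + d * y + q)%R
   = (`|a * d - b * c|^-1)%:E * \int[mu]_x \int[mu]_y F (x, y))%E.
Proof.
move=> mF F0 D0; have [a0|a0] := eqVneq a 0; last exact: linear2_pivot.
rewrite (@tonelli_swap (fun z => F (a * z.1 + b * z.2 + p, c * z.1 + d * z.2 + q)));
  [|by meas|by []].
have E : b * c - a * d != 0 by rewrite -oppr_eq0 opprB.
have b0 : b != 0 by apply: contraNneq E => ->; rewrite a0 !mul0r subr0.
rewrite distrC; apply: (etrans _ (@linear2_pivot F b a d c p q mF F0 b0 E)).
apply: eq_integral => x _; apply: eq_integral => y _.
by congr (F (_, _)) => /=; ring.
Qed.


(** One step of Gaussian elimination with pivot [a1]. The block [p2, p3, q2, q3] is the Schur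
    complement, of determinant [D / a1]; for fixed [x] it is treated by the planar case, with the
    terms in [x] as translation. *)
Let linear3_pivot (F : R * R * R -> \bar R) (a1 a2 a3 b1 b2 b3 c1 c2 c3 : R) :
  let D := a1 * (b2 * c3 - b3 * c2) - a2 * (b1 * c3 - b3 * c1) + a3 * (b1 * c2 - b2 * c1) in
  measurable_fun setT F -> (forall x, 0 <= F x)%E -> a1 != 0 -> D != 0 ->
  (\int[mu]_x \int[mu]_y \int[mu]_z
     F (a1 * x + a2 * y + a3 * z, b1 * x + b2 * y + b3 * z, c1 * x + c2 * y + c3 * z)%R
   = (`|D|^-1)%:E * \int[mu]_x \int[mu]_y \int[mu]_z F (x, y, z))%E.
Proof.
move=> D mF F0 a0 D0.
pose G x y z := F (a1 * x + a2 * y + a3 * z, b1 * x + b2 * y + b3 * z, c1 * x + c2 * y + c3 * z)%R.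
pose p2 := b2 - b1 * a2 / a1; pose p3 := b3 - b1 * a3 / a1.
pose q2 := c2 - c1 * a2 / a1; pose q3 := c3 - c1 * a3 / a1.
have ED : p2 * q3 - p3 * q2 = D / a1.
  by rewrite /p2 /p3 /q2 /q3 /D; field.
pose K x y z := F (x, p2 * y + p3 * z + b1 / a1 * x, q2 * y + q3 * z + c1 / a1 * x)%R.
have swap (H : R -> R -> R -> \bar R) :
    measurable_fun setT (fun t : R * R * R => H t.1.1 t.1.2 t.2) ->
    (forall x y z, 0 <= H x y z)%E ->
    (\int[mu]_x \int[mu]_y \int[mu]_z H x y z = \int[mu]_y \int[mu]_z \int[mu]_x H x y z)%E.
  move=> mH H0.
  rewrite (@tonelli_swap (fun t => \int[mu]_z H t.1 t.2 z)%E); last 2 first.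
  - exact: (@measurable_tonelli _ _ (fun t z => H t.1 t.2 z)).
  - by move=> t; exact: integral_ge0.
  apply: eq_integral => y _.
  rewrite (@tonelli_swap (fun t => H t.1 y t.2)) //.
  apply: (measurableT_comp (f := fun t : R * R * R => H t.1.1 t.1.2 t.2)
    (g := fun t : R * R => (t.1, y, t.2))) => //.
  by meas.
have mG : measurable_fun setT (fun t : R * R * R => G t.1.1 t.1.2 t.2) by rewrite /G; meas.
have G0 x y z : (0 <= G x y z)%E by rewrite /G.
have K0 x y z : (0 <= K x y z)%E by rewrite /K.
rewrite -[LHS]/(\int[mu]_x \int[mu]_y \int[mu]_z G x y z)%E swap //.
transitivity (\int[mu]_y \int[mu]_z \int[mu]_x ((`|a1|^-1)%:E * K x y z))%E.
  apply: eq_integral => y _; apply: eq_integral => z _.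
  rewrite ge0_integralZl_EFin //=; last by rewrite /K; meas.
  rewrite -(@ge0_integral_affine _ a1 (a2 * y + a3 * z)) //; last by rewrite /K; meas.
  apply: eq_integral => x _; rewrite /K /G /p2 /p3 /q2 /q3; congr (F (_, _, _)).
  - by ring.
  - by field.
  - by field.
transitivity (\int[mu]_x \int[mu]_y \int[mu]_z ((`|a1|^-1)%:E * K x y z))%E.
  apply/esym/(swap (fun x y z => (`|a1|^-1)%:E * K x y z)%E).
    by rewrite /K; meas.
  by move=> x y z; rewrite mule_ge0 // lee_fin.
rewrite -[RHS]ge0_integralZl_EFin //=; last 2 first.
- by move=> x _; apply: integral_ge0 => y _; apply: integral_ge0.
- apply: (@measurable_tonelli _ _ (fun x y => \int[mu]_z F (x, y, z))%E).
    by apply: (@measurable_tonelli _ _ (fun t z => F (t.1, t.2, z))%E) => //; meas.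
  by move=> x y; apply: integral_ge0.
apply: eq_integral => x _.
under eq_integral => y _.
  rewrite ge0_integralZl_EFin //=; last by rewrite /K; meas.
  over.
rewrite /= ge0_integralZl_EFin //=; last 2 first.
- by move=> y _; apply: integral_ge0.
- apply: (@measurable_tonelli _ _ (fun y z => K x y z)) => //.
  by rewrite /K; meas.
have ED0 : p2 * q3 - p3 * q2 != 0 by rewrite ED mulf_neq0 ?invr_eq0.
have mFx : measurable_fun setT (fun t : R * R => F (x, t.1, t.2)) by meas.
have -> := @ge0_integral_linear2 (fun t => F (x, t.1, t.2)) _ _ _ _
  (b1 / a1 * x) (c1 / a1 * x) mFx (fun=> F0 _) ED0.
rewrite muleA -EFinM ED; congr ((_)%:E * _)%E.
by rewrite normf_div invf_div mulrA mulVf ?normr_eq0 // mul1r.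
Qed.

(** A nonzero determinant has a nonzero entry in its first row; permuting the order of integration
    brings that entry to the pivot position. *)
Lemma ge0_integral_linear3 (F : R * R * R -> \bar R) (a1 a2 a3 b1 b2 b3 c1 c2 c3 : R) :
  let D := a1 * (b2 * c3 - b3 * c2) - a2 * (b1 * c3 - b3 * c1) + a3 * (b1 * c2 - b2 * c1) in
  measurable_fun setT F -> (forall x, 0 <= F x)%E -> D != 0 ->
  (\int[mu]_x \int[mu]_y \int[mu]_z
     F (a1 * x + a2 * y + a3 * z, b1 * x + b2 * y + b3 * z, c1 * x + c2 * y + c3 * z)%R
   = (`|D|^-1)%:E * \int[mu]_x \int[mu]_y \int[mu]_z F (x, y, z))%E.
Proof.
move=> D mF F0 D0.
have [a10|a10] := eqVneq a1 0; last exact: linear3_pivot.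
pose G x y z := F (a1 * x + a2 * y + a3 * z, b1 * x + b2 * y + b3 * z, c1 * x + c2 * y + c3 * z)%R.
have mG : measurable_fun setT (fun t : R * R * R => G t.1.1 t.1.2 t.2) by rewrite /G; meas.
have G0 x y z : (0 <= G x y z)%E by rewrite /G.
have swap12 (H : R -> R -> R -> \bar R) :
    measurable_fun setT (fun t : R * R * R => H t.1.1 t.1.2 t.2) ->
    (forall x y z, 0 <= H x y z)%E ->
    (\int[mu]_x \int[mu]_y \int[mu]_z H x y z = \int[mu]_y \int[mu]_x \int[mu]_z H x y z)%E.
  move=> mH H0; apply: (@tonelli_swap (fun t => \int[mu]_z H t.1 t.2 z)%E).
    exact: (@measurable_tonelli _ _ (fun t z => H t.1 t.2 z)).
  by move=> t; exact: integral_ge0.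
have swap23 (H : R -> R -> R -> \bar R) :
    measurable_fun setT (fun t : R * R * R => H t.1.1 t.1.2 t.2) ->
    (forall x y z, 0 <= H x y z)%E ->
    (\int[mu]_x \int[mu]_y \int[mu]_z H x y z = \int[mu]_x \int[mu]_z \int[mu]_y H x y z)%E.
  move=> mH H0; apply: eq_integral => x _.
  rewrite (@tonelli_swap (fun t => H x t.1 t.2)) //.
  apply: (measurableT_comp (f := fun t : R * R * R => H t.1.1 t.1.2 t.2)
    (g := fun t : R * R => (x, t.1, t.2))) => //.
  by meas.
have [a20|a20] := eqVneq a2 0; last first.
  rewrite -[LHS]/(\int[mu]_x \int[mu]_y \int[mu]_z G x y z)%E swap12 //.
  have ED : a2 * (b1 * c3 - b3 * c1) - a1 * (b2 * c3 - b3 * c2) + a3 * (b2 * c1 - b1 * c2) = - D.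
    by rewrite /D; ring.
  have ED0 := D0; rewrite -oppr_eq0 -ED in ED0.
  rewrite -normrN -ED; apply: (etrans _ (linear3_pivot mF F0 a20 ED0)).
  apply: eq_integral => x _; apply: eq_integral => y _; apply: eq_integral => z _.
  by rewrite /G; congr (F (_, _, _)); ring.
have a30 : a3 != 0.
  by apply: contraNneq D0 => a30; rewrite /D a10 a20 a30; apply/eqP; ring.
rewrite -[LHS]/(\int[mu]_x \int[mu]_y \int[mu]_z G x y z)%E swap23 // swap12 //; last first.
  by rewrite /G; meas.
have ED : a3 * (b1 * c2 - b2 * c1) - a1 * (b3 * c2 - b2 * c3) + a2 * (b3 * c1 - b1 * c3) = D.
  by rewrite /D; ring.
have ED0 := D0; rewrite -ED in ED0.
rewrite -ED; apply: (etrans _ (linear3_pivot mF F0 a30 ED0)).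
apply: eq_integral => x _; apply: eq_integral => y _; apply: eq_integral => z _.
by rewrite /G; congr (F (_, _, _)); ring.
Qed.

End change_of_variables.

(** * Integrals in polar and spherical coordinates *)

Section polar.
Variable R : realType.
Local Notation mu := (@lebesgue_measure R).

Lemma ler_sqr_ge0 (a b : R) : 0 <= a -> 0 <= b -> (a ^+ 2 <= b ^+ 2) = (a <= b).
Proof. by move=> a0 b0; rewrite ler_pXn2r // nnegrE. Qed.

Lemma integral_if d (T : measurableType d) (m : {measure set T -> \bar R})
    (P : T -> bool) (f : T -> \bar R) :
  (\int[m]_x (if P x then f x else 0) = \int[m]_(x in [set x | P x]) f x)%E.
Proof.
rewrite [RHS]integral_mkcond; apply: eq_integral => x _; rewrite patchE.
by case: ifPn => Px; [rewrite mem_set|rewrite memNset //=; exact/negP].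
Qed.

Lemma integral_itv_if (f : R -> \bar R) (a b : R) :
  (\int[mu]_(x in `[a, b]) f x = \int[mu]_x (if (a <= x)%R && (x <= b)%R then f x else 0))%E.
Proof.
by rewrite (integral_if mu (fun x : R => (a <= x) && (x <= b))); congr (integral _ _ _); apply/seteqP; split => x /=; rewrite in_itv.
Qed.

Lemma integral_eq_except (c : R) (f g : R -> \bar R) :
  measurable_fun setT f -> measurable_fun setT g -> (forall x, x != c -> f x = g x) ->
  (\int[mu]_x f x = \int[mu]_x g x)%E.
Proof.
move=> mf mg fg.
have mD : measurable ([set: R] `\ c) by exact: measurableD.
rewrite -(@integral_setD1 _ f c) //; last exact: measurable_funTS.
rewrite -(@integral_setD1 _ g c) //; last exact: measurable_funTS.
by apply: eq_integral => x; rewrite inE /= => -[_ /eqP/fg].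
Qed.

Lemma integral_invr (c d : R) : 0 < c -> c < d ->
  (\int[mu]_(x in `[c, d]) (x^-1)%:E = (ln d - ln c)%:E)%E.
Proof.
move=> c0 cd; have d0 := lt_trans c0 cd.
rewrite EFinB; apply: continuous_FTC2 => //.
- apply: continuous_in_subspaceT => x; rewrite inE /= in_itv /= => /andP[cx _].
  by apply: inv_continuous; rewrite gt_eqF // (lt_le_trans c0).
- split.
  + move=> x; rewrite in_itv /= => /andP[cx _].
    by have [] := is_derive1_ln (lt_trans c0 cx).
  + by apply: cvg_at_right_filter; exact: continuous_ln.
  + by apply: cvg_at_left_filter; exact: continuous_ln.
- move=> x; rewrite in_itv /= => /andP[cx _].
  by rewrite derive1E; have [_] := is_derive1_ln (lt_trans c0 cx).
Qed.

(* Evaluate the integral of b(xy) over the sector x <= y <= 4x in the coordinates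
   (x, xy) and (x, y/x): this only uses linear substitutions. *)
Lemma ge0_integral_sqr (b : R -> \bar R) : measurable_fun setT b ->
  (forall x, 0 <= b x)%E ->
  (\int[mu]_z (if (0 < z)%R then (2 * z)%:E * b (z ^+ 2)%R else 0)
   = \int[mu]_p (if (0 < p)%R then b p else 0))%E.
Proof.
move=> mb b0.
pose W (x y : R) : \bar R := if (0 < x) && ((x <= y) && (y <= 4 * x)) then b (x * y) else 0%E.
have mW : measurable_fun setT (fun t : R * R => W t.1 t.2) by rewrite /W; meas.
have W0 x y : (0 <= W x y)%E by rewrite /W; case: ifP.
have ln20 : 0 < ln 2 :> R by rewrite ln_gt0 // ltr1n.
pose Z := (\int[mu]_z (if (0 < z)%R then (2 * z)%:E * b (z ^+ 2)%R else 0))%E.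
(* With [p = x y] the sector becomes [sqrt p / 2 <= x <= sqrt p] and the weight is [1 / x], whose
   integral over this interval is [ln 2] for every [p]. *)
have E1 : (\int[mu]_x \int[mu]_y W x y = (ln 2)%:E * \int[mu]_p (if (0 < p)%R then b p else 0))%E.
  pose U (x p : R) : \bar R := if (0 < x) && ((x ^+ 2 <= p) && (p <= 4 * x ^+ 2))
    then (x^-1%:E * b p)%E else 0%E.
  have mU : measurable_fun setT (fun t : R * R => U t.1 t.2) by rewrite /U; meas.
  have U0 x y : (0 <= U x y)%E.
    by rewrite /U; case: ifP => // /andP[x0 _]; rewrite mule_ge0 // lee_fin invr_ge0 ltW.
  transitivity (\int[mu]_x \int[mu]_p U x p)%E.
    apply: eq_integral => x _; have [x0|x0] := ltP 0 x; last first.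
      by apply: eq_integral => p _; rewrite /W /U ltNge x0.
    have mWx : measurable_fun setT (fun y => W x y) by rewrite /W; meas.
    rewrite (@ge0_integral_affine_inv _ _ (x^-1) 0) //; last by rewrite invr_eq0 gt_eqF.
    apply: eq_integral => p _; rewrite /W /U x0 addr0 mulrA mulfV ?gt_eqF // mul1r.
      have -> : (x <= x^-1 * p) = (x ^+ 2 <= p) by rewrite ler_pdivlMl // expr2.
      have -> : (x^-1 * p <= 4 * x) = (p <= 4 * x ^+ 2).
        by rewrite ler_pdivrMl // mulrCA expr2.
      by case: ifP => _; rewrite ?mule0 // gtr0_norm ?invr_gt0.
  rewrite (@tonelli_swap _ (fun t => U t.1 t.2)) //=.
  rewrite -[RHS]ge0_integralZl_EFin //=; first last.
  - exact: ltW.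
  - by meas.
  - by move=> p _; case: ifP.
  apply: eq_integral => p _; have [p0|p0] := ltP 0 p; last first.
    rewrite mule0; apply: integral0_eq => x _; rewrite /U; case: ifP => // /and3P[x0 xp _].
    by have := lt_le_trans (exprn_gt0 2 x0) (le_trans xp p0); rewrite ltxx.
  have sp0 : 0 < Num.sqrt p by rewrite sqrtr_gt0.
  have -> : (\int[mu]_x U x p = \int[mu]_(x in `[(Num.sqrt p / 2)%R, Num.sqrt p]) (b p * (x^-1)%:E))%E.
    rewrite integral_itv_if; apply: eq_integral => x _; rewrite /U.
    have [x0|x0] := ltP 0 x; last first.
      case: ifP => // /andP[xp _]; have := le_trans xp x0.
      by rewrite leNgt divr_gt0.
    rewrite /= muleC andbC; congr (if _ && _ then _ else _).
      rewrite ler_pdivrMr // -[RHS]ler_sqr_ge0 ?(ltW sp0) //; last by rewrite mulr_ge0 // ltW.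
      by rewrite sqr_sqrtr ?(ltW p0) // exprMn mulrC -natrX.
    by rewrite -[RHS]ler_sqr_ge0 ?(ltW sp0) ?(ltW x0) // sqr_sqrtr ?(ltW p0).
  rewrite ge0_integralZl //; last 2 first.
  - by apply: measurable_funTS; meas; exact: measurable_inv.
  - move=> x /=; rewrite in_itv /= lee_fin invr_ge0 => /andP[+ _].
    by apply: le_trans; rewrite divr_ge0 // ltW.
  rewrite integral_invr ?divr_gt0 //; last by rewrite ltr_pdivrMr // ltr_pMr // ltr1n.
  by rewrite muleC ln_div ?posrE //; congr ((_)%:E * _)%E; ring.
(* With [y = t x] and then [x = z / sqrt t], the integral over [z] becomes [Z / (2 t)], and
   [1 / (2 t)] integrates over [[1, 4]] to the same [ln 2], which then cancels. *)
have E2 : (\int[mu]_x \int[mu]_y W x y = (ln 2)%:E * Z)%E.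
  pose V (x t : R) : \bar R := if (1 <= t) && (t <= 4) then
     (if (0 < x)%R then x%:E * b (x ^+ 2 * t)%R else 0)%E else 0%E.
  have mV : measurable_fun setT (fun t : R * R => V t.1 t.2) by rewrite /V; meas.
  have V0 x y : (0 <= V x y)%E.
    by rewrite /V; case: ifP => // _; case: ifP => // x0; rewrite mule_ge0 // lee_fin ltW.
  transitivity (\int[mu]_x \int[mu]_t V x t)%E.
    apply: eq_integral => x _; have [x0|x0] := ltP 0 x; last first.
      by apply: eq_integral => p _; rewrite /W /V ltNge x0 /=; case: ifP.
    have mWx : measurable_fun setT (fun y => W x y) by rewrite /W; meas.
    rewrite (@ge0_integral_affine_inv _ _ x 0) //; last by rewrite gt_eqF.
      apply: eq_integral => t _; rewrite /W /V x0 addr0 mulrA -expr2 /=.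
      rewrite ler_pMr // [4 * x]mulrC ler_pM2l //.
      by case: ifP => _; rewrite ?mule0 // gtr0_norm.
  rewrite (@tonelli_swap _ (fun t => V t.1 t.2)) //=.
  transitivity (\int[mu]_(t in `[1%R, 4%R]) ((2^-1)%:E * Z * (t^-1)%:E))%E.
    rewrite integral_itv_if; apply: eq_integral => t _; rewrite /V; case: ifP => [/andP[t1 t4]|_]; last first.
      exact: integral0_eq.
    have t0 : 0 < t by exact: lt_le_trans t1.
    have st0 : 0 < Num.sqrt t by rewrite sqrtr_gt0.
    rewrite (@ge0_integral_affine_inv _ _ (Num.sqrt t)^-1 0); last 3 first.
    - by meas.
    - by move=> x; case: ifP => // x0; rewrite mule_ge0 // lee_fin ltW.
    - by rewrite invr_eq0 gt_eqF.
    rewrite muleC muleA -EFinM -ge0_integralZl_EFin //; last 3 first.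
    - by move=> x _; case: ifP => // x0; rewrite mule_ge0 // lee_fin mulr_ge0 // ltW.
    - by meas.
    - by rewrite mulr_ge0 ?invr_ge0 ?ltW.
    apply: eq_integral => x _; rewrite addr0 pmulr_rgt0 ?invr_gt0 //.
    case: ifP => x0; last by rewrite !mule0.
    rewrite gtr0_norm ?invr_gt0 // !muleA -!EFinM; congr ((_)%:E * b _)%E; last first.
      by rewrite exprMn exprVn sqr_sqrtr ?ltW // mulrAC mulVf ?gt_eqF // mul1r.
    rewrite mulrA -invfM -expr2 sqr_sqrtr ?ltW //.
    by rewrite -mulrA; congr (_ * _); rewrite mulrA mulVf ?mul1r // pnatr_eq0.
  have Z0 : (0 <= Z)%E.
    by apply: integral_ge0 => z _; case: ifP => // x0; rewrite mule_ge0 // lee_fin mulr_ge0 // ltW.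
  rewrite ge0_integralZl //; last 3 first.
  - by apply: measurable_funTS; meas; exact: measurable_inv.
  - move=> x /=; rewrite in_itv /= lee_fin invr_ge0 => /andP[+ _].
    by apply: le_trans.
  - by rewrite mule_ge0 // lee_fin invr_ge0.
  rewrite integral_invr // ?ltr1n // ln1 subr0 muleC muleA -EFinM; congr ((_)%:E * _)%E.
  have -> : 4 = 2 ^+ 2 :> R by rewrite -natrX.
  by rewrite lnXn // mulr2n; field.
rewrite -/Z; have := E1; rewrite E2 => /(congr1 (fun x => ((ln 2)^-1)%:E * x)%E).
by rewrite !muleA -!EFinM mulVf ?gt_eqF // !mul1e.
Qed.

Lemma ge0_integral_sqr_shift (b : R -> \bar R) (c : R) : measurable_fun setT b ->
  (forall x, 0 <= b x)%E ->
  (\int[mu]_z (if (0 < z)%R then (2 * z)%:E * b (z ^+ 2)%R else 0)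
   = \int[mu]_p (if (c < p)%R then b (p - c)%R else 0))%E.
Proof.
move=> mb b0; rewrite ge0_integral_sqr // (@ge0_integral_affine_inv _ _ 1 (- c)) ?oner_eq0 //.
- by apply: eq_integral => p _; rewrite normr1 mul1e mul1r subr_gt0.
- by meas.
- by move=> x; case: ifP.
Qed.

Lemma ge0_integral_sqr_shift_half (b : R -> \bar R) (c : R) : measurable_fun setT b ->
  (forall x, 0 <= b x)%E ->
  (\int[mu]_z (if (0 < z)%R then z%:E * b (z ^+ 2)%R else 0)
   = (2^-1)%:E * \int[mu]_p (if (c < p)%R then b (p - c)%R else 0))%E.
Proof.
move=> mb b0; rewrite -ge0_integral_sqr_shift // -ge0_integralZl_EFin //.
- apply: eq_integral => z _; case: ifP => _; last by rewrite mule0.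
  by rewrite muleA -EFinM mulrA mulVf ?pnatr_eq0 // mul1r.
- by move=> z _; case: ifP => // z0; rewrite mule_ge0 // lee_fin mulr_ge0 // ltW.
- by meas.
Qed.

Lemma integral_even (h : R -> \bar R) : measurable_fun setT h -> (forall x, 0 <= h x)%E ->
  (\int[mu]_r h `|r|%R = 2%:E * \int[mu]_r (if (0 < r)%R then h r else 0))%E.
Proof.
move=> mh h0.
pose g (r : R) : \bar R := if 0 < r then h r else 0%E.
have mg : measurable_fun setT g by rewrite /g; meas.
have g0 r : (0 <= g r)%E by rewrite /g; case: ifP.
rewrite (@integral_eq_except 0 _ (fun r => g r + g (-1 * r + 0)%R)%E).
- rewrite ge0_integralD //=; last by meas.
  rewrite ge0_integral_affine // ?normrN1 ?invr1 ?mul1e.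
  by rewrite -[2]/(1 + 1)%R EFinD ge0_muleDl ?lee_fin // mul1e.
- by apply: (measurableT_comp mh); exact: normr_measurable.
- by apply: emeasurable_funD => //; apply: (measurableT_comp mg); meas.
- move=> x x0; rewrite /g mulN1r addr0 oppr_gt0.
  have [xp|xn|xe] := ltgtP 0 x; last by rewrite -xe eqxx in x0.
    by rewrite gtr0_norm // adde0.
  by rewrite ltr0_norm // add0e.
Qed.

Lemma integral_inv_oneDsqr : (\int[mu]_t ((1 + t ^+ 2)^-1)%:E = pi%:E)%E.
Proof.
transitivity (\int[mu]_t ((1 + `|t| ^+ 2)^-1)%:E)%E.
  by apply: eq_integral => t _; rewrite real_normK ?num_real.
rewrite (@integral_even (fun t => ((1 + t ^+ 2)^-1)%:E)); last 2 first.
- by meas.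
- by move=> x; rewrite lee_fin invr_ge0 addr_ge0 // sqr_ge0.
rewrite (integral_if mu (fun t : R => 0 < t)).
have -> : [set t : R | 0 < t] = `]0, +oo[%classic.
  by apply/seteqP; split => x /=; rewrite in_itv /= andbT.
rewrite integral_itv_obnd_cbnd; last by apply: measurable_funTS; meas.
rewrite (@ge0_continuous_FTC2y _ _ (@atan R) _ (pi / 2)).
- by rewrite atan0 sube0 -EFinM mulrC divfK.
- by move=> x _; rewrite invr_ge0 addr_ge0 // sqr_ge0.
- apply: continuous_subspaceT => x; apply: (@continuousV _ _ (fun x : R => 1 + x ^+ 2)).
    by rewrite gt_eqF // ltr_pwDl // sqr_ge0.
  by apply: continuousD; [exact: cvg_cst|exact: exprn_continuous].
- exact: cvgy_atan.
- by move=> x _; have [] := is_derive1_atan x.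
- by apply: cvg_at_right_filter; exact: continuous_atan.
- by move=> x _; rewrite derive1_atan.
Qed.

(** The substitution [y = x t] makes the radius [|x| sqrt (1 + t^2)]; rescaling [x] by that root
    separates the variables with factor [1 / (1 + t^2)], whose integral is [pi]. The other factor 2
    comes from the two signs of [x]. *)
Lemma ge0_integral_radial (a : R -> \bar R) : measurable_fun setT a -> (forall x, 0 <= a x)%E ->
  (\int[mu]_x \int[mu]_y a (Num.sqrt (x ^+ 2 + y ^+ 2))
   = (2 * pi)%:E * \int[mu]_r (if (0 < r)%R then r%:E * a r else 0))%E.
Proof.
move=> ma a0.
pose V (x t : R) := (`|x|%:E * a (`|x| * Num.sqrt (1 + t ^+ 2))%R)%E.
have mV : measurable_fun setT (fun t : R * R => V t.1 t.2) by rewrite /V; meas.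
have V0 x t : (0 <= V x t)%E by rewrite /V mule_ge0 // lee_fin.
transitivity (\int[mu]_x \int[mu]_t V x t)%E.
  apply: (@integral_eq_except 0).
  - by apply: (@measurable_tonelli _ _ _ (fun x y : R => a (Num.sqrt (x ^+ 2 + y ^+ 2)))) => //; meas.
  - exact: (@measurable_tonelli _ _ _ V).
  - move=> x x0; rewrite (@ge0_integral_affine_inv _ _ x 0) //; last by meas.
    apply: eq_integral => t _; rewrite /V; congr (_ * a _)%E.
    rewrite addr0 exprMn -{1}[x ^+ 2]mulr1 -mulrDr sqrtrM ?sqr_ge0 //.
    by rewrite sqrtr_sqr.
rewrite (@tonelli_swap _ (fun t => V t.1 t.2)) //=.
pose A := (\int[mu]_r (`|r|%:E * a `|r|%R))%E.
have A0 : (0 <= A)%E by apply: integral_ge0 => x _; rewrite mule_ge0 // lee_fin.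
transitivity (\int[mu]_t (A * ((1 + t ^+ 2)^-1)%:E))%E.
  apply: eq_integral => t _.
  have t1 : 0 < 1 + t ^+ 2 by rewrite ltr_pwDl // sqr_ge0.
  have st : 0 < Num.sqrt (1 + t ^+ 2) by rewrite sqrtr_gt0.
  rewrite (@ge0_integral_affine_inv _ _ (Num.sqrt (1 + t ^+ 2))^-1 0) //; last 2 first.
  - by rewrite /V; meas.
  - by rewrite invr_eq0 gt_eqF.
  rewrite muleC -ge0_integralZl_EFin //; last 3 first.
  - by move=> x _; rewrite mule_ge0 // lee_fin.
  - by meas.
  - by rewrite invr_ge0 ltW.
  apply: eq_integral => r _; rewrite /V addr0 normrM gtr0_norm ?invr_gt0 //.
  rewrite muleA -EFinM mulrA -invfM -expr2 sqr_sqrtr ?ltW // muleA -EFinM.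
  by rewrite mulrAC mulVf ?gt_eqF // mul1r.
rewrite ge0_integralZl //; last 2 first.
- by meas.
- by move=> x _; rewrite lee_fin invr_ge0 addr_ge0 // sqr_ge0.
have -> : A = (2%:E * \int[mu]_r (if (0 < r)%R then r%:E * a r else 0))%E.
  transitivity (\int[mu]_r (fun r => `|r|%:E * a r) `|r|%R)%E.
    by apply: eq_integral => r _; rewrite normr_id.
  apply: (etrans (@integral_even (fun r : R => `|r|%:E * a r)%E _ _)).
  - by meas.
  - by move=> r; rewrite mule_ge0 // lee_fin.
  by congr (_ * _)%E; apply: eq_integral => r _; case: ifP => // r0; rewrite gtr0_norm.
have -> := integral_inv_oneDsqr.
by rewrite muleC muleA -EFinM mulrC.
Qed.

(** With half-open intervals []c, T + c]] is exactly []c, T]] followed by []T, T + c]], and the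
    second piece moves back by one period. *)
Let integral_periodic_ge0 (P : R -> \bar R) (T c : R) : measurable_fun setT P ->
  (forall x, 0 <= P x)%E -> (forall x, P (x + T) = P x) -> 0 <= c <= T ->
  (\int[mu]_x (if (0 < x)%R && (x <= T)%R then P (x + c)%R else 0) =
   \int[mu]_x (if (0 < x)%R && (x <= T)%R then P x else 0))%E.
Proof.
move=> mP P0 PT /andP[c0 cT].
pose Q (a b x : R) : \bar R := if (a < x) && (x <= b) then P x else 0%E.
have mQ a b : measurable_fun setT (Q a b) by rewrite /Q; meas.
have Q0 a b x : (0 <= Q a b x)%E by rewrite /Q; case: ifP.
have split a b d : a <= b -> b <= d ->
    (\int[mu]_x Q a d x = \int[mu]_x Q a b x + \int[mu]_x Q b d x)%E.
  move=> ab bd; rewrite -(@ge0_integralD _ _ _ mu setT measurableT (Q a b) (Q b d)) //;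
    [|exact: mQ|exact: mQ].
  apply: eq_integral => x _; rewrite /Q.
  have [xb|bx] := leP x b; rewrite ?andbT ?andbF /=.
    by rewrite (le_trans xb bd) andbT adde0.
  by rewrite (le_lt_trans ab bx) add0e.
have shift (a b d : R) : (\int[mu]_x Q (a + d)%R (b + d)%R x
    = \int[mu]_x (if (a < x)%R && (x <= b)%R then P (x + d)%R else 0))%E.
  rewrite (@ge0_integral_affine_inv _ _ 1 d) ?oner_eq0 //.
  apply: eq_integral => x _; rewrite normr1 mul1e mul1r /Q.
  by rewrite ltrD2r lerD2r.
rewrite -[RHS]/(\int[mu]_x Q 0%R T x)%E -shift add0r (split c T) ?lerDl // addeC.
rewrite -{1}[T in Q T]add0r [T + c]addrC shift (split 0 c) //; congr (_ + _)%E.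
by apply: eq_integral => x _; rewrite PT.
Qed.

Lemma integral_periodic (P : R -> \bar R) (T c : R) : measurable_fun setT P ->
  (forall x, 0 <= P x)%E -> (forall x, P (x + T) = P x) -> - T <= c <= T ->
  (\int[mu]_(x in `[0%R, T]) P (x + c)%R = \int[mu]_(x in `[0%R, T]) P x)%E.
Proof.
move=> mP P0 PT /andP[c1 c2].
have toif (g : R -> \bar R) : measurable_fun setT g ->
    (\int[mu]_(x in `[0%R, T]) g x = \int[mu]_x (if (0 < x)%R && (x <= T)%R then g x else 0))%E.
  move=> mg; rewrite -integral_itv_obnd_cbnd; last exact: measurable_funTS.
  rewrite (integral_if mu (fun x : R => (0 < x) && (x <= T))).
  by congr (integral _ _ _); apply/seteqP; split => x /=; rewrite in_itv.
rewrite !toif //; last by meas.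
have [c0|c0] := leP 0 c; first by apply: integral_periodic_ge0; rewrite // c0.
rewrite -(@integral_periodic_ge0 P T (c + T)) //; last first.
  by rewrite -lerBlDr sub0r c1 /= gerDr ltW.
by apply: eq_integral => x _; rewrite addrA PT.
Qed.

Lemma cos_sin_angle (x y : R) : exists2 c, - pi <= c <= pi &
  x = Num.sqrt (x ^+ 2 + y ^+ 2) * cos c /\ y = Num.sqrt (x ^+ 2 + y ^+ 2) * sin c.
Proof.
set r := Num.sqrt _.
have s0 : 0 <= x ^+ 2 + y ^+ 2 by rewrite addr_ge0 ?sqr_ge0.
have [r0|r0] := eqVneq r 0.
  have /eqP : r ^+ 2 = 0 by rewrite r0 expr0n.
  rewrite sqr_sqrtr // paddr_eq0 ?sqr_ge0 // !sqrf_eq0 => /andP[/eqP-> /eqP->].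
  exists 0; first by rewrite oppr_le0 pi_ge0.
  by rewrite r0 !mul0r.
have rp : 0 < r by rewrite lt_neqAle eq_sym r0 sqrtr_ge0.
have rE : r ^+ 2 = x ^+ 2 + y ^+ 2 by rewrite sqr_sqrtr.
have xr : -1 <= x / r <= 1.
  rewrite -ler_norml normf_div (gtr0_norm rp) ler_pdivrMr // mul1r.
  by rewrite -ler_sqr_ge0 ?(ltW rp) // real_normK ?num_real // rE lerDl sqr_ge0.
have [/andP[a0 api] ca] := acos_def xr.
have sa : sin (acos (x / r)) = `|y| / r.
  rewrite sin_acos // -[RHS]ger0_norm; last by rewrite divr_ge0 // ltW.
  rewrite -sqrtr_sqr; congr Num.sqrt; rewrite !expr_div_n rE real_normK ?num_real //.
  by field; rewrite -rE expf_neq0.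
have [y0|y0] := leP 0 y.
  exists (acos (x / r)); first by rewrite api andbT (le_trans _ a0) // oppr_le0 pi_ge0.
  by rewrite ca sa (ger0_norm y0); split; field.
exists (- acos (x / r)).
  by rewrite lerN2 api /= (le_trans _ (pi_ge0 _)) // oppr_le0.
by rewrite cosN sinN ca sa (ltr0_norm y0); split; field.
Qed.

(** Rotations preserve the planar integral, so [2 pi] times it equals the integral of its average
    over all rotations. That average is [a], a function of the radius alone, to which
    [ge0_integral_radial] applies with the same factor [2 pi]. *)
Lemma ge0_integral_polar (F : R * R -> \bar R) : measurable_fun setT F ->
  (forall x, 0 <= F x)%E ->
  (\int[mu]_x \int[mu]_y F (x, y) =
   \int[mu]_r (if (0 < r)%R then
     r%:E * \int[mu]_(t in `[0%R, (2 * pi)%R]) F (r * cos t, r * sin t)%R else 0))%E.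
Proof.
move=> mF F0.
have pi0 : 0 < 2 * pi :> R by rewrite mulr_gt0 // pi_gt0.
pose D (t : R) : bool := (0 <= t) && (t <= 2 * pi).
pose a r : \bar R := (\int[mu]_(t in `[0%R, (2 * pi)%R]) F (r * cos t, r * sin t)%R)%E.
have aE r : a r = (\int[mu]_t (if D t then F (r * cos t, r * sin t)%R else 0))%E.
  exact: integral_itv_if.
have a0 r : (0 <= a r)%E by exact: integral_ge0.
have ma : measurable_fun setT a.
  have -> : a = _ := funext aE.
  apply: (@measurable_tonelli _ _ _ (fun r t : R => if D t then F (r * cos t, r * sin t)%R else 0%E)).
    by rewrite /D; meas.
  by move=> x y; case: ifP.
rewrite -[RHS]/(\int[mu]_r (if (0 < r)%R then r%:E * a r else 0))%E.
pose I := (\int[mu]_x \int[mu]_y F (x, y))%E; rewrite -/I.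
have I0 : (0 <= I)%E by apply: integral_ge0 => x _; exact: integral_ge0.
pose G (t : R) (z : R * R) := F (cos t * z.1 + (- sin t) * z.2 + 0, sin t * z.1 + cos t * z.2 + 0).
have E1 : ((2 * pi)%:E * I = \int[mu]_t (if D t then \int[mu]_x \int[mu]_y G t (x, y) else 0))%E.
  transitivity (\int[mu]_(t in `[0%R, (2 * pi)%R]) (cst I t))%E.
    rewrite integral_cst //= lebesgue_measure_itv /= lte_fin pi0 sube0 muleC //.
  rewrite integral_itv_if; apply: eq_integral => t _; rewrite -/(D t); case: ifP => // _.
  have d1 : cos t * cos t - (- sin t) * sin t = 1.
    by rewrite mulNr opprK -!expr2 cos2Dsin2.
  rewrite /G /= ge0_integral_linear2 // ?d1 ?oner_eq0 //.
  by rewrite normr1 invr1 mul1e.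
have mG : measurable_fun setT (fun p : R * R * R => if D p.1.1 then G p.1.1 (p.1.2, p.2) else 0%E).
  by rewrite /D /G; meas.
have E2 : ((2 * pi)%:E * I = \int[mu]_x \int[mu]_y a (Num.sqrt (x ^+ 2 + y ^+ 2)))%E.
  rewrite E1.
  transitivity (\int[mu]_t \int[mu]_x \int[mu]_y (if D t then G t (x, y) else 0))%E.
    apply: eq_integral => t _; case: ifP => // _.
    by rewrite integral0_eq // => x _; rewrite integral0_eq.
  have G0 t x y : (0 <= if D t then G t (x, y) else 0)%E by case: ifP => // _; exact: F0.
  rewrite (@tonelli_swap _ (fun p => \int[mu]_y (if D p.1 then G p.1 (p.2, y) else 0))%E); last 2 first.
  - exact: (@measurable_tonelli _ _ _ (fun (p : R * R) (y : R) => if D p.1 then G p.1 (p.2, y) else 0%E)).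
  - by move=> p; exact: integral_ge0.
  apply: eq_integral => x _.
  rewrite (@tonelli_swap _ (fun p => if D p.1 then G p.1 (x, p.2) else 0)%E) //; last first.
    by rewrite /D /G; meas.
  apply: eq_integral => y _ /=.
  have mFr (r : R) : measurable_fun setT (fun t : R => F (r * cos t, r * sin t)) by meas.
  (* Rotating [(x, y)] by [t] gives the point at angle [t + c] on its circle, and over a full period
     the shift by [c] is invisible. *)
  have [c /andP[c1 c2] [xE yE]] := cos_sin_angle x y.
  set r := Num.sqrt _ in xE yE *.
  rewrite -[LHS](integral_itv_if _ 0 (2 * pi)) /a -(integral_periodic (c := c) (mFr r)) //; last 2 first.
  - by move=> t; rewrite [2 * pi]mulr_natl cosD2pi sinD2pi.
  - have pp : pi <= 2 * pi :> R by rewrite ler_peMl ?pi_ge0 // ler1n.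
    by rewrite (le_trans c2) // (le_trans _ c1) // lerN2.
  apply: eq_integral => t _; rewrite /G /= {1 2}xE {1 2}yE cosD sinD !addr0.
  by congr (F (_, _)); ring.
move: E2; rewrite ge0_integral_radial // => /(congr1 (fun x => ((2 * pi)^-1)%:E * x)%E).
by rewrite !muleA -!EFinM mulVf ?gt_eqF // !mul1e.
Qed.

Lemma tonelli3 (H : R -> R -> R -> \bar R) :
  measurable_fun setT (fun t : R * R * R => H t.1.1 t.1.2 t.2) ->
  (forall x y z, 0 <= H x y z)%E ->
  (\int[mu]_x \int[mu]_y \int[mu]_z H x y z = \int[mu]_y \int[mu]_z \int[mu]_x H x y z)%E.
Proof.
move=> mH H0.
rewrite (@tonelli_swap _ (fun t => \int[mu]_z H t.1 t.2 z)%E); last 2 first.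
- exact: (@measurable_tonelli _ _ _ (fun (t : R * R) z => H t.1 t.2 z)).
- by move=> t; exact: integral_ge0.
apply: eq_integral => y _.
rewrite (@tonelli_swap _ (fun t => H t.1 y t.2)) //.
apply: (measurableT_comp (f := fun t : R * R * R => H t.1.1 t.1.2 t.2)
  (g := fun t : R * R => (t.1, y, t.2))) => //.
by meas.
Qed.

(** The determinant of an orthonormal frame is a sign: [D^2] is the Gram determinant of the three
    vectors, which is 1 here. *)
Lemma ge0_integral_frame (K : R * R * R -> \bar R) (u1 u2 u3 v1 v2 v3 k1 k2 k3 : R) :
  measurable_fun setT K -> (forall x, 0 <= K x)%E ->
  u1 * u1 + u2 * u2 + u3 * u3 = 1 -> v1 * v1 + v2 * v2 + v3 * v3 = 1 ->
  k1 * k1 + k2 * k2 + k3 * k3 = 1 -> u1 * v1 + u2 * v2 + u3 * v3 = 0 ->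
  u1 * k1 + u2 * k2 + u3 * k3 = 0 -> v1 * k1 + v2 * k2 + v3 * k3 = 0 ->
  (\int[mu]_x \int[mu]_y \int[mu]_z
     K (u1 * x + v1 * y + k1 * z, u2 * x + v2 * y + k2 * z, u3 * x + v3 * y + k3 * z)%R
   = \int[mu]_x \int[mu]_y \int[mu]_z K (x, y, z))%E.
Proof.
move=> mK K0 uu vv kk uv uk vk.
pose D := u1 * (v2 * k3 - k2 * v3) - v1 * (u2 * k3 - k2 * u3) + k1 * (u2 * v3 - v2 * u3).
have D2 : D ^+ 2 = 1.
  have -> : D ^+ 2 = (u1 * u1 + u2 * u2 + u3 * u3) * (v1 * v1 + v2 * v2 + v3 * v3) *
       (k1 * k1 + k2 * k2 + k3 * k3)
     + 2 * (u1 * v1 + u2 * v2 + u3 * v3) * (u1 * k1 + u2 * k2 + u3 * k3) * (v1 * k1 + v2 * k2 + v3 * k3)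
     - (u1 * u1 + u2 * u2 + u3 * u3) * (v1 * k1 + v2 * k2 + v3 * k3) ^+ 2
     - (v1 * v1 + v2 * v2 + v3 * v3) * (u1 * k1 + u2 * k2 + u3 * k3) ^+ 2
     - (k1 * k1 + k2 * k2 + k3 * k3) * (u1 * v1 + u2 * v2 + u3 * v3) ^+ 2 by rewrite /D; ring.
  by rewrite uu vv kk uv uk vk; ring.
have D1 : `|D| = 1.
  by apply/eqP; rewrite -(@eqrXn2 _ 2) // real_normK ?num_real // D2 expr1n.
have D0 : D != 0 by rewrite -normr_eq0 D1 oner_eq0.
by rewrite (ge0_integral_linear3 mK K0 D0) -/D D1 invr1 mul1e.
Qed.

(** * The area of the sphere in latitude coordinates and in the graph chart *)

Section sphere.
Variable H : R * R * R -> \bar R.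
Hypothesis mH : measurable_fun setT H.
Hypothesis H0 : forall x, (0 <= H x)%E.

(* Both parametrisations of the sphere come from integrating over the shell 1 <= |y|^2 <= 2. *)
Let K (x y z : R) : \bar R := let n := x ^+ 2 + y ^+ 2 + z ^+ 2 in
  if (1 <= n) && (n <= 2)
  then ((Num.sqrt n)^-1%:E * H (x / Num.sqrt n, y / Num.sqrt n, z / Num.sqrt n)%R)%E else 0%E.

Let mK : measurable_fun setT (fun t : R * R * R => K t.1.1 t.1.2 t.2).
Proof. by rewrite /K /=; meas. Qed.

Let K0 x y z : (0 <= K x y z)%E.
Proof. by rewrite /K; case: ifP => // _; rewrite mule_ge0 // lee_fin invr_ge0 sqrtr_ge0. Qed.

Let K_scale (p x y z : R) : 0 < p -> x ^+ 2 + y ^+ 2 + z ^+ 2 = 1 ->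
  K (Num.sqrt p * x) (Num.sqrt p * y) (Num.sqrt p * z) =
  if (1 <= p) && (p <= 2) then ((Num.sqrt p)^-1%:E * H (x, y, z))%E else 0%E.
Proof.
move=> p0 n1; rewrite /K !exprMn sqr_sqrtr ?(ltW p0) // -!mulrDr n1 mulr1.
have sp : Num.sqrt p != 0 by rewrite gt_eqF // sqrtr_gt0.
by rewrite ![Num.sqrt p * _]mulrC !mulfK.
Qed.

(** The shell has length one in the variable [p = |y|^2], so a quantity that no longer depends on
    [p] is reproduced without a constant. *)
Let integral_cst12 (c : \bar R) :
  (\int[mu]_p (if (1 <= p)%R && (p <= 2)%R then c else 0) = c)%E.
Proof.
rewrite -(integral_itv_if (cst c)) integral_cst //= lebesgue_measure_itv /= lte_fin.
by rewrite ltr1n /= -EFinB (_ : 2 - 1 = 1)%R ?mule1 //; ring.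
Qed.

(** Cylindrical coordinates around the axis [k]: with [z] the height along [k] and [r] the distance
    from it, [r dr] is half of [dp] for [p = r^2 + z^2], which is the origin of [2^-1]. Writing
    [z = sqrt p * s] then splits off [p]; the Jacobian [sqrt p] cancels the weight put into [K].
    That [ds dt] is the area element is the theorem of Archimedes. *)
Let shell_latitude (u1 u2 u3 v1 v2 v3 k1 k2 k3 : R) :
  u1 * u1 + u2 * u2 + u3 * u3 = 1 -> v1 * v1 + v2 * v2 + v3 * v3 = 1 ->
  k1 * k1 + k2 * k2 + k3 * k3 = 1 -> u1 * v1 + u2 * v2 + u3 * v3 = 0 ->
  u1 * k1 + u2 * k2 + u3 * k3 = 0 -> v1 * k1 + v2 * k2 + v3 * k3 = 0 ->
  (\int[mu]_x \int[mu]_y \int[mu]_z K x y z = (2^-1)%:E *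
   \int[mu]_s (if (s ^+ 2 < 1)%R then \int[mu]_(t in `[0%R, (2 * pi)%R])
     H (Num.sqrt (1 - s ^+ 2) * (cos t * u1 + sin t * v1) + s * k1,
        Num.sqrt (1 - s ^+ 2) * (cos t * u2 + sin t * v2) + s * k2,
        Num.sqrt (1 - s ^+ 2) * (cos t * u3 + sin t * v3) + s * k3)%R else 0))%E.
Proof.
move=> uu vv kk uv uk vk.
pose K' (x y z : R) := K (u1 * x + v1 * y + k1 * z) (u2 * x + v2 * y + k2 * z) (u3 * x + v3 * y + k3 * z).
have mK' : measurable_fun setT (fun t : R * R * R => K' t.1.1 t.1.2 t.2).
  rewrite /K'; apply: (measurableT_comp (f := fun t : R * R * R => K t.1.1 t.1.2 t.2)
    (g := fun t : R * R * R => (u1 * t.1.1 + v1 * t.1.2 + k1 * t.2,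
      u2 * t.1.1 + v2 * t.1.2 + k2 * t.2, u3 * t.1.1 + v3 * t.1.2 + k3 * t.2))) => //.
  by meas.
have K'0 x y z : (0 <= K' x y z)%E by exact: K0.
set L := integral _ _ (fun s => if _ then _ else _).
have mK'c d (T : measurableType d) (f g h : T -> R) : measurable_fun setT f ->
    measurable_fun setT g -> measurable_fun setT h ->
    measurable_fun setT (fun x => K' (f x) (g x) (h x)).
  move=> mf mg mh; apply: (measurableT_comp (f := fun t : R * R * R => K' t.1.1 t.1.2 t.2)
    (g := fun x => (f x, g x, h x))) => //.
  by meas.
pose D (t : R) : bool := (0 <= t) && (t <= 2 * pi).
pose B (z q : R) : \bar R := (\int[mu]_(t in `[0%R, (2 * pi)%R])
  K' (Num.sqrt q * cos t)%R (Num.sqrt q * sin t)%R z)%E.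
have BE z q : B z q = (\int[mu]_t (if D t then K' (Num.sqrt q * cos t)%R (Num.sqrt q * sin t)%R z else 0))%E.
  exact: integral_itv_if.
have B0 z q : (0 <= B z q)%E by exact: integral_ge0.
have mB : measurable_fun setT (fun p : R * R => B p.1 p.2).
  under eq_fun do rewrite BE.
  apply: (@measurable_tonelli _ _ _ (fun (p : R * R) (t : R) =>
    if D t then K' (Num.sqrt p.2 * cos t) (Num.sqrt p.2 * sin t) p.1 else 0%E)).
    apply: measurable_fun_ifT; [by rewrite /D; meas|apply: mK'c; meas|by meas].
  by move=> p t; case: ifP.
have mBc d (T : measurableType d) (f g : T -> R) : measurable_fun setT f ->
    measurable_fun setT g -> measurable_fun setT (fun x => B (f x) (g x)).
  move=> mf mg; apply: (measurableT_comp (f := fun t : R * R => B t.1 t.2)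
    (g := fun x => (f x, g x))) => //.
  by meas.
pose E (z p : R) : \bar R := if z ^+ 2 < p then B z (p - z ^+ 2) else 0%E.
have E0 z p : (0 <= E z p)%E by rewrite /E; case: ifP.
have mE : measurable_fun setT (fun t : R * R => E t.1 t.2).
  by rewrite /E; apply: measurable_fun_ifT; [meas|apply: mBc; meas|meas].
transitivity (\int[mu]_z ((2^-1)%:E * \int[mu]_p E z p))%E.
  transitivity (\int[mu]_z \int[mu]_x \int[mu]_y K' x y z)%E.
    have mKz : measurable_fun setT (fun t : R * R * R => K' t.1.2 t.2 t.1.1) by apply: mK'c; meas.
    apply: (etrans _ (esym (@tonelli3 (fun z x y => K' x y z) mKz (fun z x y => K'0 x y z)))).
    by apply/esym/(@ge0_integral_frame (fun t => K t.1.1 t.1.2 t.2) u1 u2 u3 v1 v2 v3 k1 k2 k3).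
  apply: eq_integral => z _.
  have mKz : measurable_fun setT (fun t : R * R => K' t.1 t.2 z) by apply: mK'c; meas.
  apply: (etrans (ge0_integral_polar mKz (fun t => K'0 _ _ _))).
  have mBz : measurable_fun setT (B z) by apply: mBc; meas.
  apply: (etrans _ (ge0_integral_sqr_shift_half (z ^+ 2) mBz (B0 z))).
  apply: eq_integral => r _; case: ifP => r0; last by [].
  by congr (_ * _)%E; rewrite /B sqrtr_sqr gtr0_norm.
rewrite ge0_integralZl_EFin //=; last 2 first.
- by move=> z _; exact: integral_ge0.
- exact: (@measurable_tonelli _ _ _ E).
congr (_ * _)%E.
apply: (etrans (tonelli_swap mE (fun t => E0 _ _))); rewrite -[RHS]integral_cst12.
apply: eq_integral => p _; have [p0|p0] := ltP 0 p; last first.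
  rewrite integral0_eq => [|z _]; last first.
    by rewrite /E ltNge (le_trans p0) // sqr_ge0.
  by rewrite leNgt (le_lt_trans p0).
have sp : 0 < Num.sqrt p by rewrite sqrtr_gt0.
rewrite (@ge0_integral_affine_inv _ _ (Num.sqrt p) 0) ?gt_eqF //; last first.
  by rewrite /E; apply: measurable_fun_ifT; [meas|apply: mBc; meas|meas].
transitivity (\int[mu]_s (if (1 <= p)%R && (p <= 2)%R then
   (if (s ^+ 2 < 1)%R then \int[mu]_(t in `[0%R, (2 * pi)%R])
     H (Num.sqrt (1 - s ^+ 2) * (cos t * u1 + sin t * v1) + s * k1,
        Num.sqrt (1 - s ^+ 2) * (cos t * u2 + sin t * v2) + s * k2,
        Num.sqrt (1 - s ^+ 2) * (cos t * u3 + sin t * v3) + s * k3)%R else 0) else 0))%E; last first.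
  by case: ifP => // _; exact: integral0_eq.
apply: eq_integral => s _; rewrite /E addr0 exprMn sqr_sqrtr ?(ltW p0) //.
rewrite gtr_pMr //; case: ifP => [s1|_]; last by rewrite mule0; case: ifP.
rewrite gtr0_norm //.
have s1' : 0 <= 1 - s ^+ 2 by rewrite subr_ge0 ltW.
have mHt : measurable_fun setT (fun t : R => H (Num.sqrt (1 - s ^+ 2) * (cos t * u1 + sin t * v1) + s * k1,
        Num.sqrt (1 - s ^+ 2) * (cos t * u2 + sin t * v2) + s * k2,
        Num.sqrt (1 - s ^+ 2) * (cos t * u3 + sin t * v3) + s * k3)) by meas.
transitivity (\int[mu]_(t in `[0%R, (2 * pi)%R]) (if (1 <= p)%R && (p <= 2)%R then
     H (Num.sqrt (1 - s ^+ 2) * (cos t * u1 + sin t * v1) + s * k1,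
        Num.sqrt (1 - s ^+ 2) * (cos t * u2 + sin t * v2) + s * k2,
        Num.sqrt (1 - s ^+ 2) * (cos t * u3 + sin t * v3) + s * k3)%R else 0))%E; last first.
  by case: ifP => // _; exact: integral0_eq.
rewrite /B -ge0_integralZl_EFin //=; last by apply: measurable_funTS; apply: mK'c; meas.
apply: eq_integral => t _; rewrite /K'.
have -> : p - p * s ^+ 2 = p * (1 - s ^+ 2) by ring.
rewrite sqrtrM ?(ltW p0) //.
set w := Num.sqrt (1 - s ^+ 2).
have w2 : w ^+ 2 = 1 - s ^+ 2 by rewrite sqr_sqrtr.
have F (a b c : R) : a * (Num.sqrt p * w * cos t) + b * (Num.sqrt p * w * sin t) + c * (Num.sqrt p * s)
   = Num.sqrt p * (w * (cos t * a + sin t * b) + s * c) by ring.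
rewrite !F K_scale //.
  case: ifP => _; last by rewrite mule0.
  by rewrite muleA -EFinM mulfV ?gt_eqF // mul1e.
have -> : (w * (cos t * u1 + sin t * v1) + s * k1) ^+ 2 + (w * (cos t * u2 + sin t * v2) + s * k2) ^+ 2 +
   (w * (cos t * u3 + sin t * v3) + s * k3) ^+ 2 =
   w ^+ 2 * (cos t ^+ 2 * (u1 * u1 + u2 * u2 + u3 * u3) + sin t ^+ 2 * (v1 * v1 + v2 * v2 + v3 * v3)
     + 2 * cos t * sin t * (u1 * v1 + u2 * v2 + u3 * v3))
   + s ^+ 2 * (k1 * k1 + k2 * k2 + k3 * k3) + 2 * w * s * cos t * (u1 * k1 + u2 * k2 + u3 * k3)
   + 2 * w * s * sin t * (v1 * k1 + v2 * k2 + v3 * k3) by ring.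
by rewrite uu vv kk uv uk vk !mulr1 !mulr0 !addr0 cos2Dsin2 mulr1 w2 subrK.
Qed.

(** On the vertical line over [(x, y)] the substitution [p = x^2 + y^2 + z^2] has [dz = dp / (2 z)],
    and dilating [(x, y)] by [sqrt p] has Jacobian [p]. Together with the weight [1 / sqrt p] all
    powers of [p] cancel, leaving the factor [1 / 2] and the area density of the chart. Only the
    branch [z > 0] contributes. *)
Let shell_graph : (forall x y z, z <= 0 -> H (x, y, z) = 0%E) ->
  (\int[mu]_x \int[mu]_y \int[mu]_z K x y z = (2^-1)%:E *
   \int[mu]_x \int[mu]_y (if (x ^+ 2 + y ^+ 2 < 1)%R then
     ((Num.sqrt (1 - (x ^+ 2 + y ^+ 2)))^-1)%:E * H (x, y, Num.sqrt (1 - (x ^+ 2 + y ^+ 2)))%R else 0))%E.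
Proof.
move=> Hneg.
have mKc d (T : measurableType d) (f g h : T -> R) : measurable_fun setT f ->
    measurable_fun setT g -> measurable_fun setT h ->
    measurable_fun setT (fun x => K (f x) (g x) (h x)).
  move=> mf mg mh; apply: (measurableT_comp (f := fun t : R * R * R => K t.1.1 t.1.2 t.2)
    (g := fun x => (f x, g x, h x))) => //.
  by meas.
pose b (x y q : R) := ((2 * Num.sqrt q)^-1%:E * K x y (Num.sqrt q))%E.
have b0 x y q : (0 <= b x y q)%E by rewrite mule_ge0 // lee_fin invr_ge0 mulr_ge0 // sqrtr_ge0.
have mbc d (T : measurableType d) (f g h : T -> R) : measurable_fun setT f ->
    measurable_fun setT g -> measurable_fun setT h ->
    measurable_fun setT (fun x => b (f x) (g x) (h x)).
  by move=> mf mg mh; rewrite /b; apply: emeasurable_funM; [meas|apply: mKc; meas].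
pose E (p x y : R) : \bar R := if x ^+ 2 + y ^+ 2 < p then b x y (p - (x ^+ 2 + y ^+ 2)) else 0%E.
have E0 p x y : (0 <= E p x y)%E by rewrite /E; case: ifP.
have mE : measurable_fun setT (fun t : R * R * R => E t.1.1 t.1.2 t.2).
  by rewrite /E; apply: measurable_fun_ifT; [meas|apply: mbc; meas|meas].
transitivity (\int[mu]_x \int[mu]_y \int[mu]_p E p x y)%E.
  apply: eq_integral => x _; apply: eq_integral => y _.
  transitivity (\int[mu]_z (if (0 < z)%R then (2 * z)%:E * b x y (z ^+ 2)%R else 0))%E.
    apply: eq_integral => z _; have [z0|z0] := ltP 0 z; last first.
      rewrite /K; case: ifP => // _; rewrite Hneg ?mule0 //.
      by rewrite mulr_le0_ge0 // invr_ge0 sqrtr_ge0.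
    rewrite /b sqrtr_sqr gtr0_norm // muleA -EFinM mulfV ?mul1e //.
    by rewrite mulf_neq0 ?gt_eqF.
  have mbxy : measurable_fun setT (b x y) by apply: mbc; meas.
  exact: (ge0_integral_sqr_shift (x ^+ 2 + y ^+ 2) mbxy (b0 x y)).
apply: (etrans (esym (tonelli3 mE E0))).
set L := integral _ _ (fun x => integral _ _ (fun y => if _ then _ else _)).
have L0 : (0 <= L)%E.
  apply: integral_ge0 => x _; apply: integral_ge0 => y _; case: ifP => // _.
  by rewrite mule_ge0 // lee_fin invr_ge0 sqrtr_ge0.
rewrite -[RHS]integral_cst12.
apply: eq_integral => p _; have [p0|p0] := ltP 0 p; last first.
  rewrite integral0_eq => [|x _]; last first.
    rewrite integral0_eq // => y _.
    by rewrite /E ltNge (le_trans p0) // addr_ge0 ?sqr_ge0.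
  by rewrite leNgt (le_lt_trans p0).
have sp : 0 < Num.sqrt p by rewrite sqrtr_gt0.
have dp : Num.sqrt p * Num.sqrt p - 0 * 0 = p by rewrite mulr0 subr0 -expr2 sqr_sqrtr ?(ltW p0).
have mEp : measurable_fun setT (fun t : R * R => E p t.1 t.2).
  by rewrite /E; apply: measurable_fun_ifT; [meas|apply: mbc; meas|meas].
have := @ge0_integral_linear2 _ (fun t => E p t.1 t.2) (Num.sqrt p) 0 0 (Num.sqrt p) 0 0 mEp.
rewrite dp (gtr0_norm p0) gt_eqF // => /(_ (fun t => E0 _ _ _) isT) /= /(congr1 (fun x => p%:E * x)%E).
rewrite muleA -EFinM mulfV ?gt_eqF // mul1e => <-.
pose c : \bar R := if (1 <= p) && (p <= 2) then (2^-1 / p)%:E else 0%E.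
have c0 : (0 <= c)%E.
  by rewrite /c; case: ifP => // _; rewrite lee_fin divr_ge0 ?invr_ge0 // ltW.
pose M (x y : R) : \bar R := if x ^+ 2 + y ^+ 2 < 1 then
     (((Num.sqrt (1 - (x ^+ 2 + y ^+ 2)))^-1)%:E * H (x, y, Num.sqrt (1 - (x ^+ 2 + y ^+ 2)))%R)%E else 0%E.
have M0 x y : (0 <= M x y)%E.
  by rewrite /M; case: ifP => // _; rewrite mule_ge0 // lee_fin invr_ge0 sqrtr_ge0.
have mM : measurable_fun setT (fun t : R * R => M t.1 t.2) by rewrite /M; meas.
transitivity (p%:E * (c * L))%E; last first.
  rewrite /c; case: ifP => _; last by rewrite mul0e mule0.
  by rewrite muleA -EFinM mulrC divfK // gt_eqF.
congr (_ * _)%E.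
rewrite -[L]/(\int[mu]_x \int[mu]_y M x y)%E -ge0_integralZl //; last 2 first.
- exact: (@measurable_tonelli _ _ _ M).
- by move=> x _; exact: integral_ge0.
apply: eq_integral => x _; rewrite -ge0_integralZl //; last by rewrite /M; meas.
apply: eq_integral => y _.
rewrite mul0r addr0 addr0 mul0r add0r addr0 /E !exprMn sqr_sqrtr ?(ltW p0) // -mulrDr gtr_pMr //.
rewrite /M; case: ifP => [xy1|_]; last by rewrite mule0.
have w0 : 0 < 1 - (x ^+ 2 + y ^+ 2) by rewrite subr_gt0.
have -> : p - p * (x ^+ 2 + y ^+ 2) = p * (1 - (x ^+ 2 + y ^+ 2)) by ring.
rewrite /b sqrtrM ?(ltW p0) //.
set w := Num.sqrt (1 - (x ^+ 2 + y ^+ 2)).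
have w2 : w ^+ 2 = 1 - (x ^+ 2 + y ^+ 2) by rewrite sqr_sqrtr ?ltW.
have wp : 0 < w by rewrite sqrtr_gt0.
rewrite K_scale //; last by rewrite w2 addrC subrK.
rewrite /c; case: ifP => _; last by rewrite mul0e mule0.
rewrite !muleA -!EFinM; congr (_%:E * _)%E.
have -> : 2^-1 / p / w = 2^-1 / (Num.sqrt p ^+ 2) / w by rewrite sqr_sqrtr ?(ltW p0).
by field; rewrite !gt_eqF.
Qed.

(** Both evaluations of the shell carry the same factor [2^-1]. This is the passage from the circles
    used by [Mop] to the graph chart, whatever the axis [k]. *)
Lemma ge0_integral_sphere (u1 u2 u3 v1 v2 v3 k1 k2 k3 : R) :
  (forall x y z, z <= 0 -> H (x, y, z) = 0%E) ->
  u1 * u1 + u2 * u2 + u3 * u3 = 1 -> v1 * v1 + v2 * v2 + v3 * v3 = 1 ->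
  k1 * k1 + k2 * k2 + k3 * k3 = 1 -> u1 * v1 + u2 * v2 + u3 * v3 = 0 ->
  u1 * k1 + u2 * k2 + u3 * k3 = 0 -> v1 * k1 + v2 * k2 + v3 * k3 = 0 ->
  (\int[mu]_s (if (s ^+ 2 < 1)%R then \int[mu]_(t in `[0%R, (2 * pi)%R])
     H (Num.sqrt (1 - s ^+ 2) * (cos t * u1 + sin t * v1) + s * k1,
        Num.sqrt (1 - s ^+ 2) * (cos t * u2 + sin t * v2) + s * k2,
        Num.sqrt (1 - s ^+ 2) * (cos t * u3 + sin t * v3) + s * k3)%R else 0) =
   \int[mu]_x \int[mu]_y (if (x ^+ 2 + y ^+ 2 < 1)%R then
     ((Num.sqrt (1 - (x ^+ 2 + y ^+ 2)))^-1)%:E * H (x, y, Num.sqrt (1 - (x ^+ 2 + y ^+ 2)))%R else 0))%E.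
Proof.
move=> Hneg uu vv kk uv uk vk.
have := shell_latitude uu vv kk uv uk vk; rewrite (shell_graph Hneg).
move=> /(congr1 (fun x => 2%:E * x)%E); rewrite !muleA -!EFinM mulfV ?pnatr_eq0 // !mul1e.
exact: esym.
Qed.

End sphere.
End polar.

(** * Logarithmic integrals *)

Section log_integral.
Variable R : realType.
Local Notation mu := (@lebesgue_measure R).

(* Unlike [ln], which is 0 at 0, this turns products into sums without exception. *)
Definition nlog (x : R) : \bar R := if x == 0 then +oo%E else (- ln `|x|)%:E.

Lemma measurable_nlog : measurable_fun setT nlog.
Proof.
apply: measurable_fun_ifT; [|by meas|].
  by apply: measurable_fun_eqr; meas.
by apply/measurable_EFinP; meas.
Qed.

Lemma nlogM (x y : R) : nlog (x * y) = (nlog x + nlog y)%E.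
Proof.
rewrite /nlog mulf_eq0; have [x0|x0] := eqVneq x 0; have [y0|y0] //= := eqVneq y 0.
by rewrite normrM lnM ?posrE ?normr_gt0 // opprD EFinD.
Qed.

Lemma nlogN (x : R) : nlog (- x) = nlog x.
Proof. by rewrite /nlog oppr_eq0 normrN. Qed.

Lemma nlog_norm (x : R) : nlog `|x| = nlog x.
Proof. by rewrite /nlog normr_eq0 normr_id. Qed.

Lemma nlog_ge0 (x : R) : `|x| <= 1 -> (0 <= nlog x)%E.
Proof.
by move=> x1; rewrite /nlog; case: ifP => // _; rewrite lee_fin oppr_ge0 ln_le0.
Qed.

(** From [ln y <= y - 1] at [y = 1 / sqrt x]. It supplies a majorant of the logarithm that is
    integrable at 0. *)
Lemma oppln_le_sqrtV (x : R) : 0 < x -> - ln x <= 2 / Num.sqrt x.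
Proof.
move=> x0; have s0 : 0 < Num.sqrt x by rewrite sqrtr_gt0.
have -> : ln x = 2 * ln (Num.sqrt x).
  by rewrite -{1}[x](sqr_sqrtr (ltW x0)) lnXn // mulr_natl.
rewrite -mulrN -lnV ?posrE // ler_pM2l //.
have -> : (Num.sqrt x)^-1 = 1 + ((Num.sqrt x)^-1 - 1) by ring.
apply: (le_trans (le_ln1Dx _)); last by lra.
by rewrite ltrBrDl subrr invr_gt0.
Qed.

Lemma integral_nlog_unit : (\int[mu]_x (if (`|x| <= 1)%R then nlog x else 0) < +oo)%E.
Proof.
have mn := measurable_nlog.
pose h (x : R) : \bar R := if `|x| <= 1 then nlog x else 0%E.
have h0 x : (0 <= h x)%E by rewrite /h; case: ifP => // /nlog_ge0.
have mh : measurable_fun setT h by rewrite /h; meas.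
have -> : (\int[mu]_x (if (`|x| <= 1)%R then nlog x else 0) = \int[mu]_x h `|x|%R)%E.
  by apply: eq_integral => x _; rewrite /h normr_id nlog_norm.
rewrite integral_even // lte_mul_pinfty //.
pose b (p : R) : \bar R := if p <= 1 then (2 / Num.sqrt p)%:E else 0%E.
have b0 p : (0 <= b p)%E.
  by rewrite /b; case: ifP => // _; rewrite lee_fin divr_ge0 // sqrtr_ge0.
have mb : measurable_fun setT b by rewrite /b; meas.
apply: (@le_lt_trans _ _ (\int[mu]_p (if (0 < p)%R then b p else 0))%E).
  apply: ge0_le_integral => //.
  - by move=> x _; case: ifP.
  - by meas.
  - by meas.
  - move=> x _; case: ifP => // x0; rewrite /h /b gtr0_norm //; case: ifP => // x1.
    by rewrite /nlog gt_eqF // gtr0_norm // lee_fin oppln_le_sqrtV.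
(* In the variable [z = sqrt p] the majorant [2 / sqrt p] becomes the constant 4 on [[0, 1]]. *)
rewrite -ge0_integral_sqr //.
apply: (@le_lt_trans _ _ (\int[mu]_(z in `[0%R, 1%R]) (cst 4%:E z))%E); last first.
  by rewrite integral_cst //= lebesgue_measure_itv /= lte_fin ltr01 sube0 mule1 ltry.
rewrite integral_itv_if; apply: ge0_le_integral => //.
- by move=> z _; case: ifP => // z0; rewrite mule_ge0 // lee_fin mulr_ge0 // ltW.
- by meas.
- by meas.
- move=> z _; case: ifP => z0; last by case: ifP => // _; rewrite lee_fin.
  rewrite /b; case: ifP => z1; last by rewrite mule0; case: ifP => // _; rewrite lee_fin.
  have z1' : z <= 1 by rewrite -(@ler_sqr_ge0 _ z 1) ?expr1n // ltW.
  rewrite (ltW z0) z1' /= sqrtr_sqr gtr0_norm // -EFinM lee_fin.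
  by have -> : 2 * z * (2 / z) = 4 by field; rewrite gt_eqF.
Qed.

(** Halving [s] brings it into the unit interval, where [nlog] is nonnegative; at [s = 0] the
    right-hand side is infinite. *)
Lemma norm_ln_le (s : R) : `|s| <= 2 -> ((`|ln `|s| |)%:E <= nlog (s / 2) + (ln 2)%:E)%E.
Proof.
move=> s2; rewrite /nlog; have [->|s0] := eqVneq s 0.
  by rewrite mul0r eqxx addye // leey.
have h0 : s / 2 != 0 by rewrite mulf_neq0 // invr_eq0 pnatr_eq0.
have ns : 0 < `|s| by rewrite normr_gt0.
rewrite (negbTE h0) normf_div (gtr0_norm (ltr0n _ 2)) ln_div ?posrE //.
rewrite -EFinD lee_fin.
have l2 : ln `|s| <= ln 2 by rewrite ler_ln ?posrE.
have l0 : 0 <= ln 2 :> R by rewrite ln_ge0 // ler1n.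
by rewrite ler_norml; apply/andP; split; lra.
Qed.

Lemma integral_norm_ln (c : R) : `|c| <= 1 ->
  (\int[mu]_(s in `[(-1)%R, 1%R]) (`|ln `|s - c| |)%:E < +oo)%E.
Proof.
move=> c1; have mn := measurable_nlog.
pose h (u : R) : \bar R := if `|u| <= 1 then nlog u else 0%E.
have h0 x : (0 <= h x)%E by rewrite /h; case: ifP => // /nlog_ge0.
have mh : measurable_fun setT h by rewrite /h; meas.
have l0 : 0 <= ln 2 :> R by rewrite ln_ge0 // ler1n.
rewrite integral_itv_if.
apply: (@le_lt_trans _ _ (\int[mu]_s (h (2^-1 * s + (- c / 2))%R +
   (if ((-1) <= s)%R && (s <= 1)%R then (ln 2)%:E else 0)))%E).
  apply: ge0_le_integral => //.
  - by move=> s _; case: ifP => // _; rewrite lee_fin.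
  - by meas.
  - by apply: emeasurable_funD; meas.
  - move=> s _; case: ifP => [/andP[s1 s2]|_]; last by rewrite adde0.
    have sc : `|s - c| <= 2.
      by move: c1; rewrite !ler_norml => /andP[]; lra.
    have -> : 2^-1 * s + - c / 2 = (s - c) / 2 by field.
    rewrite /h normf_div (gtr0_norm (ltr0n _ 2)) ler_pdivrMr // mul1r sc.
    exact: norm_ln_le.
rewrite ge0_integralD //; last 3 first.
- by meas.
- by move=> s _; case: ifP => // _; rewrite lee_fin.
- by meas.
rewrite ge0_integral_affine // lte_add_pinfty //.
  by rewrite lte_mul_pinfty // integral_nlog_unit.
rewrite -(integral_itv_if (cst (ln 2)%:E)) integral_cst //= lebesgue_measure_itv /= lte_fin.
by rewrite ifT ?ltry //; lra.
Qed.

Lemma integrable_cst_itv (a b c : R) : mu.-integrable `[a, b] (fun=> c%:E).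
Proof.
apply/integrableP; split; first exact: measurable_cst.
rewrite integral_cst //= lebesgue_measure_itv /=; case: ifP => _; last by rewrite mule0 ltry.
by rewrite -EFinB -EFinM ltry.
Qed.

(** Doubling the angle runs through two periods, which the Jacobian [1 / 2] compensates. *)
Lemma integral_double (P : R -> \bar R) : measurable_fun setT P ->
  (forall x, 0 <= P x)%E -> (forall x, P (x + 2 * pi) = P x) ->
  (\int[mu]_(t in `[0%R, (2 * pi)%R]) P (2 * t)%R = \int[mu]_(t in `[0%R, (2 * pi)%R]) P t)%E.
Proof.
move=> mP P0 Pp.
have pi0 : 0 < pi :> R := pi_gt0 R.
have toif (g : R -> \bar R) (a b : R) : measurable_fun setT g ->
    (\int[mu]_(x in `[a, b]) g x = \int[mu]_x (if (a < x)%R && (x <= b)%R then g x else 0))%E.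
  move=> mg; rewrite -integral_itv_obnd_cbnd; last exact: measurable_funTS.
  rewrite (integral_if mu (fun x : R => (a < x) && (x <= b))).
  by congr (integral _ _ _); apply/seteqP; split => x /=; rewrite in_itv.
rewrite !toif //; last by meas.
pose Q (a b x : R) : \bar R := if (a < x) && (x <= b) then P x else 0%E.
have mQ a b : measurable_fun setT (Q a b) by rewrite /Q; meas.
have Q0 a b x : (0 <= Q a b x)%E by rewrite /Q; case: ifP.
transitivity (\int[mu]_t Q 0%R (4 * pi)%R (2 * t + 0)%R)%E.
  apply: eq_integral => t _; rewrite /Q addr0 pmulr_rgt0 //.
  have -> : 4 * pi = 2 * (2 * pi) :> R by ring.
  by rewrite ler_pM2l.
rewrite ge0_integral_affine //.
transitivity ((`|2|^-1)%:E * (\int[mu]_x (Q 0%R (2 * pi)%R x + Q (2 * pi)%R (4 * pi)%R x)))%E.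
  congr (_ * _)%E; apply: eq_integral => x _; rewrite /Q.
  have [xb|bx] := leP x (2 * pi); rewrite ?andbT ?andbF /=.
    have -> : x <= 4 * pi by lra.
    by rewrite andbT adde0.
  have -> : 0 < x by lra.
  by rewrite add0e.
rewrite ge0_integralD //; [|exact: mQ|exact: mQ].
have -> : (\int[mu]_x Q (2 * pi)%R (4 * pi)%R x = \int[mu]_x Q 0%R (2 * pi)%R x)%E.
  rewrite (@ge0_integral_affine_inv _ _ 1 (2 * pi)) ?oner_eq0 //.
  apply: eq_integral => x _; rewrite normr1 mul1e mul1r /Q Pp.
  congr (if _ && _ then _ else _); first by rewrite ltrDr.
  by rewrite -lerBrDr; congr (_ <= _); ring.
have I0 : (0 <= \int[mu]_x Q 0%R (2 * pi)%R x)%E by exact: integral_ge0.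
rewrite gtr0_norm //.
have -> (e : \bar R) : (0 <= e -> (2^-1)%:E * (e + e) = e)%E.
  by move=> e0; rewrite ge0_muleDr // -ge0_muleDl ?lee_fin ?invr_ge0 // -EFinD
    (_ : 2^-1 + 2^-1 = 1)%R ?mul1e //; field.
by [].
by [].
Qed.

Lemma norm_cos_le1 (x : R) : `|cos x| <= 1.
Proof. by rewrite ler_norml cos_geN1 cos_le1. Qed.

Lemma norm_sin_le1 (x : R) : `|sin x| <= 1.
Proof. by rewrite ler_norml sin_geN1 sin_le1. Qed.

Let I := (\int[mu]_(t in `[0%R, (2 * pi)%R]) nlog (cos t))%E.

Let I_ge0 : (0 <= I)%E.
Proof. by apply: integral_ge0 => t _; exact: nlog_ge0 (norm_cos_le1 t). Qed.

(* Compare the integral of -ln|x| over the unit disc in Cartesian and polar coordinates. *)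
Let I_lty : (I < +oo)%E.
Proof.
have mn := measurable_nlog.
have pi0 : 0 < pi :> R := pi_gt0 R.
pose F (p : R * R) : \bar R := if p.1 ^+ 2 + p.2 ^+ 2 <= 1 then nlog p.1 else 0%E.
have F0 p : (0 <= F p)%E.
  rewrite /F; case: ifP => // p1; apply: nlog_ge0.
  rewrite -(@ler_sqr_ge0 _ _ 1) // expr1n real_normK ?num_real //.
  by apply: le_trans p1; rewrite lerDl sqr_ge0.
have mF : measurable_fun setT F by rewrite /F; meas.
have up : (\int[mu]_x \int[mu]_y F (x, y) < +oo)%E.
  pose h (u : R) : \bar R := if `|u| <= 1 then nlog u else 0%E.
  have h0 x : (0 <= h x)%E by rewrite /h; case: ifP => // /nlog_ge0.
  have mh : measurable_fun setT h by rewrite /h; meas.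
  apply: (@le_lt_trans _ _ (\int[mu]_x (2%:E * h x))%E); last first.
    by rewrite ge0_integralZl_EFin // lte_mul_pinfty // integral_nlog_unit.
  apply: ge0_le_integral => //.
  - by move=> x _; exact: integral_ge0.
  - by apply: (@measurable_tonelli _ _ _ (fun x y : R => F (x, y))) => //; meas.
  - by meas.
  - move=> x _.
    have -> : (2%:E * h x = \int[mu]_(y in `[(-1)%R, 1%R]) (cst (h x) y))%E.
      rewrite integral_cst //= lebesgue_measure_itv /= lte_fin ifT; last by lra.
      by rewrite muleC -EFinB opprK.
    rewrite integral_itv_if; apply: ge0_le_integral => //.
    + by meas.
    + by meas.
    + move=> y _; rewrite /F /=; case: ifP => xy; last by case: ifP.
      have x1 : `|x| <= 1.
        rewrite -(@ler_sqr_ge0 _ _ 1) // expr1n real_normK ?num_real //.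
        by apply: le_trans xy; rewrite lerDl sqr_ge0.
      have : `|y| <= 1.
        rewrite -(@ler_sqr_ge0 _ _ 1) // expr1n real_normK ?num_real //.
        by apply: le_trans xy; rewrite lerDr sqr_ge0.
      by rewrite ler_norml => ->; rewrite /h x1.
(* In polar coordinates [nlog (r cos t) = nlog r + nlog (cos t)] is at least [nlog (cos t)] when
   [r <= 1]. The disc integral therefore dominates [I] times the integral of [r] over [[0, 1]], that
   is [I / 2]; [b] is the cut-off written in terms of [r^2]. *)
pose b (p : R) : \bar R := if p <= 1 then I else 0%E.
have b0 p : (0 <= b p)%E by rewrite /b; case: ifP.
have mb : measurable_fun setT b by rewrite /b; meas.
have lb : (\int[mu]_r (if (0 < r)%R then r%:E * b (r ^+ 2)%R else 0) = (2^-1)%:E * I)%E.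
  rewrite (@ge0_integral_sqr_shift_half _ b 0) //; congr (_ * _)%E.
  transitivity (\int[mu]_(p in `[0%R, 1%R]) (cst I p))%E.
    rewrite -integral_itv_obnd_cbnd; last by apply: measurable_funTS; meas.
    rewrite [RHS]integral_mkcond; apply: eq_integral => p _; rewrite patchE mem_setE in_itv /= subr0.
    by rewrite /b; case: ltP.
  by rewrite integral_cst //= lebesgue_measure_itv /= lte_fin ltr01 sube0 mule1.
have : ((2^-1)%:E * I < +oo)%E.
  apply: le_lt_trans up; rewrite -lb ge0_integral_polar //.
  pose J (r : R) : \bar R := (\int[mu]_(t in `[0%R, (2 * pi)%R]) F (r * cos t, r * sin t)%R)%E.
  have J0 r : (0 <= J r)%E by exact: integral_ge0.
  apply: ge0_le_integral => //.
  - by move=> r _; case: ifP => // r0; rewrite mule_ge0 // lee_fin ltW.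
  - by meas.
  - have mJ : measurable_fun setT J.
      have -> : J = (fun r => \int[mu]_t (if ((0 <= t) && (t <= 2 * pi))%R then F (r * cos t, r * sin t)%R else 0))%E.
        by apply/funext => r; exact: integral_itv_if.
      apply: (@measurable_tonelli _ _ _ (fun r t : R => if ((0 <= t) && (t <= 2 * pi))%R
        then F (r * cos t, r * sin t)%R else 0%E)); first by meas.
      by move=> x y; case: ifP.
    by meas.
  - move=> r _; case: ifP => // r0; apply: lee_wpmul2l; first by rewrite lee_fin ltW.
    rewrite /b; case: ifP => r1; last exact: J0.
    apply: ge0_le_integral => //.
    + by move=> t _; exact: nlog_ge0 (norm_cos_le1 t).
    + by apply: measurable_funTS; meas.
    + by apply: measurable_funTS; meas.
    + move=> t _; rewrite /F /= !exprMn -mulrDr cos2Dsin2 mulr1 r1 nlogM leeDr //.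
      apply: nlog_ge0; rewrite -(@ler_sqr_ge0 _ _ 1) // expr1n real_normK ?num_real //.
case: (I) I_ge0 => [r|_|//]; first by move=> _ _; rewrite ltry.
by rewrite mulr_infty gtr0_sg ?invr_gt0 // mul1e.
Qed.

Let integral_nlog_sin :
  (\int[mu]_(t in `[0%R, (2 * pi)%R]) nlog (sin t) = I)%E.
Proof.
have mn := measurable_nlog.
have mc : measurable_fun setT (fun t : R => nlog (cos t)) by meas.
have pi0 : 0 < pi :> R := pi_gt0 R.
rewrite /I -(@integral_periodic _ (fun t => nlog (cos t)) _ (pi / 2)) //.
- by apply: eq_integral => t _; rewrite cosDpihalf nlogN.
- by move=> t; exact: nlog_ge0 (norm_cos_le1 t).
- by move=> t; rewrite [2 * pi]mulr_natl cosD2pi.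
- by apply/andP; split; lra.
Qed.

(** The duplication argument of Euler: [sin (2 t) = 2 sin t cos t], and the integrals of [nlog] of
    [sin (2 t)], [sin t] and [cos t] are all [I], so [I + 2 pi ln 2 = I + I]. Finiteness of [I]
    allows the cancellation. *)
Let I_val : I = (2 * pi * ln 2)%:E.
Proof.
have mn := measurable_nlog.
have pi0 : 0 < pi :> R := pi_gt0 R.
have ln20 : 0 <= ln 2 :> R by rewrite ln_ge0 // ler1n.
have mc : measurable_fun setT (fun t : R => nlog (cos t)) by meas.
have ms : measurable_fun setT (fun t : R => nlog (sin t)) by meas.
have ms2 : measurable_fun setT (fun t : R => nlog (sin (2 * t))) by meas.
have c0 t : (0 <= nlog (cos t))%E by exact: nlog_ge0 (norm_cos_le1 t).
have s0 t : (0 <= nlog (sin t))%E by exact: nlog_ge0 (norm_sin_le1 t).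
have E : (I + (2 * pi * ln 2)%:E = I + I)%E.
  transitivity (\int[mu]_(t in `[0%R, (2 * pi)%R]) (nlog (sin (2 * t)%R) + (ln 2)%:E))%E.
    rewrite ge0_integralD //; last exact: measurable_funTS.
    rewrite (@integral_double (fun t => nlog (sin t))) //; last first.
      by move=> t; rewrite [2 * pi]mulr_natl sinD2pi.
    rewrite integral_nlog_sin integral_cst //= lebesgue_measure_itv /= lte_fin.
    by rewrite mulr_gt0 // sube0 -EFinM [ln 2 * _]mulrC.
  rewrite -{1}integral_nlog_sin -ge0_integralD //; [|exact: measurable_funTS|exact: measurable_funTS].
  apply: eq_integral => t _; rewrite mulr_natl mulr2n sinD.
  have -> : sin t * cos t + cos t * sin t = 2 * (sin t * cos t) by ring.
  rewrite nlogM nlogM addeC addeA {1}/nlog pnatr_eq0 /= gtr0_norm // -EFinD subrr add0e //.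
move: E I_ge0 I_lty; case: I => //= r [] E _ _; congr EFin.
by move: E; lra.
Qed.

(** Let [a = sqrt (A^2 + B^2)]. Since [|b| <= a], one can write [b = a cos g], and
    [A cos t + B sin t = a cos (t - c)]. The sum of the two cosines is twice a product of cosines of
    half angles, so after division by [2 a] the [nlog] is a sum of two translates of [P], which has
    period [2 pi] because [|cos|] has period [pi]. Each integrates to [I], and [g], hence [b],
    disappears. *)
Lemma integral_nlog_affine_cos (A B b : R) : 0 < A ^+ 2 + B ^+ 2 -> b ^+ 2 <= A ^+ 2 + B ^+ 2 ->
  (\int[mu]_(t in `[0%R, (2 * pi)%R])
     nlog ((A * cos t + B * sin t + b) / (2 * Num.sqrt (A ^+ 2 + B ^+ 2)))%R
   = (4 * pi * ln 2)%:E)%E.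
Proof.
move=> a2 b2; set a := Num.sqrt _.
have mn := measurable_nlog.
have pi0 : 0 < pi :> R := pi_gt0 R.
have a0 : 0 < a by rewrite sqrtr_gt0.
have ba : `|b / a| <= 1.
  rewrite normf_div (gtr0_norm a0) ler_pdivrMr // mul1r -ler_sqr_ge0 ?(ltW a0) //.
  by rewrite real_normK ?num_real // sqr_sqrtr // ltW.
have [|/andP[g0 g1] bE] := @acos_def _ (b / a); first by rewrite -ler_norml.
set g := acos _ in g0 g1 bE.
have [c /andP[c1 c2] [AE BE]] := cos_sin_angle A B; rewrite -/a in AE BE.
pose P (t : R) := nlog (cos (t / 2)).
have mP : measurable_fun setT P by rewrite /P; meas.
have P0 t : (0 <= P t)%E by exact: nlog_ge0 (norm_cos_le1 _).
have Pp t : P (t + 2 * pi) = P t.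
  rewrite /P; have -> : (t + 2 * pi) / 2 = t / 2 + pi by field.
  by rewrite cosDpi nlogN.
have PI : (\int[mu]_(t in `[0%R, (2 * pi)%R]) P t = I)%E.
  rewrite -integral_double //; apply: eq_integral => t _; rewrite /P.
  by congr (nlog (cos _)); field.
transitivity (\int[mu]_(t in `[0%R, (2 * pi)%R]) (P (t + (g - c))%R + P (t + (- g - c))%R))%E.
  apply: eq_integral => t _; rewrite /P -nlogM; congr nlog.
  have -> : b = a * cos g by rewrite bE; field; rewrite gt_eqF.
  rewrite {1}AE {1}BE.
  have -> : a * cos c * cos t + a * sin c * sin t + a * cos g
      = a * (cos (t - c) + cos g) by rewrite cosB; ring.
  set p := (t + (g - c)) / 2; set q := (t + (- g - c)) / 2.
  have -> : t - c = p + q by rewrite /p /q; field.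
  have -> : g = p - q by rewrite /p /q; field.
  by rewrite cosD cosB; field; rewrite gt_eqF.
rewrite ge0_integralD //; last 2 first.
- by apply: measurable_funTS; meas.
- by apply: measurable_funTS; meas.
rewrite !integral_periodic //; try by apply/andP; split; lra.
by rewrite PI I_val -EFinD; congr EFin; ring.
Qed.

(** The previous identity for [ln], which takes the value 0 instead of minus infinity at a zero of
    its argument. The bound [|u t| <= 2 a] makes the normalised [nlog] nonnegative, so the value of
    its integral already gives integrability. *)
Lemma integral_ln_affine_cos (A B b : R) : 0 < A ^+ 2 + B ^+ 2 -> b ^+ 2 <= A ^+ 2 + B ^+ 2 ->
  mu.-integrable `[0, 2 * pi] (fun t => (ln `|A * cos t + B * sin t + b|)%:E) /\
  (\int[mu]_(t in `[0%R, (2 * pi)%R]) (ln `|A * cos t + B * sin t + b|)%:E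
   = (2 * pi * ln (Num.sqrt (A ^+ 2 + B ^+ 2) / 2))%:E)%E.
Proof.
move=> a2 b2; have := integral_nlog_affine_cos a2 b2; set a := Num.sqrt _.
have mn := measurable_nlog.
have pi0 : 0 < pi :> R := pi_gt0 R.
have a0 : 0 < a by rewrite sqrtr_gt0.
pose u (t : R) := A * cos t + B * sin t + b; rewrite -/(u _).
have mu_ : measurable_fun setT u by rewrite /u; meas.
move=> Iu.
have ua t : `|u t / (2 * a)| <= 1.
  rewrite normf_div (gtr0_norm (mulr_gt0 _ a0)) // ler_pdivrMr ?mulr_gt0 // mul1r.
  have ab : `|b| <= a.
    by rewrite -ler_sqr_ge0 ?(ltW a0) // real_normK ?num_real // sqr_sqrtr // ltW.
  apply: (le_trans (ler_normD _ _)).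
  have -> : 2 * a = a + a by ring.
  apply: lerD => //; rewrite -ler_sqr_ge0 ?(ltW a0) // real_normK ?num_real // sqr_sqrtr ?(ltW a2) //.
  have <- : (A * cos t + B * sin t) ^+ 2 + (A * sin t - B * cos t) ^+ 2 = A ^+ 2 + B ^+ 2.
    have -> : (A * cos t + B * sin t) ^+ 2 + (A * sin t - B * cos t) ^+ 2 =
      (A ^+ 2 + B ^+ 2) * (cos t ^+ 2 + sin t ^+ 2) by ring.
    by rewrite cos2Dsin2 mulr1.
  by rewrite lerDl sqr_ge0.
pose N (t : R) := nlog (u t / (2 * a)).
have mN : measurable_fun `[0, 2 * pi] N by apply: measurable_funTS; rewrite /N; meas.
have N0 t : (0 <= N t)%E by exact: nlog_ge0.
have iN : mu.-integrable `[0, 2 * pi] N.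
  apply/integrableP; split=> //.
  under eq_integral do rewrite gee0_abs //.
  by rewrite Iu ltry.
have ic : mu.-integrable `[0, 2 * pi] (fun=> (ln (2 * a))%:E).
  exact: integrable_cst_itv.
have iB : mu.-integrable `[0, 2 * pi] (fun t => (ln (2 * a))%:E - N t)%E by exact: integrableB.
have ml : measurable_fun setT (fun t => (ln `|u t|)%:E) by meas.
have lnu t : u t != 0 -> ln `|u t| = ln (2 * a) + ln `|u t / (2 * a)|.
  move=> u0; have a20 : 0 < 2 * a by rewrite mulr_gt0.
  by rewrite normf_div (gtr0_norm a20) ln_div ?posrE ?normr_gt0 // addrC subrK.
have a2n : 2 * a != 0 by rewrite gt_eqF // mulr_gt0.
(* [N] is integrable, hence finite almost everywhere, and it is infinite exactly where [u] vanishes: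
   the points where [ln] and [nlog] disagree are negligible. *)
have ae : ae_eq mu (`[0, 2 * pi]%classic) (fun t : R => (ln (2 * a))%:E - N t)%E
    (fun t : R => (ln `|u t|)%:E).
  have aeN : {ae mu, forall t, `[0, 2 * pi]%classic t -> N t \is a fin_num} by exact: integrable_ae.
  move: aeN; apply: filterS; first exact: (ae_filter_ringOfSetsType mu).
  move=> t /= + Dt => /(_ Dt).
  rewrite /N /nlog mulf_eq0 invr_eq0 (negbTE a2n) orbF; case: ifPn => // u0 _.
  by rewrite -EFinB opprK lnu.
split; last first.
  transitivity (\int[mu]_(t in `[0%R, (2 * pi)%R]) ((ln (2 * a))%:E - N t))%E.
    apply/esym/ae_eq_integral => //; last exact: measurable_funTS.
    by have /integrableP[] := iB.
  rewrite integralB // integral_cst //= Iu lebesgue_measure_itv /= lte_fin mulr_gt0 // sube0.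
  rewrite -EFinM -EFinB; congr EFin.
  rewrite lnM ?posrE // ln_div ?posrE //; ring.
have ic' : mu.-integrable `[0, 2 * pi] (fun=> `|ln (2 * a)|%:E).
  exact: integrable_cst_itv.
apply: le_integrable (integrableD _ ic' iN) => //; first exact: measurable_funTS.
move=> t _ /=; rewrite [leRHS]gee0_abs; last by rewrite adde_ge0 // lee_fin.
rewrite /N /nlog mulf_eq0 invr_eq0 (negbTE a2n) orbF; case: ifPn => u0.
  by rewrite addey // leey.
have nn : 0 <= - ln `|u t / (2 * a)| by rewrite oppr_ge0 ln_le0.
rewrite -EFinD lee_fin -/(u t) lnu // (le_trans (ler_normD _ _)) // lerD2l.
by rewrite -normrN ger0_norm.
Qed.

End log_integral.

(** * Newtonian potential in the plane *)

Section transfer.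
Variable R : realType.

(** Lifts a substitution formula from nonnegative to signed integrands. Applied to [|h|] the formula
    gives integrability on the other side; applied to the positive and negative parts of [h] it
    gives the identity. The weights [a] and [b] hold Jacobians and indicators of domains. *)
Lemma integral_transfer d1 d2 d3 (X : measurableType d1) (Y : measurableType d2)
    (Z : measurableType d3) (mX : {measure set X -> \bar R}) (mY : {measure set Y -> \bar R})
    (phi : X -> Z) (psi : Y -> Z) (a : X -> R) (b : Y -> R) (h : Z -> R) :
  measurable_fun setT phi -> measurable_fun setT psi ->
  measurable_fun setT a -> measurable_fun setT b ->
  (forall x, 0 <= a x) -> (forall y, 0 <= b y) ->
  (forall H : Z -> \bar R, measurable_fun setT H -> (forall z, 0 <= H z)%E ->
    (\int[mX]_x ((a x)%:E * H (phi x)) = \int[mY]_y ((b y)%:E * H (psi y)))%E) ->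
  measurable_fun setT h ->
  mX.-integrable setT (fun x => (a x * h (phi x))%:E) ->
  mY.-integrable setT (fun y => (b y * h (psi y))%:E) /\
  (\int[mX]_x (a x * h (phi x))%:E = \int[mY]_y (b y * h (psi y))%:E)%E.
Proof.
move=> mphi mpsi ma mb a0 b0 AB mh iX.
have ABr (k : Z -> R) : measurable_fun setT k -> (forall z, 0 <= k z) ->
    (\int[mX]_x (a x * k (phi x))%:E = \int[mY]_y (b y * k (psi y))%:E)%E.
  move=> mk k0; have := AB (fun z => (k z)%:E); rewrite /= => -> //; by meas.
have mX_le (k : Z -> R) : measurable_fun setT k -> (forall z, `|k z| <= `|h z|) ->
    mX.-integrable setT (fun x => (a x * k (phi x))%:E).
  move=> mk kh; apply: le_integrable iX => //; first by meas.
  by move=> x _ /=; rewrite lee_fin !normrM ler_wpM2l.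
have toY (k : Z -> R) : measurable_fun setT k -> (forall z, `|k z| <= `|h z|) ->
    mY.-integrable setT (fun y => (b y * k (psi y))%:E).
  move=> mk kh; apply/integrableP; split; first by meas.
  have -> : (\int[mY]_y `|(b y * k (psi y))%:E| = \int[mY]_y (b y * `|k (psi y)|)%:E)%E.
    by apply: eq_integral => y _; rewrite /= normrM ger0_norm.
  rewrite -(ABr (fun z => `|k z|)) //; last by meas.
  have /integrableP[_] := mX_le _ mk kh.
  by under eq_integral do rewrite /= normrM ger0_norm //.
split; first exact: toY.
pose p z := Num.max (h z) 0; pose n z := Num.max (- h z) 0.
have mp : measurable_fun setT p by apply: measurable_maxr => //; meas.
have mn : measurable_fun setT n by apply: measurable_maxr => //; meas.
have p0 z : 0 <= p z by rewrite /p le_max lexx orbT.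
have n0 z : 0 <= n z by rewrite /n le_max lexx orbT.
have hE z : h z = p z - n z.
  rewrite /p /n; have [h0|h0] := leP 0 (h z).
    by have /max_idPr -> : - h z <= 0; rewrite ?subr0 // oppr_le0.
  by have /max_idPl -> : 0 <= - h z; rewrite ?sub0r ?opprK // oppr_ge0 ltW.
have ph z : `|p z| <= `|h z|.
  by rewrite ger0_norm // /p ge_max ler_norm normr_ge0.
have nh z : `|n z| <= `|h z|.
  by rewrite ger0_norm // /n ge_max -normrN ler_norm normr_ge0.
transitivity (\int[mX]_x ((a x * p (phi x))%:E - (a x * n (phi x))%:E))%E.
  by apply: eq_integral => x _; rewrite hE mulrBr EFinB.
rewrite integralB //; [|exact: mX_le|exact: mX_le].
rewrite !ABr // -integralB //; [|exact: toY|exact: toY].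
by apply: eq_integral => y _; rewrite hE mulrBr EFinB.
Qed.

End transfer.

Section plane.
Variable R : realType.
Local Notation mu := (@lebesgue_measure R).

Lemma lebesgue2_sigma_finite : sigma_finite setT (mu \x mu)%E.
Proof.
have /sigma_finiteP[F [TF ndF Foo]] := sigma_finiteT mu.
exists (fun n => F n `*` F n).
  rewrite -setXTT TF predeqE => -[x y]; split.
    move=> [/= [n _ Fnx] [k _ Gky]]; exists (maxn n k) => //; split.
    - by move: x Fnx; exact/subsetPset/ndF/leq_maxl.
    - by move: y Gky; exact/subsetPset/ndF/leq_maxr.
  by move=> [n _ []/= ? ?]; split; exists n.
move=> k; have [? ?] := Foo k.
split; first exact: measurableX.
by rewrite product_measure1E// lte_mul_pinfty// ge0_fin_numE.
Qed.

(** Packaged as a sigma-finite measure so that it can itself be a factor of a product: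
    [circle_average] applies Fubini to [mu \x lebesgue2 R]. *)
Definition lebesgue2 :
    {sigma_finite_measure set (measurableTypeR R * measurableTypeR R)%type -> \bar R} :=
  HB.pack (mu \x mu)%E (Measure_isSigmaFinite.Build _ _ _ (mu \x mu)%E lebesgue2_sigma_finite).

Lemma lebesgue2_tonelli (F : R * R -> \bar R) :
  measurable_fun setT F -> (forall x, 0 <= F x)%E ->
  (\int[lebesgue2]_z F z = \int[mu]_x \int[mu]_y F (x, y))%E.
Proof. by move=> mF F0; exact: fubini_tonelli1. Qed.

Lemma lebesgue2_fubini (F : R * R -> R) :
  lebesgue2.-integrable setT (fun z => (F z)%:E) ->
  (\int[lebesgue2]_z (F z)%:E = \int[mu]_x \int[mu]_y (F (x, y))%:E)%E.
Proof. by move=> iF; rewrite -(integral12_prod_meas1 iF). Qed.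

Lemma lebesgue2_fubini_swap (F : R * R -> R) :
  lebesgue2.-integrable setT (fun z => (F z)%:E) ->
  (\int[lebesgue2]_z (F z)%:E = \int[mu]_y \int[mu]_x (F (x, y))%:E)%E.
Proof. by move=> iF; rewrite -(integral21_prod_meas1 iF). Qed.

Lemma lebesgue2_shift (F : R * R -> R) (a b : R) : measurable_fun setT F ->
  lebesgue2.-integrable setT (fun z => (F z)%:E) ->
  lebesgue2.-integrable setT (fun z => (F (a + z.1, b + z.2))%:E) /\
  (\int[lebesgue2]_z (F z)%:E = \int[lebesgue2]_z (F (a + z.1, b + z.2)%R)%:E)%E.
Proof.
move=> mF iF.
have := @integral_transfer R _ _ _ _ _ _ lebesgue2 lebesgue2 (@id (R * R))
  (fun z : R * R => (a + z.1, b + z.2)) (fun=> 1) (fun=> 1) F.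
case.
- exact: measurable_id.
- by meas.
- by meas.
- by meas.
- by [].
- by [].
- move=> H mH H0; under eq_integral do rewrite mul1e.
  under [RHS]eq_integral do rewrite mul1e.
  rewrite !lebesgue2_tonelli //; last by meas.
  rewrite /= (@ge0_integral_affine_inv _ _ 1 a) ?oner_eq0 //; last 2 first.
  - by apply: (@measurable_tonelli _ _ _ (fun x y : R => H (x, y))) => //; meas.
  - by move=> x; exact: integral_ge0.
  apply: eq_integral => x _; rewrite normr1 mul1e mul1r.
  rewrite (@ge0_integral_affine_inv _ _ 1 b) ?oner_eq0 //; last by meas.
  by apply: eq_integral => y _; rewrite normr1 mul1e mul1r addrC [y + _]addrC.
- exact: mF.
- by under eq_fun do rewrite mul1r.
move=> iF' E; split.
  by move: iF'; under eq_fun do rewrite mul1r.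
move: E; under eq_integral do rewrite mul1r.
by move=> ->; apply: eq_integral => z _; rewrite mul1r.
Qed.

(** The Jacobian together with the indicator of the coordinate strip, so that a polar integral is an
    integral over the whole plane, as [integral_transfer] expects. *)
Definition polar_weight (p : R * R) : R :=
  if (0 < p.1) && ((0 <= p.2) && (p.2 <= 2 * pi)) then p.1 else 0.

Lemma lebesgue2_polar_ge0 (H : R * R -> \bar R) : measurable_fun setT H ->
  (forall z, 0 <= H z)%E ->
  (\int[lebesgue2]_z H z =
   \int[lebesgue2]_p ((polar_weight p)%:E * H (p.1 * cos p.2, p.1 * sin p.2)%R))%E.
Proof.
move=> mH H0.
have w0 p : 0 <= polar_weight p.
  by rewrite /polar_weight; case: ifP => // /andP[/ltW].
rewrite !lebesgue2_tonelli //; last 2 first.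
- by rewrite /polar_weight; meas.
- by move=> p; rewrite mule_ge0 // lee_fin.
rewrite ge0_integral_polar //; apply: eq_integral => r _.
case: ifP => r0; last first.
  by rewrite integral0_eq // => t _; rewrite /polar_weight /= r0 mul0e.
rewrite integral_itv_if -ge0_integralZl_EFin //; last 3 first.
- by move=> t _; case: ifP.
- by meas.
- exact: ltW.
apply: eq_integral => t _; rewrite /polar_weight /= r0 /=.
by case: ifP => _; rewrite ?mule0 ?mul0e.
Qed.

Lemma lebesgue2_polar (F : R * R -> R) : measurable_fun setT F ->
  lebesgue2.-integrable setT (fun z => (F z)%:E) ->
  lebesgue2.-integrable setT (fun p => (polar_weight p * F (p.1 * cos p.2, p.1 * sin p.2))%:E) /\
  (\int[lebesgue2]_z (F z)%:E =
   \int[lebesgue2]_p (polar_weight p * F (p.1 * cos p.2, p.1 * sin p.2)%R)%:E)%E.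
Proof.
move=> mF iF.
have := @integral_transfer R _ _ _ _ _ _ lebesgue2 lebesgue2 (@id (R * R))
  (fun p : R * R => (p.1 * cos p.2, p.1 * sin p.2)) (fun=> 1) polar_weight F.
case.
- exact: measurable_id.
- by meas.
- by meas.
- by rewrite /polar_weight; meas.
- by [].
- by move=> p; rewrite /polar_weight; case: ifP => // /andP[/ltW].
- move=> H mH H0; under eq_integral do rewrite mul1e.
  exact: lebesgue2_polar_ge0.
- exact: mF.
- by under eq_fun do rewrite mul1r.
move=> iF' E; split => //.
by move: E; under eq_integral do rewrite mul1r.
Qed.

Definition ball2 (r : R) (z : R * R) : bool := z.1 ^+ 2 + z.2 ^+ 2 <= r ^+ 2.

(** The Jacobian [s] of polar coordinates absorbs a singularity of order [1 / s] at the origin,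
    leaving a bounded integrand on a bounded strip. *)
Lemma integrable_polar_bound (F : R * R -> R) (r C : R) : measurable_fun setT F -> 0 <= r ->
  (forall z, ~~ ball2 r z -> F z = 0) ->
  (forall s t, 0 < s -> s <= r -> s * `|F (s * cos t, s * sin t)| <= C) ->
  lebesgue2.-integrable setT (fun z => (F z)%:E).
Proof.
move=> mF r0 Fr FC; have pi0 : 0 < pi :> R := pi_gt0 R.
have C0 : 0 <= Num.max C 0 by rewrite le_max lexx orbT.
apply/integrableP; split; first by meas.
rewrite lebesgue2_polar_ge0 //; last by meas.
pose B (p : R * R) : \bar R := if ((0 <= p.1) && (p.1 <= r)) && ((0 <= p.2) && (p.2 <= 2 * pi))
  then (Num.max C 0)%:E else 0%E.
have mB : measurable_fun setT B by rewrite /B; meas.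
have B0 p : (0 <= B p)%E by rewrite /B; case: ifP.
apply: (@le_lt_trans _ _ (\int[lebesgue2]_p B p)%E).
  apply: ge0_le_integral => //.
  - move=> p _; rewrite mule_ge0 // lee_fin /polar_weight.
    by case: ifP => // /andP[/ltW].
  - by rewrite /polar_weight; meas.
  - move=> p _; rewrite /B /polar_weight; case: ifP => [/andP[s0 t0]|_]; last first.
      by rewrite mul0e; case: ifP.
    rewrite t0 andbT (ltW s0) /= -EFinM.
    have [sr|rs] := leP p.1 r.
      by rewrite lee_fin le_max FC.
    rewrite Fr ?normr0 ?mulr0 // /ball2 /= !exprMn -mulrDr cos2Dsin2 mulr1 -ltNge.
    by rewrite ltr_pXn2r // nnegrE ltW.
rewrite lebesgue2_tonelli //.
apply: (@le_lt_trans _ _ (\int[mu]_(x in `[0%R, r]) (cst ((Num.max C 0) * (2 * pi))%:E x))%E); last first.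
  rewrite integral_cst //= lebesgue_measure_itv /=; case: ifP => _; last by rewrite mule0 ltry.
  by rewrite -EFinB -EFinM ltry.
rewrite integral_itv_if; apply: ge0_le_integral => //.
- by move=> x _; exact: integral_ge0.
- by apply: (@measurable_tonelli _ _ _ (fun x y : R => B (x, y))) => //; meas.
- by meas.
- move=> x _; rewrite /B /=; case: ifP => xr /=; last by rewrite integral0_eq.
  rewrite -(integral_itv_if (cst (Num.max C 0)%:E)) integral_cst //= lebesgue_measure_itv /= lte_fin.
  by rewrite mulr_gt0 // -EFinB -EFinM subr0.
Qed.

(** Twice [log |z|]. This doubling explains the [4 pi] of [integral_laplacian_lnsq] and the factors
    [2^-1] in front of [lnsq] later on. *)
Definition lnsq (z : R * R) : R := ln (z.1 ^+ 2 + z.2 ^+ 2).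

Lemma measurable_lnsq : measurable_fun setT lnsq.
Proof. by rewrite /lnsq; meas. Qed.

Lemma lnsq_polar (s t : R) : 0 < s -> lnsq (s * cos t, s * sin t) = 2 * ln s.
Proof.
move=> s0; rewrite /lnsq /= !exprMn -mulrDr cos2Dsin2 mulr1.
by rewrite lnXn // mulr_natl.
Qed.

(** For [s <= 1] the square-root majorant gives [4 sqrt s <= 4]; for [s > 1] the inequality
    [ln s <= s] gives [2 s^2 <= 2 r^2]. The right-hand side is the sum of the two bounds. *)
Lemma norm_ln_mul_le (s r : R) : 0 < s -> s <= r -> s * `|2 * ln s| <= 4 + 2 * r ^+ 2.
Proof.
move=> s0 sr; have r2 : s ^+ 2 <= r ^+ 2 by rewrite ler_sqr_ge0 // ?ltW // (lt_le_trans s0).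
rewrite normrM (gtr0_norm (ltr0n _ 2)).
have [s1|s1] := leP s 1.
  have ss : 0 < Num.sqrt s by rewrite sqrtr_gt0.
  have ss1 : Num.sqrt s <= 1.
    by rewrite -ler_sqr_ge0 ?(ltW ss) // expr1n sqr_sqrtr // ltW.
  have l := oppln_le_sqrtV s0.
  rewrite ler0_norm ?ln_le0 //.
  have h : s * (2 * - ln s) <= 4 * Num.sqrt s.
    have -> : 4 * Num.sqrt s = s * (2 * (2 / Num.sqrt s)).
      rewrite -{2}[s](sqr_sqrtr (ltW s0)); by field; rewrite gt_eqF.
    by rewrite ler_pM2l // ler_pM2l.
  apply: (le_trans h); have := sqr_ge0 r; lra.
have l0 : 0 <= ln s by rewrite ln_ge0 // ltW.
have l1 : ln s <= s.
  have -> : s = 1 + (s - 1) by ring.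
  apply: (le_trans (le_ln1Dx _)); lra.
rewrite ger0_norm //; have : s * ln s <= s * s by rewrite ler_pM2l.
by rewrite -expr2; lra.
Qed.

Lemma integrable_lnsq_ball (r : R) : 0 <= r ->
  lebesgue2.-integrable setT (fun z => (if ball2 r z then lnsq z else 0)%:E).
Proof.
move=> r0; have ml := measurable_lnsq.
apply: (@integrable_polar_bound _ r (4 + 2 * r ^+ 2)) => //.
- by rewrite /ball2; meas.
- by move=> z /negbTE ->.
- move=> s t s0 sr; case: ifP => _.
    by rewrite lnsq_polar // norm_ln_mul_le.
  by rewrite normr0 mulr0 addr_ge0 // mulr_ge0 // sqr_ge0.
Qed.

(** Triangle inequality: two vectors of length at most 1 cannot bring a point at distance more than
    4 back into the unit disc. The radius 4 thus serves for all translates of the support at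
    once. *)
Lemma ball2_shift (x y t e1 e2 : R) (z : R * R) :
  x ^+ 2 + y ^+ 2 <= 1 -> e1 ^+ 2 + e2 ^+ 2 <= 1 -> `|t| <= 1 -> ~~ ball2 4 z ->
  1 <= (x + t * e1 + z.1) ^+ 2 + (y + t * e2 + z.2) ^+ 2.
Proof.
move=> xy ee t1; rewrite /ball2 -ltNge => z4.
have t2 : t ^+ 2 <= 1 by rewrite -(expr1n _ 2) -real_normK ?num_real // ler_sqr_ge0.
have te : t ^+ 2 * (e1 ^+ 2 + e2 ^+ 2) <= 1 * 1.
  by apply: ler_pM => //; rewrite ?addr_ge0 ?sqr_ge0.
have p1 := sqr_ge0 (x + t * e1 + z.1 + (x + t * e1)).
have p2 := sqr_ge0 (y + t * e2 + z.2 + (y + t * e2)).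
have q1 := sqr_ge0 (x - t * e1).
have q2 := sqr_ge0 (y - t * e2).
nra.
Qed.

(** * Integrability against the logarithm and against its gradient *)

Section kernel.
Variables (h : R -> R -> R) (C : R).
Hypothesis mh : measurable_fun setT (fun z : R * R => h z.1 z.2).
Hypothesis hC : forall a b, `|h a b| <= C.
Hypothesis hsupp : forall a b, 1 <= a ^+ 2 + b ^+ 2 -> h a b = 0.

Let mhc d (T : measurableType d) (f g : T -> R) : measurable_fun setT f ->
  measurable_fun setT g -> measurable_fun setT (fun x => h (f x) (g x)).
Proof.
move=> mf mg; apply: (measurableT_comp (f := fun t : R * R => h t.1 t.2)
  (g := fun x => (f x, g x))) => //.
by meas.
Qed.

Let C0 : 0 <= C. Proof. exact: le_trans (hC 0 0). Qed.

Let hball (x y : R) (z : R * R) : x ^+ 2 + y ^+ 2 <= 1 -> ~~ ball2 4 z -> h (x + z.1) (y + z.2) = 0.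
Proof.
move=> xy zb; apply: hsupp.
have := @ball2_shift x y 0 0 0 z xy; rewrite !mul0r !addr0; apply => //.
by rewrite expr0n /= addr0.
by rewrite normr0.
Qed.

Lemma integrable_mul_lnsq (x y : R) : x ^+ 2 + y ^+ 2 <= 1 ->
  lebesgue2.-integrable setT (fun z => (h (x + z.1) (y + z.2) * lnsq z)%:E).
Proof.
move=> xy; have ml := measurable_lnsq.
have : lebesgue2.-integrable setT (fun z => (C%:E * (if ball2 4 z then lnsq z else 0)%:E)%E).
  by apply: integrableZl => //; exact: integrable_lnsq_ball.
apply: le_integrable => //.
  by apply/measurable_EFinP; apply: measurable_funM => //; apply: mhc; meas.
move=> z _; rewrite -EFinM !abse_EFin lee_fin !normrM (ger0_norm C0).
case: ifPn => [_|zb]; first by rewrite ler_wpM2r.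
by rewrite hball // normr0 mul0r mulr_ge0.
Qed.

(** [j] stands for either coordinate: [2 j z / |z|^2] is a partial derivative of [lnsq], of size at
    most [2 / |z|], which the polar Jacobian cancels. *)
Lemma integrable_mul_inv (x y : R) (j : R * R -> R) : x ^+ 2 + y ^+ 2 <= 1 ->
  measurable_fun setT j -> (forall s t, 0 < s -> `|j (s * cos t, s * sin t)| <= s) ->
  lebesgue2.-integrable setT
    (fun z => (h (x + z.1) (y + z.2) * (2 * j z / (z.1 ^+ 2 + z.2 ^+ 2)))%:E).
Proof.
move=> xy mj jz.
apply: (@integrable_polar_bound _ 4 (2 * C)) => //.
- by apply: measurable_funM => //; [apply: mhc; meas|meas].
- by move=> z zb; rewrite hball // mul0r.
- move=> s t s0 _ /=; rewrite !exprMn -mulrDr cos2Dsin2 mulr1.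
  rewrite normrM mulrCA normf_div normrM (gtr0_norm (ltr0n _ 2)) (gtr0_norm (exprn_gt0 2 s0)).
  set J := `|j _|; rewrite [2 * C]mulrC.
  have -> : s * (2 * J / s ^+ 2) = 2 * (J / s) by field; rewrite gt_eqF.
  have Js : J / s <= 1 by rewrite ler_pdivrMr // mul1r jz.
  have J0 : 0 <= J / s by rewrite divr_ge0 ?(ltW s0) // /J normr_ge0.
  by apply: ler_pM => //; lra.
Qed.

End kernel.

(** The parameter [t] sits in the density and not in the singular kernel, so [C |lnsq|] on the ball
    of radius 4 dominates the derivative for all [t] in []-1, 1[] and differentiation under the
    integral applies. *)
Lemma is_derive_newton (h h' : R -> R -> R) (C x y e1 e2 : R) :
  measurable_fun setT (fun z : R * R => h z.1 z.2) ->
  (forall a b, `|h a b| <= C) -> (forall a b, `|h' a b| <= C) ->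
  (forall a b, 1 <= a ^+ 2 + b ^+ 2 -> h a b = 0) ->
  (forall a b, 1 <= a ^+ 2 + b ^+ 2 -> h' a b = 0) ->
  (forall a b (t : R), is_derive t 1 (fun t : R => h (a + t * e1) (b + t * e2)) (h' (a + t * e1) (b + t * e2))) ->
  x ^+ 2 + y ^+ 2 <= 1 -> e1 ^+ 2 + e2 ^+ 2 <= 1 ->
  is_derive (0 : R) 1
    (fun t : R => \int[lebesgue2]_z (h (x + t * e1 + z.1) (y + t * e2 + z.2) * lnsq z))
    (\int[lebesgue2]_z (h' (x + z.1) (y + z.2) * lnsq z)).
Proof.
move=> mh hC h'C hs h's dh xy ee; have ml := measurable_lnsq.
have C0 : 0 <= C by exact: le_trans (hC 0 0).
pose f (t : R) (z : R * R) := h (x + t * e1 + z.1) (y + t * e2 + z.2) * lnsq z.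
pose G (z : R * R) := `|C * (if ball2 4 z then lnsq z else 0)|.
have f0 (t : R) z : t \in `]-1, 1[ -> ~~ ball2 4 z -> h (x + t * e1 + z.1) (y + t * e2 + z.2) = 0
    /\ h' (x + t * e1 + z.1) (y + t * e2 + z.2) = 0.
  rewrite in_itv /= => /andP[t1 t2] zb.
  have [] : 1 <= (x + t * e1 + z.1) ^+ 2 + (y + t * e2 + z.2) ^+ 2.
    by apply: ball2_shift => //; rewrite ler_norml !ltW.
  by move=> w; split; [exact: hs|exact: h's].
have df (t : R) z : is_derive t 1 (f ^~ z) (h' (x + t * e1 + z.1) (y + t * e2 + z.2) * lnsq z).
  have := dh (x + z.1) (y + z.2) t => D.
  rewrite /f.
  have -> : (fun t : R => h (x + t * e1 + z.1) (y + t * e2 + z.2) * lnsq z)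
     = (fun t : R => lnsq z *: h (x + z.1 + t * e1) (y + z.2 + t * e2)).
    by apply/funext => u; rewrite mulrC [x + _ + _]addrAC [y + _ + _]addrAC.
  rewrite mulrC [x + _ + _]addrAC [y + _ + _]addrAC.
  exact: is_deriveZ.
have iG : lebesgue2.-integrable setT (EFin \o G).
  have : lebesgue2.-integrable setT (fun z => (C%:E * (if ball2 4 z then lnsq z else 0)%:E)%E).
    by apply: integrableZl => //; exact: integrable_lnsq_ball.
  move/integrable_abse; apply: eq_integrable => // z _ /=.
have mf (t : R) : measurable_fun setT (f t).
  apply: measurable_funM => //.
  apply: (measurableT_comp (f := fun z : R * R => h z.1 z.2)
    (g := fun z : R * R => (x + t * e1 + z.1, y + t * e2 + z.2))) => //.
  by meas.
have intf (t : R) : t \in `]-1, 1[ -> lebesgue2.-integrable setT (EFin \o f t).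
  move=> t1; apply: le_integrable iG => //; first by apply/measurable_EFinP; exact: mf.
  move=> z _; rewrite /= lee_fin /f /G normr_id !normrM (ger0_norm C0).
  case: ifPn => [_|zb]; first by rewrite ler_wpM2r.
  by have [-> _] := f0 _ _ t1 zb; rewrite normr0 mul0r mulr_ge0.
have derf1 (t : R) z : t \in `]-1, 1[ -> setT z -> derivable (f ^~ z) t 1.
  by move=> _ _; have [] := df t z.
have p1 t z : partial1of2 f t z = h' (x + t * e1 + z.1) (y + t * e2 + z.2) * lnsq z.
  by rewrite partial1of2E; have [_] := df t z.
have G0 z : 0 <= G z by rewrite /G.
have Gub (t : R) z : t \in `]-1, 1[ -> setT z -> `|partial1of2 f t z| <= G z.
  move=> t1 _; rewrite p1 /G !normrM (ger0_norm C0).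
  case: ifPn => [_|zb]; first by rewrite ler_wpM2r.
  by have [_ ->] := f0 _ _ t1 zb; rewrite normr0 mul0r mulr_ge0.
have I0 : `]-1, 1[%classic (0 : R) by rewrite /= in_itv /= ltrN10 ltr01.
have mT : measurable [set: R * R] by exact: measurableT.
have D1 := @derivable_under_integral R _ _ lebesgue2 f setT measurableT 0 (-1) 1 I0 intf derf1 G G0 iG Gub.
have D2 := @differentiation_under_integral R _ _ lebesgue2 f setT measurableT 0 (-1) 1 I0 intf derf1 G G0 iG Gub.
apply: DeriveDef; first exact: D1.
rewrite -derive1E D2; apply: eq_Rintegral => z _.
by rewrite p1 !mul0r !addr0.
Qed.

(** On a line at distance [|c| > 0] from the origin the logarithm is smooth, and the boundary terms
    at -4 and 4 vanish with [p]. *)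
Lemma integral_ln_by_parts (p q : R -> R) (c : R) : c != 0 ->
  (forall s : R, is_derive s 1 p (q s)) -> continuous q ->
  (forall s, 4 <= `|s| -> p s = 0) -> (forall s, 4 <= `|s| -> q s = 0) ->
  (\int[mu]_s (q s * ln (s ^+ 2 + c ^+ 2))%:E
   = \int[mu]_s (- (p s * (2 * s / (s ^+ 2 + c ^+ 2))))%:E)%E.
Proof.
move=> c0 dp cq ps qs.
have pos (s : R) : 0 < s ^+ 2 + c ^+ 2.
  by rewrite ltr_wpDl ?sqr_ge0 // exprn_even_gt0.
have restr (k : R -> R) : (forall s, 4 <= `|s| -> k s = 0) ->
    (\int[mu]_s (k s)%:E = \int[mu]_(s in `[(-4)%R, 4%R]) (k s)%:E)%E.
  move=> k0; rewrite integral_itv_if; apply: eq_integral => s _.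
  by rewrite -ler_norml; case: leP => // /ltW/k0 ->.
rewrite (restr (fun s => q s * ln (s ^+ 2 + c ^+ 2))); last by move=> s /qs ->; rewrite mul0r.
rewrite (restr (fun s => - (p s * (2 * s / (s ^+ 2 + c ^+ 2)))));
  last by move=> s /ps ->; rewrite mul0r oppr0.
have dsq (s : R) : is_derive s 1 (fun s : R => s ^+ 2 + c ^+ 2) (2 * s).
  have -> : (fun s : R => s ^+ 2 + c ^+ 2) = (fun s : R => s ^+ 2) + cst (c ^+ 2) by [].
  apply: is_derive_eq; rewrite addr0.
  have -> : s%:A = s by rewrite /GRing.scale /= mulr1.
  by ring.
have dl (s : R) : is_derive s 1 (fun s : R => ln (s ^+ 2 + c ^+ 2)) (2 * s / (s ^+ 2 + c ^+ 2)).
  rewrite mulrC.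
  exact: (@is_derive1_comp _ (@ln R) _ s _ _ (is_derive1_ln (pos s)) (dsq s)).
have cont (k k' : R -> R) : (forall s : R, is_derive s 1 k (k' s)) -> continuous k.
  move=> dk s; apply: differentiable_continuous; apply/derivable1_diffP.
  by have [] := dk s.
have LR (k k' : R -> R) : (forall s : R, is_derive s 1 k (k' s)) -> derivable_oo_LRcontinuous k (-4) 4.
  move=> dk; split.
  - by move=> s _; have [] := dk s.
  - by apply: cvg_at_right_filter; exact: (cont _ _ dk).
  - by apply: cvg_at_left_filter; exact: (cont _ _ dk).
have := @integration_by_parts R (fun s => ln (s ^+ 2 + c ^+ 2)) p
  (fun s => 2 * s / (s ^+ 2 + c ^+ 2)) q (-4) 4.
rewrite !ps ?normrN ?ger0_norm // !mulr0 subr0 add0e => IBP.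
have cf : continuous (fun s : R => 2 * s / (s ^+ 2 + c ^+ 2)).
  move=> s; apply: continuousM.
    by apply: continuousM; [exact: cvg_cst|exact: cvg_id].
  apply: (@continuousV _ _ (fun s : R => s ^+ 2 + c ^+ 2)); first by rewrite gt_eqF.
  exact: (cont _ _ dsq).
under eq_integral do rewrite mulrC.
rewrite IBP.
- rewrite -mulN1e -integralZl //.
    by apply: eq_integral => s _; rewrite -EFinM mulN1r [p s * _]mulrC.
  apply: continuous_compact_integrable; first exact: segment_compact.
  have cfp : continuous (fun s : R => 2 * s / (s ^+ 2 + c ^+ 2) * p s).
    by move=> s; exact: (continuousM (cf s) (cont _ _ dp s)).
  exact: continuous_subspaceT.
- by lra.
- exact: continuous_subspaceT.
- exact: (LR _ _ dl).
- by move=> s _; rewrite derive1E; have [_] := dl s.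
- exact: continuous_subspaceT.
- exact: (LR _ _ dp).
- by move=> s _; rewrite derive1E; have [_] := dp s.
Qed.

(** Regularity is recorded along straight lines only: in the computation of the Laplacian it enters
    through one-dimensional integration by parts and the fundamental theorem of calculus. *)
Definition ray_continuous (h : R -> R -> R) :=
  forall a b c d, continuous (fun r : R => h (a + r * c) (b + r * d)).

Definition ray_derivative (h h' : R -> R -> R) (c d : R) := forall a b (t : R),
  is_derive t 1 (fun t : R => h (a + t * c) (b + t * d)) (h' (a + t * c) (b + t * d)).

(** * The Laplacian of the logarithmic potential *)

Section laplacian.
Variables (g g1 g2 g11 g22 : R -> R -> R) (C : R).
Hypothesis mg1 : measurable_fun setT (fun z : R * R => g1 z.1 z.2).
Hypothesis mg2 : measurable_fun setT (fun z : R * R => g2 z.1 z.2).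
Hypothesis mg11 : measurable_fun setT (fun z : R * R => g11 z.1 z.2).
Hypothesis mg22 : measurable_fun setT (fun z : R * R => g22 z.1 z.2).
Hypothesis g1C : forall a b, `|g1 a b| <= C.
Hypothesis g2C : forall a b, `|g2 a b| <= C.
Hypothesis g11C : forall a b, `|g11 a b| <= C.
Hypothesis g22C : forall a b, `|g22 a b| <= C.
Hypothesis gs : forall a b, 1 <= a ^+ 2 + b ^+ 2 -> g a b = 0.
Hypothesis g1s : forall a b, 1 <= a ^+ 2 + b ^+ 2 -> g1 a b = 0.
Hypothesis g2s : forall a b, 1 <= a ^+ 2 + b ^+ 2 -> g2 a b = 0.
Hypothesis g11s : forall a b, 1 <= a ^+ 2 + b ^+ 2 -> g11 a b = 0.
Hypothesis g22s : forall a b, 1 <= a ^+ 2 + b ^+ 2 -> g22 a b = 0.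
Hypothesis cg1 : ray_continuous g1.
Hypothesis cg2 : ray_continuous g2.
Hypothesis cg11 : ray_continuous g11.
Hypothesis cg22 : ray_continuous g22.
Hypothesis dg11 : ray_derivative g1 g11 1 0.
Hypothesis dg22 : ray_derivative g2 g22 0 1.
Hypothesis dg : forall c d, ray_derivative g (fun a b => c * g1 a b + d * g2 a b) c d.

Variables x y : R.
Hypothesis xy1 : x ^+ 2 + y ^+ 2 <= 1.

Let norm_le1 (a b : R) : a ^+ 2 + b ^+ 2 <= 1 -> `|a| <= 1.
Proof.
move=> ab; rewrite -(@ler_sqr_ge0 _ _ 1) // expr1n real_normK ?num_real //.
by apply: le_trans ab; rewrite lerDl sqr_ge0.
Qed.

Let far (a s : R) : `|a| <= 1 -> 4 <= `|s| -> 1 <= (a + s) ^+ 2.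
Proof.
move=> a1 s4; rewrite -real_normK ?num_real // -(expr1n _ 2) ler_sqr_ge0 //.
have := lerB_normD s a; rewrite [s + a]addrC => sa.
by apply: le_trans sa; lra.
Qed.

Let integral_g11 :
  (\int[lebesgue2]_z (g11 (x + z.1) (y + z.2) * lnsq z)%:E =
   \int[lebesgue2]_z (- (g1 (x + z.1) (y + z.2) * (2 * z.1 / (z.1 ^+ 2 + z.2 ^+ 2))))%:E)%E.
Proof.
have i1 := @integrable_mul_lnsq g11 C mg11 g11C g11s x y xy1.
have i2 : lebesgue2.-integrable setT
   (fun z => (- (g1 (x + z.1) (y + z.2) * (2 * z.1 / (z.1 ^+ 2 + z.2 ^+ 2))))%:E).
  have := @integrable_mul_inv g1 C mg1 g1C g1s x y fst xy1 measurable_fst.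
  move=> /(_ _)/integrableN; apply => s t s0 /=.
  by rewrite normrM gtr0_norm // ler_piMr ?norm_cos_le1 // ltW.
rewrite (@lebesgue2_fubini_swap (fun z => g11 (x + z.1) (y + z.2) * lnsq z) i1).
rewrite (lebesgue2_fubini_swap i2).
(* The horizontal line through the singularity is a single value of the outer variable and may be
   left out. *)
apply: (@integral_eq_except _ 0).
- exact: (measurable_fubini_G i1).
- exact: (measurable_fubini_G i2).
- move=> c c0 /=.
  apply: (@integral_ln_by_parts (fun s => g1 (x + s) (y + c)) (fun s => g11 (x + s) (y + c)) c) => //.
  + move=> s; have := dg11 x (y + c) s; rewrite !mulr0 !addr0 mulr1.
    by under eq_fun do rewrite mulr1 mulr0 addr0.
  + have := @cg11 x (y + c) 1 0.
    by under eq_fun do rewrite mulr1 mulr0 addr0.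
  + move=> s s4; apply: g1s; apply: le_trans (far (norm_le1 xy1) s4) _.
    by rewrite lerDl sqr_ge0.
  + move=> s s4; apply: g11s; apply: le_trans (far (norm_le1 xy1) s4) _.
    by rewrite lerDl sqr_ge0.
Qed.

Let integral_g22 :
  (\int[lebesgue2]_z (g22 (x + z.1) (y + z.2) * lnsq z)%:E =
   \int[lebesgue2]_z (- (g2 (x + z.1) (y + z.2) * (2 * z.2 / (z.1 ^+ 2 + z.2 ^+ 2))))%:E)%E.
Proof.
have yx1 : y ^+ 2 + x ^+ 2 <= 1 by rewrite addrC.
have i1 := @integrable_mul_lnsq g22 C mg22 g22C g22s x y xy1.
have i2 : lebesgue2.-integrable setT
   (fun z => (- (g2 (x + z.1) (y + z.2) * (2 * z.2 / (z.1 ^+ 2 + z.2 ^+ 2))))%:E).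
  have := @integrable_mul_inv g2 C mg2 g2C g2s x y snd xy1 measurable_snd.
  move=> /(_ _)/integrableN; apply => s t s0 /=.
  by rewrite normrM gtr0_norm // ler_piMr ?norm_sin_le1 // ltW.
rewrite (@lebesgue2_fubini (fun z => g22 (x + z.1) (y + z.2) * lnsq z) i1).
rewrite (lebesgue2_fubini i2).
apply: (@integral_eq_except _ 0).
- exact: (measurable_fubini_F i1).
- exact: (measurable_fubini_F i2).
- move=> c c0 /=.
  have E : (\int[mu]_s (g22 (x + c) (y + s) * ln (s ^+ 2 + c ^+ 2))%:E =
     \int[mu]_s (- (g2 (x + c) (y + s) * (2 * s / (s ^+ 2 + c ^+ 2))))%:E)%E.
    apply: (@integral_ln_by_parts (fun s => g2 (x + c) (y + s)) (fun s => g22 (x + c) (y + s)) c) => //.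
    + move=> s; have := dg22 (x + c) y s; rewrite !mulr0 !addr0 mulr1.
      by under eq_fun do rewrite mulr1 mulr0 addr0.
    + have := @cg22 (x + c) y 0 1.
      by under eq_fun do rewrite mulr1 mulr0 addr0.
    + move=> s s4; apply: g2s; apply: le_trans (far (norm_le1 yx1) s4) _.
      by rewrite lerDr sqr_ge0.
    + move=> s s4; apply: g22s; apply: le_trans (far (norm_le1 yx1) s4) _.
      by rewrite lerDr sqr_ge0.
  transitivity (\int[mu]_s (g22 (x + c) (y + s) * ln (s ^+ 2 + c ^+ 2))%:E)%E.
    by apply: eq_integral => s _; rewrite /lnsq /= [c ^+ 2 + _]addrC.
  by rewrite E; apply: eq_integral => s _; rewrite [s ^+ 2 + _]addrC.
Qed.

(** Parallelogram identity: [|x + r v|^2] is at least [r^2 / 2 - |x|^2], hence at least [8 - 1]. *)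
Let ray_far (c d r : R) : c ^+ 2 + d ^+ 2 = 1 -> 4 <= r ->
  1 <= (x + r * c) ^+ 2 + (y + r * d) ^+ 2.
Proof.
move=> cd r4; have p1 := sqr_ge0 (x + r * c + x); have p2 := sqr_ge0 (y + r * d + y).
have -> : (x + r * c) ^+ 2 + (y + r * d) ^+ 2 =
  2^-1 * ((x + r * c + x) ^+ 2 + (y + r * d + y) ^+ 2) - (x ^+ 2 + y ^+ 2)
  + 2^-1 * r ^+ 2 * (c ^+ 2 + d ^+ 2) by field.
have r16 : 4 ^+ 2 <= r ^+ 2 by rewrite ler_sqr_ge0 // (le_trans _ r4).
rewrite cd mulr1; move: (addr_ge0 p1 p2) xy1 r16; have -> : 4 ^+ 2 = 16 :> R by ring.
move: (_ + _) (x ^+ 2 + y ^+ 2) (r ^+ 2) => P N Q.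
by lra.
Qed.

Let ray_fun_continuous (c d : R) : continuous
  (fun r : R => -2 * (c * g1 (x + r * c) (y + r * d) + d * g2 (x + r * c) (y + r * d))).
Proof.
have c1 := @cg1 x y c d; have c2 := @cg2 x y c d.
have cc (k : R) : continuous (fun _ : R => k) by move=> r; exact: cvg_cst.
move=> r; apply: (continuousM (cc (-2) r)).
by apply: continuousD; [exact: (continuousM (cc c r) (c1 r))|exact: (continuousM (cc d r) (c2 r))].
Qed.

(** The integrand is [-2] times the derivative of [g] along the ray, and [g] vanishes at the far
    end: only the value at the starting point remains. *)
Let integral_ray (c d : R) : c ^+ 2 + d ^+ 2 = 1 ->
  (\int[mu]_(r in `[0%R, 4%R]) (-2 * (c * g1 (x + r * c) (y + r * d) + d * g2 (x + r * c) (y + r * d)))%:E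
   = (2 * g x y)%:E)%E.
Proof.
move=> cd.
have D (r : R) : is_derive r 1 (fun r : R => -2 * g (x + r * c) (y + r * d))
    (-2 * (c * g1 (x + r * c) (y + r * d) + d * g2 (x + r * c) (y + r * d))).
  by have := dg c d x y r => D; apply: is_deriveZ.
have cD : continuous (fun r : R => -2 * g (x + r * c) (y + r * d)).
  move=> r; apply: differentiable_continuous; apply/derivable1_diffP.
  by have [] := D r.
rewrite (@continuous_FTC2 _ _ (fun r : R => -2 * g (x + r * c) (y + r * d))) //.
- rewrite !mul0r !addr0 [g (x + _) _]gs.
    by rewrite mulr0 sub0e -EFinN; congr EFin; ring.
  exact: ray_far.
- by apply: continuous_subspaceT; exact: ray_fun_continuous.
- split.
  + by move=> r _; have [] := D r.
  + by apply: cvg_at_right_filter; exact: cD.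
  + by apply: cvg_at_left_filter; exact: cD.
- by move=> r _; rewrite derive1E; have [_] := D r.
Qed.

(** Integration by parts in each variable leaves [-2] times the gradient of [g] at [(x, y) + z]
    against [z / |z|^2]. In polar coordinates the Jacobian cancels the [1 / r], and what remains is
    a pure radial derivative. Every ray contributes [2 g(x, y)], and the angles fill [2 pi]. *)
Lemma integral_laplacian_lnsq :
  (\int[lebesgue2]_z (g11 (x + z.1) (y + z.2) * lnsq z)%:E +
   \int[lebesgue2]_z (g22 (x + z.1) (y + z.2) * lnsq z)%:E = (4 * pi * g x y)%:E)%E.
Proof.
have pi0 : 0 < pi :> R := pi_gt0 R.
pose F (z : R * R) := - (g1 (x + z.1) (y + z.2) * (2 * z.1 / (z.1 ^+ 2 + z.2 ^+ 2)))
  - g2 (x + z.1) (y + z.2) * (2 * z.2 / (z.1 ^+ 2 + z.2 ^+ 2)).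
have i1 : lebesgue2.-integrable setT
   (fun z => (- (g1 (x + z.1) (y + z.2) * (2 * z.1 / (z.1 ^+ 2 + z.2 ^+ 2))))%:E).
  have := @integrable_mul_inv g1 C mg1 g1C g1s x y fst xy1 measurable_fst.
  move=> /(_ _)/integrableN; apply => s t s0 /=.
  by rewrite normrM gtr0_norm // ler_piMr ?norm_cos_le1 // ltW.
have i2 : lebesgue2.-integrable setT
   (fun z => (- (g2 (x + z.1) (y + z.2) * (2 * z.2 / (z.1 ^+ 2 + z.2 ^+ 2))))%:E).
  have := @integrable_mul_inv g2 C mg2 g2C g2s x y snd xy1 measurable_snd.
  move=> /(_ _)/integrableN; apply => s t s0 /=.
  by rewrite normrM gtr0_norm // ler_piMr ?norm_sin_le1 // ltW.
rewrite integral_g11 integral_g22 -integralD //.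
have iF : lebesgue2.-integrable setT (fun z => (F z)%:E).
  exact: (integrableD measurableT i1 i2).
have mF : measurable_fun setT F.
  by apply/measurable_EFinP; exact: (measurable_int _ iF).
rewrite -[LHS]/(\int[lebesgue2]_z (F z)%:E)%E.
have [ipF ->] := lebesgue2_polar mF iF.
rewrite (lebesgue2_fubini_swap ipF) /=.
transitivity (\int[mu]_(t in `[0%R, (2 * pi)%R]) (cst (2 * g x y)%:E t))%E; last first.
  rewrite integral_cst //= lebesgue_measure_itv /= lte_fin mulr_gt0 // sube0 -EFinM.
  by congr EFin; ring.
rewrite integral_itv_if; apply: eq_integral => t _; case: ifP => tD; last first.
  by rewrite integral0_eq // => r _; rewrite /polar_weight /= tD andbF mul0r.
rewrite -(integral_ray (cos2Dsin2 t)) -integral_itv_obnd_cbnd; last first.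
  apply: measurable_funTS; apply/measurable_EFinP; apply: continuous_measurable_fun.
  exact: ray_fun_continuous.
rewrite [RHS]integral_mkcond; apply: eq_integral => r _; rewrite patchE mem_setE in_itv /=.
rewrite /polar_weight /= tD andbT; case: ltP => r0 /=; last by rewrite mul0r.
rewrite /F /= !exprMn -mulrDr cos2Dsin2 mulr1; case: leP => r4.
  by congr EFin; field; rewrite gt_eqF.
have r1 : 1 <= (x + r * cos t) ^+ 2 + (y + r * sin t) ^+ 2.
  by apply: ray_far; [exact: cos2Dsin2|exact: ltW].
by rewrite g1s // g2s // !mul0r oppr0 addr0 mulr0.
Qed.

End laplacian.

End plane.

(** * Functions of class C^n on the disc *)

Section caratheodory.
Variable R : realType.

(** Rounding the first argument down to the grid of mesh [1 / (n + 1)] gives a function that is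
    measurable on each of countably many strips; continuity in the first argument makes these
    functions converge to [h]. *)
Lemma measurable_caratheodory (h : R -> R -> R) : (forall b, continuous (h ^~ b)) ->
  (forall a, measurable_fun setT (h a)) -> measurable_fun setT (fun z : R * R => h z.1 z.2).
Proof.
move=> ch mh.
pose q (n : nat) (a : R) : R := (Num.floor (n.+1%:R * a))%:~R / n.+1%:R.
apply: (@measurable_fun_cvg _ _ _ _ (fun n (z : R * R) => h (q n z.1) z.2)).
  move=> n.
  (* [c] enumerates the grid through the encoding of integers by naturals. Codes without an integer
     are sent to 0, which merely repeats the strip of 0. *)
  pose c (m : nat) : R := (odflt 0 (unpickle m : option int))%:~R / n.+1%:R.
  pose E (m : nat) : set (R * R) := [set z | (q n z.1 <= c m) && (c m <= q n z.1)].
  have mq : measurable_fun setT (q n).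
    apply: nondecreasing_measurable; first exact: measurableT.
    move=> a b ab; rewrite /q ler_pM2r ?invr_gt0 ?ltr0n // ler_int.
    by apply: le_floor; rewrite ler_pM2l // ltr0n.
  have mE m : measurable (E m).
    have mb : measurable_fun setT (fun z : R * R => (q n z.1 <= c m) && (c m <= q n z.1)).
      by apply: measurable_and; apply: measurable_fun_ler; meas.
    have := mb measurableT [set true] (I : measurable [set true]).
    by rewrite setTI; congr measurable; apply/seteqP; split => z.
  have -> : [set: R * R] = \bigcup_m E m.
    apply/esym/seteqP; split => // -[a b] _.
    by exists (pickle (Num.floor (n.+1%:R * a))) => //; rewrite /E /c /= pickleK /= /q !lexx.
  apply/measurable_fun_bigcup => // m.
  apply: (@eq_measurable_fun _ _ _ _ _ (fun z : R * R => h (c m) z.2)).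
    by move=> z; rewrite inE => /andP[h1 h2]; congr (h _ z.2); apply/eqP; rewrite eq_le h1 h2.
  by apply: measurable_funTS; apply: (measurableT_comp (mh _)); meas.
move=> [a b] _ /=.
apply: (@continuous_cvg _ _ _ _ _ (q ^~ a) (h ^~ b) a); first exact: ch.
apply/cvgrPdist_le => e e0.
near=> n.
have n0 : 0 < n.+1%:R :> R by rewrite ltr0n.
have f1 := floor_le (n.+1%:R * a); have f2 := floorD1_gt (n.+1%:R * a).
have qa : q n a <= a.
  by rewrite /q ler_pdivrMr // [a * _]mulrC.
have aq : a <= q n a + n.+1%:R^-1.
  rewrite /q -[X in _ + X]mul1r -mulrDl ler_pdivlMr // mulrC ltW //.
  by move: f2; rewrite intrD.
rewrite ger0_norm ?subr_ge0 // lerBlDl (le_trans aq) // lerD2l.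
rewrite ltW //; near: n; exact: (near_infty_natSinv_lt (PosNum e0)).
Unshelve. all: by end_near. Qed.

End caratheodory.

Section differentiable_local.
Variable R : realType.

Lemma near_eq_differentiable (V W : normedModType R) (f g : V -> W) (x : V) :
  (\near x, f x = g x) -> differentiable f x -> differentiable g x.
Proof.
move=> fg df; have fgx : f x = g x := nbhs_singleton fg.
have E : g \o shift x = cst (g x) + 'd f x +o_ 0 id.
  apply/eqaddoP => e e0.
  have /eqaddoP/(_ e e0) de := diff_locally df.
  have fg0 : \forall h \near (0 : V), f (h + x) = g (h + x).
    by move: fg; rewrite (near_shift (0 : V) x) /= subr0.
  near=> h.
  have -> : (g \o shift x - (cst (g x) + 'd f x)) h = (f \o shift x - (cst (f x) + 'd f x)) h.
    rewrite !fctE /= fgx; congr (_ - _); apply/esym.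
    by near: h.
  by near: h.
have dE := diff_unique (@diff_continuous _ _ _ _ _ df) E.
apply/diff_locallyP; split; first by rewrite dE; exact: diff_continuous.
by rewrite dE.
Unshelve. all: by end_near. Qed.

Lemma is_derive_line (V W : normedModType R) (F : V -> W) (a v : V) (t : R) (l : W) :
  is_derive (a + t *: v) v F l <-> is_derive t 1 (fun t : R => F (a + t *: v)) l.
Proof.
have E : (fun h : R => h^-1 *: ((F \o shift (a + t *: v)) (h *: v) - F (a + t *: v))) =
  (fun h : R => h^-1 *: (((fun t : R => F (a + t *: v)) \o shift t) (h *: 1) - F (a + t *: v))).
  apply/funext => h /=; congr (_ *: (F _ - _)).
  by rewrite [h%:A]mulr1 scalerDl addrCA.
split => -[D1 D2]; apply: DeriveDef.
- by move: D1; rewrite /derivable E.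
- by move: D2; rewrite /derive E.
- by move: D1; rewrite /derivable -E.
- by move: D2; rewrite /derive -E.
Qed.

End differentiable_local.

Section diffn.
Variable R : realType.
Local Notation V := 'rV[R]_2.
Variable U : set V.
Hypothesis oU : open U.

(** Finite-order smoothness by recursion on the first derivative taken, in an arbitrary direction;
    in this form sums and products go by induction on [n], through the sum and product rules. *)
Fixpoint diffn (n : nat) (h : V -> R) : Prop :=
  (forall w, U w -> differentiable h w) /\
  (if n is m.+1 then forall v, diffn m (fun w => 'D_v h w) else True).

Let nearU (h k : V -> R) (w : V) : (forall w, U w -> h w = k w) -> U w -> \near w, h w = k w.
Proof.
move=> hk Uw; have := open_nbhs_nbhs (conj oU Uw); apply: filterS => z; exact: hk.
Qed.

Lemma diffn0 n h : diffn n h -> forall w, U w -> differentiable h w.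
Proof. by case: n => [|n] []. Qed.

Lemma diffn_eq n h k : (forall w, U w -> h w = k w) -> diffn n h -> diffn n k.
Proof.
elim: n h k => [|n IHn] h k hk /= [dh Dh]; split => //.
- by move=> w Uw; exact: (near_eq_differentiable (nearU hk Uw) (dh _ Uw)).
- by move=> w Uw; exact: (near_eq_differentiable (nearU hk Uw) (dh _ Uw)).
- move=> v; apply: IHn (Dh v) => w Uw; apply: near_eq_derive; exact: nearU.
Qed.

Lemma diffnW n h : diffn n.+1 h -> diffn n h.
Proof.
elim: n h => [|n IHn] h [dh Dh]; split => // v; exact: IHn.
Qed.

Lemma diffn_cst n (c : R) : diffn n (fun=> c).
Proof.
elim: n c => [|n IHn] c; split => // w.
apply: (diffn_eq _ (IHn 0)) => z _; by rewrite derive_cst.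
Qed.

Lemma diffnD n h k : diffn n h -> diffn n k -> diffn n (fun w => h w + k w).
Proof.
elim: n h k => [|n IHn] h k [dh Dh] [dk Dk]; split => //.
- by move=> w Uw; exact: (differentiableD (dh w Uw) (dk w Uw)).
- by move=> w Uw; exact: (differentiableD (dh w Uw) (dk w Uw)).
- move=> v; apply: (diffn_eq _ (IHn _ _ (Dh v) (Dk v))) => w Uw.
  rewrite -[RHS]/('D_v (h + k) w) deriveD //; apply: diff_derivable; by [exact: dh|exact: dk].
Qed.

Lemma diffnM n h k : diffn n h -> diffn n k -> diffn n (fun w => h w * k w).
Proof.
elim: n h k => [|n IHn] h k.
  move=> [dh _] [dk _]; split => // w Uw; exact: (differentiableM (dh w Uw) (dk w Uw)).
move=> dnh dnk; move: (diffnW dnh) (diffnW dnk) => eh ek.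
case: dnh dnk => [dh Dh] [dk Dk]; split => //.
  by move=> w Uw; exact: (differentiableM (dh w Uw) (dk w Uw)).
move=> v; apply: (diffn_eq _ (diffnD (IHn _ _ eh (Dk v)) (IHn _ _ ek (Dh v)))) => w Uw.
rewrite -[RHS]/('D_v (h * k) w) deriveM //; apply: diff_derivable; by [exact: dh|exact: dk].
Qed.

End diffn.

Section disc.
Variable R : realType.
Local Notation V := 'rV[R]_2.
Local Notation U := (@open_disc R).

Lemma dot2E (w v : V) : dot w v =
  w ord0 ord0 * v ord0 ord0 + w ord0 (inord 1) * v ord0 (inord 1).
Proof.
rewrite /dot !big_ord_recl big_ord0 addr0.
by have -> : lift ord0 ord0 = inord 1 :> 'I_2 by apply: val_inj; rewrite /= inordK.
Qed.

Lemma vec2_0 (a b : R) : vec2 a b ord0 ord0 = a. Proof. by rewrite mxE. Qed.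
Lemma vec2_1 (a b : R) : vec2 a b ord0 (inord 1) = b. Proof. by rewrite mxE inordK. Qed.

Lemma vec2_eta (w : V) : vec2 (w ord0 ord0) (w ord0 (inord 1)) = w.
Proof.
apply/rowP => i; rewrite mxE; case: i => -[|[|//]] h /=; congr (w _ _); apply: val_inj => //=.
by rewrite inordK.
Qed.

Lemma vec2_line (a b c d t : R) : vec2 a b + t *: vec2 c d = vec2 (a + t * c) (b + t * d).
Proof. by apply/rowP => i; rewrite !mxE; case: ifP. Qed.

Lemma dot_vec2 (a b : R) : dot (vec2 a b) (vec2 a b) = a ^+ 2 + b ^+ 2.
Proof. by rewrite dot2E vec2_0 vec2_1 -!expr2. Qed.

Lemma differentiable_dotl (v w : V) : differentiable (fun w : V => dot w v) w.
Proof.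
have -> : (fun w : V => dot w v) =
    (fun w : V => w ord0 ord0) * cst (v ord0 ord0) +
    (fun w : V => w ord0 (inord 1)) * cst (v ord0 (inord 1)).
  by apply/funext => z; rewrite dot2E.
by apply: differentiableD; apply: differentiableM => //; exact: differentiable_coord.
Qed.

Lemma differentiable_dotw (w : V) : differentiable (fun w : V => dot w w) w.
Proof.
have -> : (fun w : V => dot w w) =
    (fun w : V => w ord0 ord0) * (fun w : V => w ord0 ord0) +
    (fun w : V => w ord0 (inord 1)) * (fun w : V => w ord0 (inord 1)).
  by apply/funext => z; rewrite dot2E.
by apply: differentiableD; apply: differentiableM => //; exact: differentiable_coord.
Qed.

Lemma continuous_dotw : continuous (fun w : V => dot w w).
Proof. move=> w; apply: differentiable_continuous; exact: differentiable_dotw. Qed.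

Lemma open_open_disc : open U.
Proof.
have := @open_comp _ _ (fun w : V => dot w w) [set x : R | x < 1].
apply; last exact: open_lt.
by move=> w _; exact: continuous_dotw.
Qed.

Lemma open_annulus (r : R) : open [set w : V | r < dot w w].
Proof.
have := @open_comp _ _ (fun w : V => dot w w) [set x : R | r < x].
apply; last exact: open_gt.
by move=> w _; exact: continuous_dotw.
Qed.

Let is_derive_quad (a b c t : R) :
  is_derive t 1 (fun t : R => a + t * b + t * t * c) (b + 2 * t * c).
Proof.
have did := is_derive_id t (1 : R).
have D1 := is_deriveM did (is_derive_cst b t (1 : R)).
have D2 := is_deriveM (is_deriveM did did) (is_derive_cst c t (1 : R)).
have D3 := is_deriveD (is_deriveD (is_derive_cst a t (1 : R)) D1) D2.
apply: (@is_derive_eq _ _ _ _ _ _ _ _ D3).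
by rewrite !fctE /GRing.scale /=; ring.
Qed.

Lemma derive_dotl (v u w : V) : 'D_u (fun w : V => dot w v) w = dot u v.
Proof.
apply: derive_val; rewrite -[w]addr0 -(scale0r u); apply/is_derive_line.
have -> : (fun t : R => dot (w + t *: u) v) = (fun t : R => dot w v + t * dot u v + t * t * 0).
  by apply/funext => t; rewrite !dot2E !mxE; ring.
by have := is_derive_quad (dot w v) (dot u v) 0 0; rewrite mulr0 addr0.
Qed.

Lemma diffn_dotl n (v : V) : diffn U n (fun w : V => dot w v).
Proof.
case: n => [|n]; split => //; do ?[by move=> w _; exact: differentiable_dotl].
move=> u; apply: (diffn_eq open_open_disc _ (@diffn_cst _ U open_open_disc n (dot u v))).
by move=> w _; rewrite derive_dotl.
Qed.

(* The density of the surface measure in the graph chart of the hemisphere. *)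
Definition kappa (w : V) : R := (Num.sqrt (1 - dot w w))^-1.

Let dkappa1 (s : R) : s < 1 ->
  is_derive s 1 (fun s : R => (Num.sqrt (1 - s))^-1) (2^-1 * (Num.sqrt (1 - s))^-1 ^+ 3).
Proof.
move=> s1; have s0 : 0 < 1 - s by rewrite subr_gt0.
have sq0 : Num.sqrt (1 - s) != 0 by rewrite gt_eqF // sqrtr_gt0.
have d1 : is_derive s 1 (fun s : R => 1 - s) (-1).
  have -> : (fun s : R => 1 - s) = cst 1 - (fun s : R => s) by [].
  by apply: is_derive_eq; rewrite add0r.
have d2 := @is_derive1_comp _ (@Num.sqrt R) _ s _ _ (is_derive1_sqrt s0) d1.
have := @is_deriveV R (fun s : R => Num.sqrt (1 - s)) s _ 1 sq0 d2.
move=> d3; apply: is_derive_eq.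
by rewrite /GRing.scale /=; field.
Qed.

Lemma differentiable_kappa w : U w -> differentiable kappa w.
Proof.
move=> Uw; apply: (@differentiable_comp _ _ _ _ (fun w : V => dot w w) (fun s : R => (Num.sqrt (1 - s))^-1)).
  exact: differentiable_dotw.
apply/derivable1_diffP; by have [] := dkappa1 Uw.
Qed.

Lemma derive_kappa v w : U w -> 'D_v kappa w = dot w v * (kappa w * (kappa w * kappa w)).
Proof.
move=> Uw; apply: derive_val; rewrite -[X in is_derive X](addr0 w) -(scale0r v); apply/is_derive_line.
have d1 : is_derive (0 : R) 1 (fun t : R => dot (w + t *: v) (w + t *: v)) (2 * dot w v).
  have -> : (fun t : R => dot (w + t *: v) (w + t *: v)) =
    (fun t : R => dot w w + t * (2 * dot w v) + t * t * dot v v).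
    by apply/funext => t; rewrite !dot2E !mxE; ring.
  by have := is_derive_quad (dot w w) (2 * dot w v) (dot v v) 0; rewrite mulr0 mul0r addr0.
have Uw0 : dot (w + 0 *: v) (w + 0 *: v) < 1 by rewrite scale0r addr0.
have := @is_derive1_comp _ _ _ 0 _ _ (dkappa1 Uw0) d1.
rewrite scale0r addr0 => d2; apply: is_derive_eq.
rewrite -/(kappa w); move: (kappa w) (dot w v) => k d; by field.
Qed.

(** The derivative of [kappa] is a linear function times [kappa^3], so order [n + 1] for [kappa]
    follows from order [n] by the product rule. *)
Lemma diffn_kappa n : diffn U n kappa.
Proof.
elim: n => [|n IHn]; split => //; do ?exact: differentiable_kappa.
move=> v; have M := diffnM open_open_disc.
apply: (diffn_eq open_open_disc _ (M _ _ _ (diffn_dotl n v) (M _ _ _ IHn (M _ _ _ IHn IHn)))).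
by move=> w Uw; rewrite derive_kappa.
Qed.

(** [iterD] adds derivatives on the outside, whereas [diffn] differentiates its argument; the
    induction therefore runs over all iterated derivatives of [h] simultaneously. *)
Lemma smooth_diffn n (h : V -> R) : smooth_on U h -> diffn U n h.
Proof.
move=> sh; suff : forall vs, diffn U n (Defs.iterD vs h) by move/(_ [::]).
by elim: n => [|n IHn] vs; split; do ?exact: sh; move=> // v; exact: (IHn (v :: vs)).
Qed.

(** [r] bounds a squared norm. Nothing is asked outside the unit disc: there [hlift w] generally
    leaves the sphere, where the values of [f] are arbitrary. *)
Definition vanishes_beyond (r : R) (h : V -> R) :=
  forall w, dot w w < 1 -> r < dot w w -> h w = 0.

Lemma vanishes_derive r h v : vanishes_beyond r h -> vanishes_beyond r (fun w => 'D_v h w).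
Proof.
move=> vh w w1 rw.
rewrite (@near_eq_derive _ _ _ _ (cst 0)) ?derive_cst //.
have h1 := open_nbhs_nbhs (conj open_open_disc (w1 : U w)).
have h2 := open_nbhs_nbhs (conj (@open_annulus r) (rw : [set w : V | r < dot w w] w)).
by apply: filterS2 h1 h2 => z; exact: vh.
Qed.

(** Discards the meaningless values outside the disc. The result is differentiable on the whole
    plane as soon as [h] vanishes near the unit circle. *)
Definition ext0 (h : V -> R) (w : V) : R := if dot w w < 1 then h w else 0.

Section ext0.
Variables (r : R) (h : V -> R).
Hypotheses (r1 : r < 1) (vh : vanishes_beyond r h).
Hypothesis dh : forall w, U w -> differentiable h w.

Let near_in w : U w -> \near w, h w = ext0 h w.
Proof.
move=> Uw; have := open_nbhs_nbhs (conj open_open_disc Uw).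
by apply: filterS => z Uz; rewrite /ext0 ifT.
Qed.

(** The open set beyond [r < 1] is a neighbourhood of every point outside the disc, the unit circle
    included, so the cut made by [ext0] is invisible. *)
Let near_out w : ~~ (dot w w < 1) -> \near w, cst 0 w = ext0 h w.
Proof.
rewrite -leNgt => w1; have rw : r < dot w w by exact: lt_le_trans w1.
have := open_nbhs_nbhs (conj (@open_annulus r) (rw : [set w : V | r < dot w w] w)).
by apply: filterS => z rz; rewrite /ext0; case: ifP => // z1; rewrite vh.
Qed.

Lemma differentiable_ext0 w : differentiable (ext0 h) w.
Proof.
have [w1|w1] := boolP (dot w w < 1).
  exact: (near_eq_differentiable (near_in w1) (dh w1)).
exact: (near_eq_differentiable (near_out w1)).
Qed.

Lemma derive_ext0 v w : 'D_v (ext0 h) w = ext0 (fun w => 'D_v h w) w.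
Proof.
rewrite {2}/ext0; case: ifPn => w1.
  by apply/esym; apply: near_eq_derive; exact: near_in.
by rewrite -(near_eq_derive _ (near_out w1)) derive_cst.
Qed.

Lemma continuous_ext0 : continuous (ext0 h).
Proof. move=> w; apply: differentiable_continuous; exact: differentiable_ext0. Qed.

Lemma bounded_ext0 : exists C, forall w, `|ext0 h w| <= C.
Proof.
pose A : set V := [set v | forall i, `[(-1 : R), 1]%classic (v ord0 i)].
have cA : compact A by apply: (@rV_compact R 2 (fun=> `[(-1 : R), 1]%classic)) => i; exact: segment_compact.
have A0 : A !=set0.
  by exists 0 => i /=; rewrite mxE in_itv /= lerN10 ler01.
have cn : continuous (fun w => `|ext0 h w|).
  by move=> w; apply: (continuous_comp (continuous_ext0 (x := w))); exact: norm_continuous.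
have [c _ cmax] := EVT_max_rV A0 cA (continuous_subspaceT cn).
exists `|ext0 h c| => w.
have [w1|w1] := boolP (dot w w < 1); last by rewrite {1}/ext0 (negbTE w1) normr0.
apply: cmax; rewrite inE => i /=; rewrite in_itv /= -ler_norml.
rewrite -(@ler_sqr_ge0 _ _ 1) // expr1n real_normK ?num_real //.
apply: le_trans (ltW w1); rewrite /dot (bigD1 i) //= -expr2 lerDl.
by apply: sumr_ge0 => j _; rewrite -expr2 sqr_ge0.
Qed.

End ext0.

End disc.

(** * The potential of a function on the disc *)

Section curried.
Variable R : realType.
Local Notation V := 'rV[R]_2.
Local Notation U := (@open_disc R).

Definition cur (h : V -> R) (a b : R) : R := ext0 h (vec2 a b).

Lemma cur_supp h (a b : R) : 1 <= a ^+ 2 + b ^+ 2 -> cur h a b = 0.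
Proof. by rewrite /cur /ext0 dot_vec2 ltNge => ->. Qed.

Section one.
Variables (r : R) (h : V -> R).
Hypotheses (r1 : r < 1) (vh : vanishes_beyond r h).
Hypothesis dh : forall w, U w -> differentiable h w.

Lemma cur_ray_derivative c d :
  ray_derivative (cur h) (cur (fun w => 'D_(vec2 c d) h w)) c d.
Proof.
move=> a b t; rewrite /cur; under eq_fun do rewrite -vec2_line.
rewrite -(vec2_line a b c d t).
apply: (iffLR (is_derive_line (ext0 h) (vec2 a b) (vec2 c d) t _)).
rewrite -(derive_ext0 r1 vh).
by apply: derivableP; apply: diff_derivable; exact: (differentiable_ext0 r1 vh dh).
Qed.

Lemma cur_ray_continuous : ray_continuous (cur h).
Proof.
move=> a b c d t; apply: differentiable_continuous; apply/derivable1_diffP.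
by have [] := cur_ray_derivative c d a b t.
Qed.

Lemma cur_measurable : measurable_fun setT (fun z : R * R => cur h z.1 z.2).
Proof.
apply: measurable_caratheodory.
  move=> b; have := @cur_ray_continuous 0 b 1 0.
  by under eq_fun do rewrite mulr1 mulr0 add0r addr0.
move=> a; apply: continuous_measurable_fun; have := @cur_ray_continuous a 0 0 1.
by under eq_fun do rewrite mulr1 mulr0 add0r addr0.
Qed.

Lemma cur_bounded : exists C, forall a b, `|cur h a b| <= C.
Proof. by have [C hC] := bounded_ext0 r1 vh dh; exists C => a b; exact: hC. Qed.

Lemma cur_derive c d (a b : R) : cur (fun w => 'D_(vec2 c d) h w) a b =
  c * cur (fun w => 'D_(vec2 1 0) h w) a b + d * cur (fun w => 'D_(vec2 0 1) h w) a b.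
Proof.
rewrite /cur /ext0; case: (boolP (dot (vec2 a b) (vec2 a b) < 1)) => w1; last first.
  by rewrite (mulr0 c) (mulr0 d) addr0.
have dw : differentiable h (vec2 a b) by exact: dh.
rewrite !deriveE //.
have -> : vec2 c d = c *: vec2 1 0 + d *: vec2 0 1.
  by apply/rowP => i; rewrite !mxE; case: ifP => _; rewrite !mulr1 !mulr0 ?addr0 ?add0r.
by rewrite linearD !linearZ.
Qed.

End one.

(** Twice the planar logarithmic potential, with the integration variable centred at [w], so that
    derivatives in [w] fall on the density alone. *)
Definition newton (h : V -> R) (w : V) : R :=
  (\int[lebesgue2 R]_z (cur h (w ord0 ord0 + z.1) (w ord0 (inord 1) + z.2) * lnsq z))%R.

Lemma is_derive_newton_cur (r : R) h (v w : V) : r < 1 -> vanishes_beyond r h ->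
  diffn U 1 h -> dot v v <= 1 -> dot w w <= 1 ->
  is_derive w v (newton h) (newton (fun w => 'D_v h w) w).
Proof.
move=> r1 vh [dh Dh] v1 w1.
have [dDh _] := Dh v; have vDh := vanishes_derive v vh.
have [C1 hC1] := cur_bounded r1 vh dh; have [C2 hC2] := cur_bounded r1 vDh dDh.
rewrite -[X in is_derive X](addr0 w) -(scale0r v); apply/is_derive_line.
rewrite /newton; under eq_fun do rewrite !mxE.
rewrite !dot2E -!expr2 in v1 w1.
apply: (@is_derive_newton _ _ _ (C1 + C2)) => //.
- exact: (cur_measurable r1 vh dh).
- by move=> a b; apply: le_trans (hC1 a b) _; rewrite lerDl (le_trans _ (hC2 a b)).
- by move=> a b; apply: le_trans (hC2 a b) _; rewrite lerDr (le_trans _ (hC1 a b)).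
- by move=> a b; exact: cur_supp.
- by move=> a b; exact: cur_supp.
- move=> a b t; have := cur_ray_derivative r1 vh dh (v ord0 ord0) (v ord0 (inord 1)) a b t.
  by rewrite vec2_eta.
Qed.

Lemma newton_laplacian (r : R) g (w : V) : r < 1 -> vanishes_beyond r g ->
  diffn U 2 g -> dot w w < 1 ->
  newton (fun w => 'D_(vec2 1 0) (fun w => 'D_(vec2 1 0) g w) w) w +
  newton (fun w => 'D_(vec2 0 1) (fun w => 'D_(vec2 0 1) g w) w) w = 4 * pi * g w.
Proof.
move=> r1 vg dg2 w1; have [dg Dg] := dg2.
pose g1 := fun w => 'D_(vec2 1 0) g w; pose g2 := fun w => 'D_(vec2 0 1) g w.
have [d1 D1] : diffn U 1 g1 by exact: Dg.
have [d2 D2] : diffn U 1 g2 by exact: Dg.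
pose g11 := fun w => 'D_(vec2 1 0) g1 w; pose g22 := fun w => 'D_(vec2 0 1) g2 w.
suff : newton g11 w + newton g22 w = 4 * pi * g w by [].
have [d11 _] : diffn U 0 g11 by exact: D1.
have [d22 _] : diffn U 0 g22 by exact: D2.
have v1 : vanishes_beyond r g1 by exact: vanishes_derive.
have v2 : vanishes_beyond r g2 by exact: vanishes_derive.
have v11 : vanishes_beyond r g11 by exact: vanishes_derive.
have v22 : vanishes_beyond r g22 by exact: vanishes_derive.
have [C1 b1] := cur_bounded r1 v1 d1; have [C2 b2] := cur_bounded r1 v2 d2.
have [C11 b11] := cur_bounded r1 v11 d11; have [C22 b22] := cur_bounded r1 v22 d22.
pose C := C1 + C2 + (C11 + C22).
have p1 : 0 <= C1 by exact: le_trans (b1 0 0).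
have p2 : 0 <= C2 by exact: le_trans (b2 0 0).
have p11 : 0 <= C11 by exact: le_trans (b11 0 0).
have p22 : 0 <= C22 by exact: le_trans (b22 0 0).
have bnd (h : V -> R) (D : R) : (forall a b, `|cur h a b| <= D) -> D <= C ->
  forall a b, `|cur h a b| <= C by move=> hD DC a b; exact: le_trans (hD a b) DC.
have c1 := bnd _ _ b1 (_ : C1 <= C); have c2 := bnd _ _ b2 (_ : C2 <= C).
have c11 := bnd _ _ b11 (_ : C11 <= C); have c22 := bnd _ _ b22 (_ : C22 <= C).
have {}c1 : forall a b, `|cur g1 a b| <= C by apply: c1; rewrite /C; lra.
have {}c2 : forall a b, `|cur g2 a b| <= C by apply: c2; rewrite /C; lra.
have {}c11 : forall a b, `|cur g11 a b| <= C by apply: c11; rewrite /C; lra.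
have {}c22 : forall a b, `|cur g22 a b| <= C by apply: c22; rewrite /C; lra.
have w1' : w ord0 ord0 ^+ 2 + w ord0 (inord 1) ^+ 2 <= 1.
  by rewrite ltW //; move: w1; rewrite dot2E -!expr2.
have m11 := cur_measurable r1 v11 d11; have m22 := cur_measurable r1 v22 d22.
have s11 := @cur_supp g11; have s22 := @cur_supp g22.
have E := @integral_laplacian_lnsq R (cur g) (cur g1) (cur g2) (cur g11) (cur g22) C
  (cur_measurable r1 v1 d1) (cur_measurable r1 v2 d2) m11 m22 c1 c2 c11 c22
  (@cur_supp g) (@cur_supp g1) (@cur_supp g2) s11 s22
  (cur_ray_continuous r1 v1 d1) (cur_ray_continuous r1 v2 d2)
  (cur_ray_continuous r1 v11 d11) (cur_ray_continuous r1 v22 d22)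
  (cur_ray_derivative r1 v1 d1 1 0) (cur_ray_derivative r1 v2 d2 0 1) _ _ _ w1'.
have i11 := @integrable_mul_lnsq R _ C m11 c11 s11 _ _ w1'.
have i22 := @integrable_mul_lnsq R _ C m22 c22 s22 _ _ w1'.
have n11 : (newton g11 w)%:E = _ := fineK (integrable_fin_num measurableT i11).
have n22 : (newton g22 w)%:E = _ := fineK (integrable_fin_num measurableT i22).
apply: EFin_inj; apply: (@etrans _ _ ((newton g11 w)%:E + (newton g22 w)%:E)%E); first by [].
apply: (etrans (f_equal2 adde n11 n22)).
apply: (etrans (E _)).
  move=> c d a b t; have := cur_ray_derivative r1 vg dg c d a b t.
  by rewrite (cur_derive dg).
by rewrite /cur vec2_eta /ext0 ifT.
Qed.

End curried.

(** * Integrals over circles and spheres against a logarithm *)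

Section sphere_log.
Variable R : realType.
Local Notation mu := (@lebesgue_measure R).

Definition graph3 (z : R * R) : R := Num.sqrt (1 - (z.1 ^+ 2 + z.2 ^+ 2)).

Definition graph_weight (z : R * R) : R :=
  if z.1 ^+ 2 + z.2 ^+ 2 < 1 then (graph3 z)^-1 else 0.

Lemma measurable_graph3 : measurable_fun setT graph3.
Proof. by rewrite /graph3; meas. Qed.

Lemma measurable_graph_weight : measurable_fun setT graph_weight.
Proof. by rewrite /graph_weight /graph3; meas. Qed.

Variables (K : R -> R -> R) (C : R).
Hypothesis mK : measurable_fun setT (fun z : R * R => K z.1 z.2).
Hypothesis KC : forall a b, `|K a b| <= C.

Variables u1 u2 u3 v1 v2 v3 k1 k2 k3 : R.
Hypotheses (uu : u1 * u1 + u2 * u2 + u3 * u3 = 1) (vv : v1 * v1 + v2 * v2 + v3 * v3 = 1)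
  (kk : k1 * k1 + k2 * k2 + k3 * k3 = 1) (uv : u1 * v1 + u2 * v2 + u3 * v3 = 0)
  (uk : u1 * k1 + u2 * k2 + u3 * k3 = 0) (vk : v1 * k1 + v2 * k2 + v3 * k3 = 0).

Let p (ui vi ki : R) (x : R * R) : R :=
  Num.sqrt (1 - x.1 ^+ 2) * (cos x.2 * ui + sin x.2 * vi) + x.1 * ki.

Let P (x : R * R) : R * R * R := (p u1 v1 k1 x, p u2 v2 k2 x, p u3 v3 k3 x).

(** The function on the sphere given by [K] in the graph chart of the upper hemisphere and by 0
    below it, read on the circle at height [s] along the axis [k]. *)
Definition sphere_slice (s t : R) : R :=
  if 0 < p u3 v3 k3 (s, t) then K (p u1 v1 k1 (s, t)) (p u2 v2 k2 (s, t)) else 0.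

Let C0 : 0 <= C. Proof. exact: le_trans (KC 0 0). Qed.

Let mp (a b c : R) : measurable_fun setT (p a b c).
Proof. by rewrite /p; meas. Qed.

Let mP : measurable_fun setT P.
Proof. by apply: measurable_fun_pair; [apply: measurable_fun_pair|]; exact: mp. Qed.

Lemma integrable_sphere_slice s :
  mu.-integrable `[0, 2 * pi] (fun t => (sphere_slice s t)%:E).
Proof.
have mS : measurable_fun setT (sphere_slice s).
  rewrite /sphere_slice; apply: measurable_fun_ifT => //.
  - by apply: measurable_fun_ltr => //; rewrite /p /=; meas.
  - apply: (measurableT_comp (f := fun z : R * R => K z.1 z.2)
      (g := fun t : R => (p u1 v1 k1 (s, t), p u2 v2 k2 (s, t)))) => //.
    by rewrite /p /=; meas.
apply: (@le_integrable _ _ _ mu _ _ _ (fun=> C%:E)) => //.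
- by apply/measurable_EFinP; exact: measurable_funTS.
- move=> t _; rewrite /= lee_fin (ger0_norm C0) /sphere_slice.
  by case: ifP => _ //; rewrite normr0.
- exact: integrable_cst_itv.
Qed.

(** The component along the axis is the parameter [s]; this is how [ln |s - c|] becomes a function
    of the point of the sphere. *)
Let kP x : k1 * (P x).1.1 + k2 * (P x).1.2 + k3 * (P x).2 = x.1.
Proof.
rewrite /P /p /=.
transitivity (Num.sqrt (1 - x.1 ^+ 2) * (cos x.2 * (u1 * k1 + u2 * k2 + u3 * k3)
  + sin x.2 * (v1 * k1 + v2 * k2 + v3 * k3)) + x.1 * (k1 * k1 + k2 * k2 + k3 * k3)).
  by ring.
by rewrite uk vk kk !mulr0 addr0 mulr0 add0r mulr1.
Qed.

Let inX (x : R * R) : bool := (x.1 ^+ 2 < 1) && ((0 <= x.2) && (x.2 <= 2 * pi)).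
Let a (x : R * R) : R := if inX x && (0 < p u3 v3 k3 x) then 1 else 0.

Let minX : measurable_fun setT inX.
Proof. by rewrite /inX; meas. Qed.

Let ma : measurable_fun setT a.
Proof. by rewrite /a /inX /p; meas. Qed.

Let a0 x : 0 <= a x. Proof. by rewrite /a; case: ifP. Qed.

Let transfer_ge0 (H : R * R * R -> \bar R) : measurable_fun setT H -> (forall z, 0 <= H z)%E ->
  (\int[lebesgue2 R]_x ((a x)%:E * H (P x)) =
   \int[lebesgue2 R]_z ((graph_weight z)%:E * H (z, graph3 z)))%E.
Proof.
move=> mH H0.
have mg3 := measurable_graph3; have mgw := measurable_graph_weight.
(* [ge0_integral_sphere] asks for a function that vanishes on the lower hemisphere; truncation
   provides it, and the factor [0 < p u3 v3 k3 x] in [a] accounts for it. *)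
pose H' (q : R * R * R) : \bar R := if (0 < q.2)%R then H q else 0%E.
have mH' : measurable_fun setT H' by rewrite /H'; meas.
have H'0 q : (0 <= H' q)%E by rewrite /H'; case: ifP.
have mHP : measurable_fun setT (fun x => H (P x)) by exact: (measurableT_comp mH mP).
have E := @ge0_integral_sphere R H' mH' H'0 u1 u2 u3 v1 v2 v3 k1 k2 k3 _ uu vv kk uv uk vk.
rewrite !lebesgue2_tonelli; last first.
- by move=> x; rewrite mule_ge0 // lee_fin.
- by apply: emeasurable_funM => //; exact/measurable_EFinP.
- move=> z; rewrite mule_ge0 // lee_fin /graph_weight; case: ifP => // _.
  by rewrite invr_ge0 sqrtr_ge0.
- apply: emeasurable_funM; first exact/measurable_EFinP.
  apply: (measurableT_comp mH); apply: measurable_fun_pair => //; exact: measurable_id.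
transitivity (\int[mu]_s (if (s ^+ 2 < 1)%R then \int[mu]_(t in `[0%R, (2 * pi)%R]) H' (P (s, t)) else 0))%E.
  apply: eq_integral => s _; case: ifP => s1; last first.
    by apply: integral0_eq => t _; rewrite /a /inX /= s1 mul0e.
  rewrite integral_itv_if; apply: eq_integral => t _; rewrite /a /inX /= s1 /=.
  apply/esym; case: ifP => t1 /=; last by rewrite mul0e.
  by rewrite /H' /=; case: ifP => _; rewrite ?mul1e ?mul0e.
apply: (etrans (E _)).
  by move=> x y z z0; rewrite /H' /= ltNge z0.
apply: eq_integral => x _; apply: eq_integral => y _; rewrite /graph_weight /graph3 /=.
case: ifP => xy; last by rewrite mul0e.
by rewrite /H' /= ifT // sqrtr_gt0 subr_gt0.
Qed.

(** Turns the integral over [tau] of circle integrals against the logarithm into one integral over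
    the disc. Integrability is checked in the variables [(s, t)], where the integrand is dominated
    by [C |ln |s - c||], and is then transferred to the disc. *)
Lemma sphere_log (c : R) : `|c| <= 1 ->
  (lebesgue2 R).-integrable setT (fun z => (graph_weight z *
    (K z.1 z.2 * ln `|k1 * z.1 + k2 * z.2 + k3 * graph3 z - c|))%:E) /\
  (\int[mu]_(s in `[(-1)%R, 1%R])
     ((if (s ^+ 2 < 1)%R then (\int[mu]_(t in `[0%R, (2 * pi)%R]) sphere_slice s t)%R else 0)
      * ln `|s - c|)%:E =
   \int[lebesgue2 R]_z (graph_weight z *
    (K z.1 z.2 * ln `|k1 * z.1 + k2 * z.2 + k3 * graph3 z - c|))%:E)%E.
Proof.
move=> c1; have pi0 : 0 < pi :> R := pi_gt0 R.
have mg3 := measurable_graph3; have mgw := measurable_graph_weight.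
pose h (q : R * R * R) : R := K q.1.1 q.1.2 * ln `|k1 * q.1.1 + k2 * q.1.2 + k3 * q.2 - c|.
have mh : measurable_fun setT h.
  rewrite /h; apply: measurable_funM; last by meas.
  by apply: (measurableT_comp mK); meas.
have hP x : h (P x) = K (p u1 v1 k1 x) (p u2 v2 k2 x) * ln `|x.1 - c| by rewrite /h kP.
have mah : measurable_fun setT (fun x => a x * h (P x)).
  by apply: measurable_funM => //; exact: (measurableT_comp mh mP).
have mB : measurable_fun setT (fun x : R * R => (if inX x then C * `|ln `|x.1 - c| | else 0)%:E).
  by meas.
have iX : (lebesgue2 R).-integrable setT (fun x => (a x * h (P x))%:E).
  apply/integrableP; split; first exact/measurable_EFinP.
  apply: (@le_lt_trans _ _ (\int[lebesgue2 R]_x (if inX x then C * `|ln `|x.1 - c| | else 0)%:E)%E).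
    apply: ge0_le_integral => //.
    - by apply: measurableT_comp => //; exact/measurable_EFinP.
    - move=> x _; rewrite /= lee_fin hP /a; case: ifP => [/andP[-> _]|_]; rewrite ?mul1r ?mul0r ?normr0.
        by rewrite normrM ler_wpM2r.
      by case: ifP => // _; rewrite mulr_ge0.
  rewrite lebesgue2_tonelli //; last by move=> x; rewrite lee_fin; case: ifP => // _; rewrite mulr_ge0.
  rewrite /=.
  have -> : (\int[mu]_s \int[mu]_t (if inX (s, t) then C * `|ln `|s - c| | else 0)%:E =
     \int[mu]_s (if (s ^+ 2 < 1)%R then ((2 * pi * C) * `|ln `|s - c| |)%:E else 0))%E.
    apply: eq_integral => s _; rewrite /inX /=; case: ifP => s1 /=; last by rewrite integral0_eq.
    transitivity (\int[mu]_(t in `[0%R, (2 * pi)%R]) cst (C * `|ln `|s - c| |)%:E t)%E.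
      by rewrite integral_itv_if; apply: eq_integral => t _; case: ifP.
    rewrite integral_cst //= lebesgue_measure_itv /= lte_fin mulr_gt0 // sube0 -EFinM.
    by congr EFin; ring.
  apply: (@le_lt_trans _ _ ((2 * pi * C)%:E * \int[mu]_(s in `[(-1)%R, 1%R]) (`|ln `|s - c| |)%:E)%E); last first.
    by rewrite lte_mul_pinfty ?lee_fin ?mulr_ge0 ?(ltW pi0) // integral_norm_ln.
  rewrite integral_itv_if -ge0_integralZl_EFin //; last 3 first.
  - by move=> s _; case: ifP.
  - by meas.
  - by rewrite mulr_ge0 // mulr_ge0 // ltW.
  apply: ge0_le_integral => //.
  - by move=> s _; case: ifP => // _; rewrite lee_fin mulr_ge0 // mulr_ge0 // mulr_ge0 // ltW.
  - by meas.
  - by meas.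
  - move=> s _; case: ifP => s1.
      rewrite ifT ?EFinM // -ler_norml ltW //.
      by rewrite -(expr_lt1 (n := 2)) // real_normK ?num_real.
    by case: ifP; rewrite ?mule0 // => _; rewrite -EFinM lee_fin mulr_ge0 // mulr_ge0 // mulr_ge0 // ltW.
have mg : measurable_fun setT (fun z : R * R => (z, graph3 z)).
  by apply: measurable_fun_pair => //; exact: measurable_id.
have gw0 z : 0 <= graph_weight z.
  by rewrite /graph_weight; case: ifP => // _; rewrite invr_ge0 sqrtr_ge0.
have [iY E] := @integral_transfer R _ _ _ _ _ _ (lebesgue2 R) (lebesgue2 R) P
  (fun z : R * R => (z, graph3 z)) a graph_weight h mP mg ma mgw a0 gw0 transfer_ge0 mh iX.
split; first exact: iY.
apply: (etrans _ E); rewrite (lebesgue2_fubini iX) integral_itv_if.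
apply: eq_integral => s _.
have [s1|s1] := boolP (s ^+ 2 < 1); last first.
  rewrite mul0r if_same integral0_eq // => t _.
  by rewrite /a /inX /= (negbTE s1) mul0r.
have sI : (-1 <= s) && (s <= 1).
  by rewrite -ler_norml ltW // -(expr_lt1 (n := 2)) // real_normK ?num_real.
rewrite sI.
have iS := integrable_sphere_slice s.
rewrite EFinM /Rintegral fineK; last exact: (integrable_fin_num _ iS).
rewrite -integralZr // integral_itv_if.
apply: eq_integral => t _; rewrite hP /a /inX /= s1 /= /sphere_slice.
by case: ifP => _; rewrite ?mul0r //=; case: ifP => _; rewrite -?EFinM ?mul1r ?mul0r.
Qed.

End sphere_log.

(** * Averaging the logarithm over the boundary of the cap *)

Section circle_average.
Variable R : realType.
Local Notation mu := (@lebesgue_measure R).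

Lemma prod_set1 (x : R * R) : [set x] = [set x.1] `*` [set x.2].
Proof. by apply/seteqP; split => [z -> //|[z1 z2] [/= -> ->]]; case: x. Qed.

Lemma lebesgue2_set1 (x : R * R) : lebesgue2 R [set x] = 0%E.
Proof.
rewrite prod_set1; apply: (etrans (product_measure1E _ _ _ _)) => //.
apply: (etrans (f_equal2 mule (lebesgue_measure_set1 _) (lebesgue_measure_set1 _))).
by rewrite mule0.
Qed.

Lemma lebesgue2_eq_except (x : R * R) (F H : R * R -> R) :
  measurable_fun setT F -> measurable_fun setT H -> (forall z, z != x -> F z = H z) ->
  (\int[lebesgue2 R]_z (F z)%:E = \int[lebesgue2 R]_z (H z)%:E)%E.
Proof.
move=> mF mH FH; apply: ae_eq_integral => //; [exact/measurable_EFinP|exact/measurable_EFinP|].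
exists [set x]; split => //.
- by rewrite prod_set1; apply: measurableX.
- exact: lebesgue2_set1.
- move=> z /= nFH; apply: contrapT => /eqP zx; apply: nFH => _.
  by rewrite FH.
Qed.

Lemma integrable_disc (H : R -> R -> R) (E : R) :
  measurable_fun setT (fun z : R * R => H z.1 z.2) -> (forall a b, `|H a b| <= E) ->
  (forall a b, 1 <= a ^+ 2 + b ^+ 2 -> H a b = 0) ->
  (lebesgue2 R).-integrable setT (fun z => (H z.1 z.2)%:E).
Proof.
move=> mH HE Hs; apply: (@integrable_polar_bound _ (fun z => H z.1 z.2) 1 E) => //.
- move=> z; rewrite /ball2 expr1n -ltNge => z1; apply: Hs; exact: ltW.
- move=> s t s0 s1 /=; rewrite -[E]mul1r; apply: ler_pM => //; exact: ltW.
Qed.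

(** The bound is affine in [ln y], so the exact average of the logarithm also controls the average
    of its absolute value; this is what Fubini needs. *)
Lemma norm_ln_le_linear (y : R) : 0 <= y -> `|ln y| <= 2 * y - ln y.
Proof.
rewrite le_eqVlt => /orP[/eqP <-|y0]; first by rewrite ln0 // normr0 mulr0 subr0.
have l1 : ln y <= y.
  have -> : y = 1 + (y - 1) by ring.
  by apply: (le_trans (le_ln1Dx _)); lra.
have [l0|l0] := leP 0 (ln y); first by rewrite ger0_norm //; lra.
by rewrite ltr0_norm //; lra.
Qed.

(** Write [p], [q] for the heights of the two points and [X], [Z] for the squared norms of their
    projections. Then [X - Z = (q - p) (q + p)] with [p + q >= 2 c], because both points are in the
    cap. On the other hand [X - Z] is, up to sign, the inner product of [z - x] and [z + x];
    Cauchy-Schwarz and [|z + x| <= 2 S] bound its square by [4 S^2 |z - x|^2]. The factor 4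
    cancels. *)
Lemma cap_distance (S c : R) (x z : R * R) : 0 <= c -> S ^+ 2 + c ^+ 2 = 1 ->
  x.1 ^+ 2 + x.2 ^+ 2 <= S ^+ 2 -> z.1 ^+ 2 + z.2 ^+ 2 <= S ^+ 2 ->
  c ^+ 2 * (graph3 z - graph3 x) ^+ 2 <= S ^+ 2 * ((z.1 - x.1) ^+ 2 + (z.2 - x.2) ^+ 2).
Proof.
move=> c0 Sc xS zS; rewrite /graph3.
have S2 : S ^+ 2 = 1 - c ^+ 2 by rewrite -Sc addrK.
set X := x.1 ^+ 2 + x.2 ^+ 2 in xS *; set Z := z.1 ^+ 2 + z.2 ^+ 2 in zS *.
have c2 := sqr_ge0 c.
have X0 : c ^+ 2 <= 1 - X by lra.
have Z0 : c ^+ 2 <= 1 - Z by lra.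
have xc : c <= Num.sqrt (1 - X).
  by rewrite -ler_sqr_ge0 ?sqrtr_ge0 // sqr_sqrtr // (le_trans c2).
have zc : c <= Num.sqrt (1 - Z).
  by rewrite -ler_sqr_ge0 ?sqrtr_ge0 // sqr_sqrtr // (le_trans c2).
have xx := sqr_sqrtr (le_trans c2 X0); have zz := sqr_sqrtr (le_trans c2 Z0).
move: (Num.sqrt (1 - X)) (Num.sqrt (1 - Z)) xc zc xx zz => p q pc qc pp qq.
have h1 : c ^+ 2 * 4 <= (p + q) ^+ 2.
  have -> : c ^+ 2 * 4 = (c + c) ^+ 2 by ring.
  by rewrite ler_sqr_ge0 ?addr_ge0 ?lerD // (le_trans c0).
have h2 : (q - p) ^+ 2 * (p + q) ^+ 2 = (X - Z) ^+ 2.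
  have -> : X - Z = q ^+ 2 - p ^+ 2 by rewrite pp qq; ring.
  by ring.
pose D := (z.1 - x.1) ^+ 2 + (z.2 - x.2) ^+ 2; rewrite -/D.
pose T := (z.1 + x.1) ^+ 2 + (z.2 + x.2) ^+ 2.
have D0 : 0 <= D by rewrite addr_ge0 // sqr_ge0.
have TS : T <= 4 * S ^+ 2.
  have := addr_ge0 (sqr_ge0 (z.1 - x.1)) (sqr_ge0 (z.2 - x.2)).
  have : T + D = 2 * X + 2 * Z by rewrite /T /D /X /Z; ring.
  by rewrite -/D; lra.
have h3 : (X - Z) ^+ 2 <= D * T.
  have -> : D * T = (X - Z) ^+ 2 + ((z.1 - x.1) * (z.2 + x.2) - (z.2 - x.2) * (z.1 + x.1)) ^+ 2.
    by rewrite /D /T /X /Z; ring.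
  by rewrite lerDl sqr_ge0.
have h4 : (q - p) ^+ 2 * (c ^+ 2 * 4) <= (q - p) ^+ 2 * (p + q) ^+ 2 by rewrite ler_wpM2l // sqr_ge0.
have h5 : D * T <= D * (4 * S ^+ 2) by rewrite ler_wpM2l.
move: h4 h5 h3; rewrite h2.
have -> : (q - p) ^+ 2 * (c ^+ 2 * 4) = 4 * (c ^+ 2 * (q - p) ^+ 2) by ring.
have -> : D * (4 * S ^+ 2) = 4 * (S ^+ 2 * D) by ring.
move: (c ^+ 2 * _) (S ^+ 2 * D) (D * T) ((X - Z) ^+ 2) => m1 m2 m3 m4.
by lra.
Qed.

Variables (G : R -> R -> R) (C S c : R).
Hypothesis mG : measurable_fun setT (fun z : R * R => G z.1 z.2).
Hypothesis GC : forall a b, `|G a b| <= C.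
Hypotheses (S0 : 0 < S) (c0 : 0 <= c) (Sc : S ^+ 2 + c ^+ 2 = 1).
Hypothesis Gs : forall a b, G a b != 0 -> a ^+ 2 + b ^+ 2 < S ^+ 2.
Variables u1 u2 v1 v2 : R.
Hypotheses (uu : u1 * u1 + u2 * u2 = 1) (vv : v1 * v1 + v2 * v2 = 1) (uv : u1 * v1 + u2 * v2 = 0).
Variable x : R * R.
Hypothesis xS : x.1 ^+ 2 + x.2 ^+ 2 < S ^+ 2.

Let A (z : R * R) : R := S * (u1 * (z.1 - x.1) + u2 * (z.2 - x.2)).
Let B (z : R * R) : R := S * (v1 * (z.1 - x.1) + v2 * (z.2 - x.2)).
Let b (z : R * R) : R := c * (graph3 z - graph3 x).
Let Y (t : R) (z : R * R) : R := A z * cos t + B z * sin t + b z.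
Let D (z : R * R) : R := (z.1 - x.1) ^+ 2 + (z.2 - x.2) ^+ 2.

Let C0 : 0 <= C. Proof. exact: le_trans (GC 0 0). Qed.
Let pi0 : 0 < pi :> R. Proof. exact: pi_gt0. Qed.

Let S1 : S ^+ 2 <= 1. Proof. by rewrite -Sc lerDl sqr_ge0. Qed.

Let Gs1 a1 b1 : 1 <= a1 ^+ 2 + b1 ^+ 2 -> G a1 b1 = 0.
Proof.
move=> ab; apply/eqP; apply: contraT => /Gs; rewrite ltNge.
by rewrite (le_trans S1 ab).
Qed.

(* Parseval for the orthonormal frame (u, v) of the plane. *)
Let AB z : A z ^+ 2 + B z ^+ 2 = S ^+ 2 * D z.
Proof.
have e1 : u1 * u1 + v1 * v1 = 1 /\ u2 * u2 + v2 * v2 = 1 /\ u1 * u2 + v1 * v2 = 0.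
  have d : (u1 * v2 - u2 * v1) ^+ 2 = 1.
    transitivity ((u1 * u1 + u2 * u2) * (v1 * v1 + v2 * v2) - (u1 * v1 + u2 * v2) ^+ 2); first by ring.
    by rewrite uu vv uv; ring.
  (* For a square matrix [M], the entries of [M^T M - 1] and of [M M^T - 1] have the same sum of
     squares; orthonormal rows thus give orthonormal columns. *)
  have q : (u1 * u1 + v1 * v1 - 1) ^+ 2 + (u2 * u2 + v2 * v2 - 1) ^+ 2 + 2 * (u1 * u2 + v1 * v2) ^+ 2 = 0.
    transitivity ((u1 * u1 + u2 * u2 - 1) ^+ 2 + (v1 * v1 + v2 * v2 - 1) ^+ 2 + 2 * (u1 * v1 + u2 * v2) ^+ 2).
      by ring.
    by rewrite uu vv uv; ring.
  have s1 := sqr_ge0 (u1 * u1 + v1 * v1 - 1); have s2 := sqr_ge0 (u2 * u2 + v2 * v2 - 1).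
  have s3 := sqr_ge0 (u1 * u2 + v1 * v2).
  have z1 : (u1 * u1 + v1 * v1 - 1) ^+ 2 = 0 by apply/eqP; rewrite eq_le s1 andbT; move: q s2 s3; lra.
  have z2 : (u2 * u2 + v2 * v2 - 1) ^+ 2 = 0 by apply/eqP; rewrite eq_le s2 andbT; move: q s1 s3; lra.
  have z3 : (u1 * u2 + v1 * v2) ^+ 2 = 0 by apply/eqP; rewrite eq_le s3 andbT; move: q s1 s2; lra.
  move: z1 z2 z3 => /eqP; rewrite sqrf_eq0 subr_eq0 => /eqP -> /eqP; rewrite sqrf_eq0 subr_eq0 => /eqP ->.
  by move=> /eqP; rewrite sqrf_eq0 => /eqP ->.
case: e1 => e1 [e2 e3]; rewrite /A /B /D.
transitivity (S ^+ 2 * ((u1 * u1 + v1 * v1) * (z.1 - x.1) ^+ 2 + (u2 * u2 + v2 * v2) * (z.2 - x.2) ^+ 2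
  + 2 * (u1 * u2 + v1 * v2) * ((z.1 - x.1) * (z.2 - x.2)))); first by ring.
by rewrite e1 e2 e3; ring.
Qed.

Let b2 z : G z.1 z.2 != 0 -> b z ^+ 2 <= A z ^+ 2 + B z ^+ 2.
Proof.
move=> /Gs zS; rewrite AB /b exprMn; apply: cap_distance => //; exact: ltW.
Qed.

Let D_gt0 z : z != x -> 0 < D z.
Proof.
move=> zx; rewrite lt_def addr_ge0 ?sqr_ge0 // andbT.
apply: contra zx; rewrite paddr_eq0 ?sqr_ge0 // !sqrf_eq0 !subr_eq0 => /andP[/eqP h1 /eqP h2].
by rewrite (surjective_pairing z) h1 h2 -surjective_pairing.
Qed.

Let D_le4 z : G z.1 z.2 != 0 -> S ^+ 2 * D z <= 4.
Proof.
move=> /Gs zS; have s1 := S1; have D4 : D z <= 4.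
  have : D z + ((z.1 + x.1) ^+ 2 + (z.2 + x.2) ^+ 2) = 2 * (z.1 ^+ 2 + z.2 ^+ 2) + 2 * (x.1 ^+ 2 + x.2 ^+ 2).
    by rewrite /D; ring.
  have := addr_ge0 (sqr_ge0 (z.1 + x.1)) (sqr_ge0 (z.2 + x.2)).
  move: (D z) (_ + _) (z.1 ^+ 2 + z.2 ^+ 2) (x.1 ^+ 2 + x.2 ^+ 2) zS xS => d e f g.
  by lra.
have d0 : 0 <= D z by rewrite addr_ge0 // sqr_ge0.
by rewrite -[4]mul1r; apply: ler_pM => //; exact: sqr_ge0.
Qed.

(** 6 is 2 for each of the three terms: each of [A z], [B z], [b z] has square at most
    [S^2 D z <= 4]. *)
Let Y_le t z : G z.1 z.2 != 0 -> `|Y t z| <= 6.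
Proof.
move=> Gz; have d4 := D_le4 Gz; have bz := b2 Gz.
have sq (y : R) : y ^+ 2 <= 4 -> `|y| <= 2.
  move=> y4; rewrite -(@ler_sqr_ge0 _ _ 2) // real_normK ?num_real //.
  by have -> : 2 ^+ 2 = 4 :> R by ring.
have a2 : `|A z| <= 2 by apply: sq; apply: le_trans d4; rewrite -AB lerDl sqr_ge0.
have b2' : `|B z| <= 2 by apply: sq; apply: le_trans d4; rewrite -AB lerDr sqr_ge0.
have b3 : `|b z| <= 2 by apply: sq; apply: le_trans bz _; rewrite AB.
have h1 : `|A z * cos t| <= 2 by rewrite normrM -[2]mulr1; apply: ler_pM => //; exact: norm_cos_le1.
have h2 : `|B z * sin t| <= 2 by rewrite normrM -[2]mulr1; apply: ler_pM => //; exact: norm_sin_le1.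
rewrite /Y; apply: (le_trans (ler_normD _ _)); have := ler_normD (A z * cos t) (B z * sin t).
by lra.
Qed.

Let lnD z : z != x -> ln (Num.sqrt (A z ^+ 2 + B z ^+ 2) / 2) =
  2^-1 * lnsq (z.1 - x.1, z.2 - x.2) + ln (S / 2).
Proof.
move=> zx; have d0 := D_gt0 zx.
have sd : 0 < Num.sqrt (D z) by rewrite sqrtr_gt0.
rewrite AB sqrtrM ?sqr_ge0 // sqrtr_sqr (gtr0_norm S0).
have -> : ln (S * Num.sqrt (D z) / 2) = ln (Num.sqrt (D z)) + ln (S / 2).
  by rewrite -lnM ?posrE ?divr_gt0 //; congr ln; ring.
congr (_ + _); rewrite /lnsq /= -/(D z).
have := lnXn 2 sd; rewrite sqr_sqrtr ?(ltW d0) // => ->.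
by move: (ln _) => l; field.
Qed.

Let F (t : R) (z : R * R) : R := G z.1 z.2 * ln `|Y t z|.
Let F' (q : R * (R * R)) : R := if (0 <= q.1) && (q.1 <= 2 * pi) then F q.1 q.2 else 0.

Let mF' : measurable_fun setT F'.
Proof.
have mg3 := @measurable_graph3 R.
rewrite /F' /F; apply: measurable_fun_ifT => //; first by meas.
apply: measurable_funM; first by apply: (measurableT_comp mG); meas.
rewrite /Y /A /B /b; meas.
all: by apply: (measurableT_comp mg3); meas.
Qed.

Let lnS : ln (S / 2) <= 0.
Proof.
apply: ln_le0; have s1 : S <= 1 by rewrite -ler_sqr_ge0 ?(ltW S0) // expr1n.
by lra.
Qed.

(** The exact integral over [t] of [|G| (12 - ln |Y t z|)] for [z != x] with [G z.1 z.2 != 0]: 12 is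
    twice the bound 6 on [|Y|], as [norm_ln_le_linear] requires, and the rest is [2 pi] times the
    average given by [lnD]. *)
Let bound (z : R * R) : R :=
  `|G z.1 z.2| * (24 * pi - 2 * pi * ln (S / 2) - pi * lnsq (z.1 - x.1, z.2 - x.2)).

Let inner_norm z : (\int[mu]_t `|(F' (t, z))%:E| <= (bound z)%:E)%E.
Proof.
have -> : (\int[mu]_t `|(F' (t, z))%:E| = \int[mu]_(t in `[0%R, (2 * pi)%R]) (`|G z.1 z.2| * `|ln `|Y t z| |)%:E)%E.
  rewrite integral_itv_if; apply: eq_integral => t _; rewrite /F' /= /F.
  by case: ifP => _; rewrite ?normr0 // normrM.
have [Gz|Gz] := eqVneq (G z.1 z.2) 0.
  by rewrite /bound Gz normr0 mul0r integral0_eq // => t _; rewrite mul0r.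
(* At [z = x] the argument of the logarithm vanishes for all [t] and [ln 0 = 0], so the left-hand
   side is 0. It remains that [bound x] is nonnegative, which uses [ln (S / 2) <= 0]. *)
have [zx|zx] := eqVneq z x.
  rewrite integral0_eq; last first.
    move=> t _; have -> : Y t z = 0 by rewrite /Y /A /B /b zx !subrr; ring.
    by rewrite normr0 ln0 // normr0 mulr0.
  have l0 : lnsq ((0 : R), (0 : R)) = 0 by rewrite /lnsq /= expr0n /= addr0 ln0.
  rewrite lee_fin /bound mulr_ge0 // zx !subrr l0 mulr0 subr0.
  rewrite subr_ge0 (@le_trans _ _ 0) ?mulr_ge0 ?(ltW pi0) //.
  by rewrite mulr_ge0_le0 // mulr_ge0 // ltW.
have ab0 : 0 < A z ^+ 2 + B z ^+ 2 by rewrite AB mulr_gt0 ?exprn_gt0 ?D_gt0.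
have [iL EL] := integral_ln_affine_cos ab0 (b2 Gz).
rewrite -/(Y _ z) in iL EL.
apply: (@le_trans _ _ (\int[mu]_(t in `[0%R, (2 * pi)%R]) (`|G z.1 z.2|%:E * (12 - ln `|Y t z|)%:E))%E).
  apply: ge0_le_integral => //.
  - by apply: measurable_funTS; rewrite /Y; meas.
  - by apply: measurable_funTS; rewrite /Y; meas.
  - move=> t _; rewrite -EFinM lee_fin ler_wpM2l //.
    apply: (le_trans (norm_ln_le_linear (normr_ge0 _))); rewrite lerD2r.
    by have := Y_le t Gz; lra.
have ic := @integrable_cst_itv R 0 (2 * pi) 12.
have EB : (\int[mu]_(t in `[0%R, (2 * pi)%R]) (12 - ln `|Y t z|)%:E =
    \int[mu]_(t in `[0%R, (2 * pi)%R]) (cst (12 : R)%:E t) -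
    \int[mu]_(t in `[0%R, (2 * pi)%R]) (ln `|Y t z|)%:E)%E.
  apply: (@etrans _ _ (\int[mu]_(t in `[0%R, (2 * pi)%R]) (cst (12 : R)%:E t - (ln `|Y t z|)%:E))%E).
    by apply: eq_integral => t _; rewrite -EFinB.
  by rewrite integralB.
have iB : mu.-integrable `[0, 2 * pi] (fun t => (12 - ln `|Y t z|)%:E).
  have : mu.-integrable `[0, 2 * pi] (fun t => (12%:E - (ln `|Y t z|)%:E)%E) by apply: integrableB.
  by apply: eq_integrable.
rewrite integralZl //.
rewrite EB EL lnD // integral_cst //= lebesgue_measure_itv /= lte_fin mulr_gt0 // sube0.
rewrite -[X in (_ * X <= _)%E]/((12 * (2 * pi) -
  2 * pi * (2^-1 * lnsq (z.1 - x.1, z.2 - x.2) + ln (S / 2)))%:E).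
rewrite -EFinM lee_fin /bound le_eqVlt; apply/orP; left; apply/eqP; congr (_ * _).
by field.
Qed.

Lemma integrable_mul_lnsq_sub (H : R -> R -> R) (E : R) :
  measurable_fun setT (fun z : R * R => H z.1 z.2) -> (forall a b, `|H a b| <= E) ->
  (forall a b, 1 <= a ^+ 2 + b ^+ 2 -> H a b = 0) ->
  (lebesgue2 R).-integrable setT (fun z => (H z.1 z.2 * lnsq (z.1 - x.1, z.2 - x.2))%:E) /\
  (\int[lebesgue2 R]_z (H (x.1 + z.1)%R (x.2 + z.2)%R * lnsq z)%:E =
   \int[lebesgue2 R]_z (H z.1 z.2 * lnsq (z.1 - x.1, z.2 - x.2)%R)%:E)%E.
Proof.
move=> mH HE Hs; have ml := @measurable_lnsq R.
have x1 : x.1 ^+ 2 + x.2 ^+ 2 <= 1 by rewrite ltW // (lt_le_trans xS).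
have i := integrable_mul_lnsq mH HE Hs x1.
have m : measurable_fun setT (fun z : R * R => H (x.1 + z.1) (x.2 + z.2) * lnsq z).
  by apply/measurable_EFinP; exact: (measurable_int _ i).
have [i' ->] := @lebesgue2_shift R _ (- x.1) (- x.2) m i.
have e (z : R * R) : (x.1 + (- x.1 + z.1) = z.1) * (x.2 + (- x.2 + z.2) = z.2) *
   ((- x.1 + z.1, - x.2 + z.2) = (z.1 - x.1, z.2 - x.2)).
  by split; [split; ring|rewrite ![- _ + _]addrC].
split; last by apply: eq_integral => z _; rewrite /= !e.
by move: i'; under eq_fun do rewrite /= !e.
Qed.

(** [inner_norm] makes the integrand absolutely integrable in [(t, z)], so the integral over [t] may
    be done first; it is then given by [integral_ln_affine_cos], with [cap_distance] supplying the
    condition on [b] wherever [G] is nonzero. *)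
Lemma circle_average :
  (\int[mu]_(t in `[0%R, (2 * pi)%R]) \int[lebesgue2 R]_z (F t z)%:E =
   \int[lebesgue2 R]_z (2 * pi * (G z.1 z.2 * (2^-1 * lnsq (z.1 - x.1, z.2 - x.2) + ln (S / 2))))%:E)%E.
Proof.
have ml := @measurable_lnsq R.
have nG a1 b1 : `| `|G a1 b1| | <= C by rewrite normr_id.
have nGs a1 b1 : 1 <= a1 ^+ 2 + b1 ^+ 2 -> `|G a1 b1| = 0 by move=> /Gs1 ->; rewrite normr0.
have [ib _] := @integrable_mul_lnsq_sub (fun a1 b1 => `|G a1 b1|) C (measurableT_comp (@normr_measurable R setT) mG) nG nGs.
have iG := integrable_disc mG GC Gs1.
have ibound : (lebesgue2 R).-integrable setT (fun z => (bound z)%:E).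
  have i1 := integrableZl measurableT (24 * pi - 2 * pi * ln (S / 2)) (integrable_abse iG).
  have i2 := integrableZl measurableT (- pi) ib.
  have := integrableD measurableT i1 i2; apply: eq_integrable => // z _ /=.
  by rewrite -!EFinM -EFinD /bound; congr EFin; ring.
have mF : measurable_fun setT (fun q => (F' q)%:E) by apply/measurable_EFinP; exact: mF'.
have iF : (mu \x lebesgue2 R)%E.-integrable setT (fun q => (F' q)%:E).
  apply/integrable21ltyP => //.
  apply: (@le_lt_trans _ _ (\int[lebesgue2 R]_z (bound z)%:E)%E).
    apply: ge0_le_integral => //.
    - by move=> z _; exact: integral_ge0.
    - apply: (@measurable_fun_fubini_tonelli_G _ _ _ _ R mu (fun q => `|(F' q)%:E|%E)) => //.
      by apply: measurableT_comp.
    - exact: (measurable_int _ ibound).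
  by rewrite ltey_eq (integrable_fin_num measurableT ibound).
have E := @Fubini _ _ _ _ R mu (lebesgue2 R) _ iF.
transitivity (\int[mu]_t \int[lebesgue2 R]_z (F' (t, z))%:E)%E.
  rewrite integral_itv_if; apply: eq_integral => t _; rewrite /F' /=.
  by case: ifP => _ //; rewrite integral0_eq.
apply: (etrans E).
have mU : measurable_fun setT (fun z : R * R => 2 * pi * (G z.1 z.2 * (2^-1 * lnsq (z.1 - x.1, z.2 - x.2) + ln (S / 2)))).
  have : measurable_fun setT (fun z : R * R => lnsq (z.1 - x.1, z.2 - x.2)).
    by apply: (measurableT_comp ml); meas.
  by move=> mm; meas.
have fin z : (\int[mu]_t (F' (t, z))%:E)%E \is a fin_num.
  have mz : measurable_fun setT (fun t => (F' (t, z))%:E).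
    apply: (measurableT_comp (f := fun q => (F' q)%:E) (g := fun t : R => (t, z))) => //; by meas.
  apply: (integrable_fin_num measurableT); apply/integrableP; split => //.
  by apply: le_lt_trans (inner_norm z) _; rewrite ltry.
transitivity (\int[lebesgue2 R]_z (fine (\int[mu]_t (F' (t, z))%:E))%:E)%E.
  by apply: eq_integral => z _; rewrite fineK.
(* At [z = x] the coefficients [A] and [B] both vanish and the average formula does not apply; a
   single point is negligible. *)
apply: (lebesgue2_eq_except (x := x)) => //.
  by apply: measurableT_comp => //; exact: (measurable_fubini_G iF).
move=> z zx; have -> : (\int[mu]_t (F' (t, z))%:E = \int[mu]_(t in `[0%R, (2 * pi)%R]) ((G z.1 z.2)%:E * (ln `|Y t z|)%:E))%E.
  by rewrite integral_itv_if; apply: eq_integral => t _; rewrite /F' /= /F; case: ifP.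
have [Gz|Gz] := eqVneq (G z.1 z.2) 0.
  by rewrite Gz mul0r mulr0 integral0_eq // => t _; rewrite mul0e.
have ab0 : 0 < A z ^+ 2 + B z ^+ 2 by rewrite AB mulr_gt0 ?exprn_gt0 ?D_gt0.
have [iL EL] := integral_ln_affine_cos ab0 (b2 Gz).
rewrite integralZl // EL lnD //=; by ring.
Qed.

End circle_average.

(** * The inversion formula *)

Section space.
Variable R : realType.

Lemma dot3E (x y : 'rV[R]_3) : dot x y = x ord0 ord0 * y ord0 ord0 +
  x ord0 (inord 1) * y ord0 (inord 1) + x ord0 (inord 2) * y ord0 (inord 2).
Proof.
rewrite /dot !big_ord_recl big_ord0 addr0 addrA.
have -> : lift ord0 ord0 = inord 1 :> 'I_3 by apply: val_inj; rewrite /= inordK.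
by have -> : lift ord0 (lift ord0 ord0) = inord 2 :> 'I_3 by apply: val_inj; rewrite /= inordK.
Qed.

Lemma vec3_0 (a b c : R) : vec3 a b c ord0 ord0 = a. Proof. by rewrite mxE. Qed.
Lemma vec3_1 (a b c : R) : vec3 a b c ord0 (inord 1) = b. Proof. by rewrite mxE inordK. Qed.
Lemma vec3_2 (a b c : R) : vec3 a b c ord0 (inord 2) = c. Proof. by rewrite mxE inordK. Qed.

Lemma vec3_eta (y : 'rV[R]_3) : vec3 (y ord0 ord0) (y ord0 (inord 1)) (y ord0 (inord 2)) = y.
Proof.
apply/rowP => i; rewrite mxE; case: i => -[|[|[|//]]] h /=; congr (y _ _); apply: val_inj => //=;
  by rewrite inordK.
Qed.

Lemma dot_e3 (y : 'rV[R]_3) : dot y (e3 R) = y ord0 (inord 2).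
Proof. by rewrite dot3E vec3_0 vec3_1 vec3_2 !mulr0 !add0r mulr1. Qed.

Lemma dot_sqr_le1 (x y : 'rV[R]_3) : S2 x -> S2 y -> `|dot x y| <= 1.
Proof.
rewrite /S2 /= !dot3E => xx yy.
rewrite -(@ler_sqr_ge0 _ _ 1) // expr1n real_normK ?num_real //.
move: xx yy; move: (x ord0 ord0) (x ord0 (inord 1)) (x ord0 (inord 2)) => x0 x1 x2.
move: (y ord0 ord0) (y ord0 (inord 1)) (y ord0 (inord 2)) => y0 y1 y2 xx yy.
have -> : (x0 * y0 + x1 * y1 + x2 * y2) ^+ 2 =
  (x0 * x0 + x1 * x1 + x2 * x2) * (y0 * y0 + y1 * y1 + y2 * y2) -
  ((x0 * y1 - x1 * y0) ^+ 2 + (x0 * y2 - x2 * y0) ^+ 2 + (x1 * y2 - x2 * y1) ^+ 2) by ring.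
by rewrite xx yy mulr1 gerBl !addr_ge0 // sqr_ge0.
Qed.

Lemma S2_hlift (w : 'rV[R]_2) : dot w w < 1 -> S2 (hlift w).
Proof.
move=> w1; rewrite /S2 /= dot3E vec3_0 vec3_1 vec3_2 -[X in _ + X]expr2 sqr_sqrtr ?subr_ge0 ?ltW //.
by rewrite dot2E; ring.
Qed.

(** The choice in [frame] never falls back to its default: at the poles the first two basis vectors
    form a frame, elsewhere the unit tangents to the parallel and to the meridian do. *)
Lemma frameP (x : 'rV[R]_3) : S2 x ->
  dot (frame x).1 (frame x).1 = 1 /\ dot (frame x).2 (frame x).2 = 1 /\
  dot (frame x).1 (frame x).2 = 0 /\ dot (frame x).1 x = 0 /\ dot (frame x).2 x = 0.
Proof.
rewrite /S2 /= dot3E => xx; rewrite /frame.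
apply: (@xgetPex _ (0, 0) [set uv : 'rV[R]_3 * 'rV[R]_3 | dot uv.1 uv.1 = 1 /\
  dot uv.2 uv.2 = 1 /\ dot uv.1 uv.2 = 0 /\ dot uv.1 x = 0 /\ dot uv.2 x = 0]).
move: xx; set a := x ord0 ord0; set b := x ord0 (inord 1); set c := x ord0 (inord 2) => xx.
have [ab|ab] := eqVneq (a * a + b * b) 0.
  exists (vec3 1 0 0, vec3 0 1 0); move: ab => /eqP; rewrite paddr_eq0 -?expr2 ?sqr_ge0 //.
  rewrite !sqrf_eq0 => /andP[/eqP a0 /eqP b0].
  by rewrite /= !dot3E !vec3_0 !vec3_1 !vec3_2 -/a -/b -/c a0 b0; do !split; ring.
pose i := (Num.sqrt (a * a + b * b))^-1.
have ii : i ^+ 2 * (a * a + b * b) = 1.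
  rewrite /i exprVn sqr_sqrtr ?mulVf //.
  by rewrite addr_ge0 // -expr2 sqr_ge0.
exists (vec3 (- b * i) (a * i) 0, vec3 (- (c * a * i)) (- (c * b * i)) ((a * a + b * b) * i)).
rewrite /= !dot3E !vec3_0 !vec3_1 !vec3_2 -/a -/b -/c; do !split; last 3 first.
- by ring.
- by ring.
- by ring.
- by rewrite -[RHS]ii; ring.
- transitivity (i ^+ 2 * (a * a + b * b) * (a * a + b * b + c * c)); first by ring.
  by rewrite ii mul1r.
Qed.

(* The parametrisation used by [circle_int]. *)
Definition circle_point (x : 'rV[R]_3) (s t : R) : 'rV[R]_3 :=
  s *: x + Num.sqrt (1 - s ^+ 2) *: (cos t *: (frame x).1 + sin t *: (frame x).2).

Lemma circle_pointE x s t j : circle_point x s t ord0 j =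
  Num.sqrt (1 - s ^+ 2) * (cos t * (frame x).1 ord0 j + sin t * (frame x).2 ord0 j) + s * x ord0 j.
Proof. by rewrite !mxE addrC. Qed.

Lemma S2_circle_point x s t : S2 x -> s ^+ 2 <= 1 -> S2 (circle_point x s t).
Proof.
move=> xx s1; have [uu [vv [uv [ux vx]]]] := frameP xx.
have r2 : Num.sqrt (1 - s ^+ 2) ^+ 2 = 1 - s ^+ 2 by rewrite sqr_sqrtr ?subr_ge0.
move: xx uu vv uv ux vx; rewrite /S2 /= !dot3E !circle_pointE.
move: ((frame x).1) ((frame x).2) (Num.sqrt _) r2 => u v r r2.
move: (u ord0 ord0) (u ord0 (inord 1)) (u ord0 (inord 2)) => u0 u1 u2.
move: (v ord0 ord0) (v ord0 (inord 1)) (v ord0 (inord 2)) => v0 v1 v2.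
move: (x ord0 ord0) (x ord0 (inord 1)) (x ord0 (inord 2)) => x0 x1 x2 xx uu vv uv ux vx.
transitivity (r ^+ 2 * (cos t ^+ 2 * (u0 * u0 + u1 * u1 + u2 * u2) + sin t ^+ 2 * (v0 * v0 + v1 * v1 + v2 * v2)
   + 2 * cos t * sin t * (u0 * v0 + u1 * v1 + u2 * v2))
   + 2 * s * r * (cos t * (u0 * x0 + u1 * x1 + u2 * x2) + sin t * (v0 * x0 + v1 * x1 + v2 * x2))
   + s ^+ 2 * (x0 * x0 + x1 * x1 + x2 * x2)); first by ring.
by rewrite xx uu vv uv ux vx r2 !mulr0 !addr0 !mulr1 cos2Dsin2 mulr1; ring.
Qed.

End space.

Section inversion.
Variables (R : realType) (theta : R) (f : 'rV[R]_3 -> R).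
Local Notation mu := (@lebesgue_measure R).
Local Notation V := 'rV[R]_2.
Local Notation U := (@open_disc R).
Hypotheses (theta0 : 0 < theta) (theta1 : theta <= pi / 2).
Hypothesis fsmooth : smooth_on_S2_supp_upper f.
Hypothesis fsupp : supp_in f (Bcap theta).

Let S : R := sin theta.
Let c : R := cos theta.
Let pi0 : 0 < pi :> R. Proof. exact: pi_gt0. Qed.
Let S0 : 0 < S.
Proof. by apply: sin_gt0_pi; rewrite theta0 /=; move: pi0 theta1; lra. Qed.
Let c0 : 0 <= c.
Proof. by apply: cos_ge0_pihalf; rewrite theta1 andbT; move: pi0 theta0; lra. Qed.
Let Sc : S ^+ 2 + c ^+ 2 = 1. Proof. by rewrite addrC cos2Dsin2. Qed.
Let S1 : S ^+ 2 <= 1. Proof. by rewrite -Sc lerDl sqr_ge0. Qed.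

Let k (w : V) : R := f (hlift w).
Let g (w : V) : R := k w * kappa w.

Let f_cap y : S2 y -> f y != 0 -> c < y ord0 (inord 2).
Proof.
move=> yS fy; have [] : Bcap theta y by apply: fsupp; apply: subset_closure.
by rewrite dot_e3.
Qed.

Let hlift_cap (w : V) : dot w w < 1 -> c < hlift w ord0 (inord 2) -> dot w w < S ^+ 2.
Proof.
rewrite vec3_2 => w1 cw.
have : c ^+ 2 < Num.sqrt (1 - dot w w) ^+ 2.
  by rewrite ltr_pXn2r // nnegrE sqrtr_ge0.
by rewrite sqr_sqrtr ?subr_ge0 ?(ltW w1) //; move: Sc; lra.
Qed.

Let k_cap w : dot w w < 1 -> k w != 0 -> dot w w < S ^+ 2.
Proof. by move=> w1 kw; apply: hlift_cap => //; apply: f_cap => //; exact: S2_hlift. Qed.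

(** The support of [f] is compact and lies in the open cap, so the height attains on it a minimum
    [m > c >= 0]. A point of the chart with squared norm beyond [1 - m^2] lies below that height. If
    the support is empty, any [r < 1] will do. *)
Let k_vanishes : exists2 r : R, r < 1 & vanishes_beyond r k.
Proof.
pose A := closure [set y | S2 y /\ f y != 0].
have AB : A `<=` Bcap theta by exact: fsupp.
have [[y0 Ay0]|A0] := pselect (A !=set0); last first.
  exists 0 => // w w1 _; apply/eqP; apply: contraT => kw.
  by exfalso; apply: A0; exists (hlift w); apply: subset_closure; split => //; exact: S2_hlift.
have cA : compact A.
  have cB : compact [set v : 'rV[R]_3 | forall i, `[(-1 : R), 1]%classic (v ord0 i)].
    by apply: (@rV_compact R 3 (fun=> `[(-1 : R), 1]%classic)) => i; exact: segment_compact.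
  apply: (subclosed_compact (@closed_closure _ _) cB) => y /AB[yS _] i /=.
  rewrite in_itv /= -ler_norml -(@ler_sqr_ge0 _ _ 1) // expr1n real_normK ?num_real //.
  move: yS; rewrite /S2 /= /dot (bigD1 i) //= -expr2 => <-; rewrite lerDl.
  by apply: sumr_ge0 => j _; rewrite -expr2 sqr_ge0.
have ct : continuous (fun y : 'rV[R]_3 => y ord0 (inord 2)) by exact: coord_continuous.
have [p pA pmin] := EVT_min_rV (ex_intro _ y0 Ay0) cA (continuous_subspaceT ct).
have [_] : Bcap theta p by apply: AB; rewrite -inE.
rewrite dot_e3 => cp; set m := p ord0 (inord 2) in cp pmin.
have m0 : 0 < m by exact: le_lt_trans cp.
exists (1 - m ^+ 2); first by rewrite gtrBl exprn_gt0.
move=> w w1 rw; apply/eqP; apply: contraT => kw.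
have : m <= hlift w ord0 (inord 2).
  by apply: pmin; rewrite inE; apply: subset_closure; split => //; exact: S2_hlift.
rewrite vec3_2 => mw.
have : m ^+ 2 <= Num.sqrt (1 - dot w w) ^+ 2 by rewrite ler_sqr_ge0 ?sqrtr_ge0 // ltW.
rewrite sqr_sqrtr ?subr_ge0 ?(ltW w1) // => mw2.
by move: rw; rewrite ltNge => /negP; case; lra.
Qed.

Let g_vanishes : exists2 r : R, r < 1 & vanishes_beyond r g.
Proof. by have [r r1 vk] := k_vanishes; exists r => // w w1 rw; rewrite /g vk // mul0r. Qed.

Let diffn_k n : diffn U n k. Proof. exact: smooth_diffn. Qed.

Let diffn_g n : diffn U n g.
Proof.
by apply: (diffnM (@open_open_disc R)); [exact: diffn_k|exact: diffn_kappa].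
Qed.

Let f_slice y : S2 y ->
  f y = if 0 < y ord0 (inord 2) then cur k (y ord0 ord0) (y ord0 (inord 1)) else 0.
Proof.
move=> yS; case: ifPn => y2; last first.
  apply/eqP; apply: contraNT y2 => /(f_cap yS); exact: le_lt_trans.
have yy : y ord0 ord0 ^+ 2 + y ord0 (inord 1) ^+ 2 = 1 - y ord0 (inord 2) ^+ 2.
  by move: yS; rewrite /S2 /= dot3E -!expr2; lra.
rewrite /cur /ext0 dot_vec2 yy ifT; last by rewrite gtrBl exprn_gt0.
rewrite /k /hlift vec2_0 vec2_1 dot_vec2 yy opprB addrC subrK sqrtr_sqr gtr0_norm //.
by rewrite vec3_eta.
Qed.

(** Absorbs the normalisation [1 / (2 pi)] of [Mop]. *)
Let K (a b : R) : R := (2 * pi)^-1 * cur k a b.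

Let mK : measurable_fun setT (fun z : R * R => K z.1 z.2).
Proof.
have [r r1 vk] := k_vanishes; apply: measurable_funM => //.
exact: (cur_measurable r1 vk (diffn0 (diffn_k 0))).
Qed.

Let K_bounded : exists C, forall a b, `|K a b| <= C.
Proof.
have [r r1 vk] := k_vanishes; have [C kC] := cur_bounded r1 vk (diffn0 (diffn_k 0)).
by exists (`|(2 * pi)^-1| * C) => a b; rewrite normrM ler_wpM2l.
Qed.

Let slice (x : 'rV[R]_3) (s t : R) : R := sphere_slice K
  ((frame x).1 ord0 ord0) ((frame x).1 ord0 (inord 1)) ((frame x).1 ord0 (inord 2))
  ((frame x).2 ord0 ord0) ((frame x).2 ord0 (inord 1)) ((frame x).2 ord0 (inord 2))
  (x ord0 ord0) (x ord0 (inord 1)) (x ord0 (inord 2)) s t.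

Let slice_circle x s t : S2 x -> s ^+ 2 < 1 -> slice x s t = (2 * pi)^-1 * f (circle_point x s t).
Proof.
move=> xS s1; rewrite f_slice; last by apply: S2_circle_point => //; exact: ltW.
rewrite !circle_pointE /slice /sphere_slice /K /=.
by case: ifP => // _; rewrite mulr0.
Qed.

(** The arc-length factor [r] cancels [(1 - s^2)^(-1/2)], leaving a plain integral over the
    angle. *)
Let Mop_slice x s : S2 x -> Mop f x s =
  if s ^+ 2 < 1 then (\int[mu]_(t in `[0%R, (2 * pi)%R]) slice x s t)%R else 0.
Proof.
move=> xS; rewrite /Mop /circle_int; case: ifPn => s1; last first.
  (* For [|s| >= 1] the radius is 0 and so is its inverse, by the convention on division; [Mop] is
     then 0, in agreement with the other branch. *)
  have -> : Num.sqrt (1 - s ^+ 2) = 0 by apply/eqP; rewrite sqrtr_eq0 subr_le0 leNgt.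
  by rewrite invr0 !mul0r.
have r0 : 0 < Num.sqrt (1 - s ^+ 2) by rewrite sqrtr_gt0 subr_gt0.
set r := Num.sqrt (1 - s ^+ 2) in r0 *.
have [C KC] := K_bounded.
have iS : mu.-integrable `[0, 2 * pi] (EFin \o slice x s).
  exact: (integrable_sphere_slice mK KC).
transitivity (r^-1 / (2 * pi) * (\int[mu]_(t in `[0%R, (2 * pi)%R]) (2 * pi * r * slice x s t))%R).
  congr (_ * _); apply: eq_Rintegral => t _; rewrite slice_circle // /circle_point -/r.
  by move: (f _) (@pi R) (lt0r_neq0 pi0) => y q q0; field.
rewrite RintegralZl //; move: (\int[mu]_(t in `[0, 2 * pi]) slice x s t) (@pi R) (lt0r_neq0 pi0) (lt0r_neq0 r0) => y q q0 rn0.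
by field; rewrite q0 rn0.
Qed.

Let G (z : R * R) : R := cur g z.1 z.2.

Let graph_weightK z : graph_weight z * K z.1 z.2 = (2 * pi)^-1 * G z.
Proof.
rewrite /graph_weight /K /G /cur /ext0 dot_vec2; case: ifP => z1; last by rewrite !mulr0.
by rewrite /g /kappa dot_vec2 /graph3; ring.
Qed.

Let kernel (xi : 'rV[R]_3) (w : V) (z : R * R) : R := (2 * pi)^-1 * G z *
  ln `|xi ord0 ord0 * z.1 + xi ord0 (inord 1) * z.2 + xi ord0 (inord 2) * graph3 z - dot xi (hlift w)|.

(** An instance of [sphere_log] with axis [xi] and [c = xi . x], of absolute value at most 1. The
    chart density in [graph_weight] turns [k] into [g]. *)
Let inner_integral xi w : S2 xi -> dot w w < 1 ->
  (lebesgue2 R).-integrable setT (fun z => (kernel xi w z)%:E) /\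
  (((\int[mu]_(tau in `[(-1)%R, 1%R]) (Mop f xi tau * ln `|tau - dot xi (hlift w)|))%R)%:E =
   \int[lebesgue2 R]_z (kernel xi w z)%:E)%E.
Proof.
move=> xS w1; have [uu [vv [uv [ux vx]]]] := frameP xS.
have cx := dot_sqr_le1 xS (S2_hlift w1).
have [C KC] := K_bounded.
have kk := xS; rewrite /S2 /= dot3E in kk; rewrite !dot3E in uu vv uv ux vx.
have [i E] := sphere_log mK KC uu vv kk uv ux vx cx.
have e z : graph_weight z * (K z.1 z.2 * ln `|xi ord0 ord0 * z.1 + xi ord0 (inord 1) * z.2 +
    xi ord0 (inord 2) * graph3 z - dot xi (hlift w)|) = kernel xi w z.
  by rewrite mulrA graph_weightK.
have i' : (lebesgue2 R).-integrable setT (fun z => (kernel xi w z)%:E).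
  by apply: eq_integrable i => // z _; rewrite e.
split => //; rewrite /Rintegral.
have -> : (\int[lebesgue2 R]_z (kernel xi w z)%:E = \int[mu]_(s in `[(-1)%R, 1%R])
     ((if (s ^+ 2 < 1)%R then (\int[mu]_(t in `[0%R, (2 * pi)%R]) slice xi s t)%R else 0)
      * ln `|s - dot xi (hlift w)|)%:E)%E.
  by apply/esym; apply: (etrans E); apply: eq_integral => z _; rewrite e.
have -> : (\int[mu]_(tau in `[(-1)%R, 1%R]) (Mop f xi tau * ln `|tau - dot xi (hlift w)|)%:E
   = \int[mu]_(s in `[(-1)%R, 1%R])
     ((if (s ^+ 2 < 1)%R then (\int[mu]_(t in `[0%R, (2 * pi)%R]) slice xi s t)%R else 0)
      * ln `|s - dot xi (hlift w)|)%:E)%E.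
  by apply: eq_integral => s _; rewrite Mop_slice.
rewrite fineK // E; apply: (integrable_fin_num measurableT i).
Qed.

(** In the factor [S / 2], [S] is the arc-length element of the boundary circle and [1 / 2] corrects
    for [lnsq] being twice the logarithm; the [2 pi] of the angular integral cancels the
    normalisation of [Mop]. The constant collects [ln (S / 2)] times the mass of [g]. Restricting
    [w] to the cap is what makes the average independent of the offset [b]. *)
Lemma potential_newton : exists K0 : R, forall w : V, dot w w < S ^+ 2 ->
  potential f theta w = S / 2 * newton g w + K0.
Proof.
exists (S * ln (S / 2) * (\int[lebesgue2 R]_z G z)%R) => w wS.
have w1 : dot w w < 1 by exact: lt_le_trans S1.
have [r r1 vg] := g_vanishes; have dg := diffn0 (diffn_g 0).
have mG := cur_measurable r1 vg dg; have [C gC] := cur_bounded r1 vg dg.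
have gs := @cur_supp R g.
pose x : R * R := (w ord0 ord0, w ord0 (inord 1)).
have xS : x.1 ^+ 2 + x.2 ^+ 2 < S ^+ 2 by move: wS; rewrite dot2E -!expr2.
have e3S : S2 (e3 R) by rewrite /S2 /= dot_e3 vec3_2.
have [uu [vv [uv [ue ve]]]] := frameP e3S.
(* Being orthogonal to [e3], both frame vectors are horizontal, so their first two coordinates form
   an orthonormal frame of the plane. *)
rewrite !dot_e3 in ue ve.
set u := (frame (e3 R)).1 in uu uv ue *; set v := (frame (e3 R)).2 in vv uv ve *.
rewrite !dot3E ?ue ?ve !mulr0 !addr0 in uu vv uv.
(* Arc-length element of the boundary circle times the normalisation of [Mop]. *)
pose m := S / (2 * pi).
have mm : measurable_fun setT (fun z : R * R => m * cur g z.1 z.2) by exact: measurable_funM.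
have mC a b : `|m * cur g a b| <= `|m| * C by rewrite normrM ler_wpM2l.
have mcap a b : m * cur g a b != 0 -> a ^+ 2 + b ^+ 2 < S ^+ 2.
  rewrite mulf_eq0 negb_or => /andP[_]; rewrite /cur /ext0 dot_vec2; case: ifPn => [ab|]; last by rewrite eqxx.
  rewrite /g mulf_eq0 negb_or => /andP[kab _]; have := @k_cap (vec2 a b); rewrite dot_vec2; exact.
have E := circle_average mm mC S0 c0 Sc mcap uu vv uv xS.
have sqS : Num.sqrt (1 - c ^+ 2) = S.
  by rewrite -Sc addrK sqrtr_sqr gtr0_norm.
have c1 : c ^+ 2 <= 1 by rewrite -Sc lerDr sqr_ge0.
rewrite /potential /circle_int -/c sqS.
pose L (z : R * R) := lnsq (z.1 - x.1, z.2 - x.2).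
have [iL EL] := integrable_mul_lnsq_sub Sc xS mG gC gs.
have iG := integrable_disc mG gC gs.
have fG : ((\int[lebesgue2 R]_z G z)%R%:E = \int[lebesgue2 R]_z (G z)%:E)%E.
  by rewrite /Rintegral fineK // (integrable_fin_num measurableT iG).
have fN : ((newton g w)%:E = \int[lebesgue2 R]_z (G z * L z)%:E)%E.
  apply: (etrans _ EL); rewrite /newton /Rintegral fineK //.
  by apply: (integrable_fin_num measurableT); apply: (integrable_mul_lnsq mG gC gs); rewrite ltW // (lt_le_trans xS).
have EY : (\int[lebesgue2 R]_z (2 * pi * (m * cur g z.1 z.2 * (2^-1 * L z + ln (S / 2))))%:E =
    (S / 2 * newton g w + S * ln (S / 2) * (\int[lebesgue2 R]_z G z)%R)%:E)%E.
  transitivity (\int[lebesgue2 R]_z ((S / 2)%:E * (G z * L z)%:E + (S * ln (S / 2))%:E * (G z)%:E))%E.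
    apply: eq_integral => z _; rewrite -!EFinM -EFinD; congr EFin.
    rewrite /G /m; move: (cur g _ _) (L z) (ln _) (@pi R) (lt0r_neq0 pi0) => y l n q q0.
    by field.
  rewrite integralD //; [|exact: integrableZl|exact: integrableZl].
  by rewrite !integralZl // -fG -fN -!EFinM -EFinD.
rewrite {1}/Rintegral.
have -> : (\int[mu]_(phi in `[0%R, (2 * pi)%R]) ((fun xi => (\int[mu]_(tau in `[(-1)%R, 1%R])
      (Mop f xi tau * ln `|tau - dot xi (hlift w)|))%R) (c *: e3 R + S *: (cos phi *: u + sin phi *: v))%R * S)%:E =
  \int[mu]_(t in `[0%R, (2 * pi)%R]) \int[lebesgue2 R]_z (m * cur g z.1 z.2 *
    ln `|S * (u ord0 ord0 * (z.1 - x.1) + u ord0 (inord 1) * (z.2 - x.2)) * cos t +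
         S * (v ord0 ord0 * (z.1 - x.1) + v ord0 (inord 1) * (z.2 - x.2)) * sin t +
         c * (graph3 z - graph3 x)|)%:E)%E.
  apply: eq_integral => t _.
  have xiE : c *: e3 R + S *: (cos t *: u + sin t *: v) = circle_point (e3 R) c t.
    by rewrite /circle_point sqS.
  have xiS : S2 (circle_point (e3 R) c t) by exact: S2_circle_point.
  have [i Ei] := inner_integral xiS w1.
  rewrite /= xiE EFinM Ei -integralZr //.
  apply: eq_integral => z _; rewrite -EFinM; congr EFin; rewrite /kernel /G mulrAC.
  congr (_ * _); last congr (ln `|_|).
    by rewrite /m; move: (cur g _ _) (@pi R) (lt0r_neq0 pi0) => y q q0; field.
  rewrite dot3E !circle_pointE vec3_0 vec3_1 vec3_2 sqS -/u -/v ue ve /hlift !vec3_0 !vec3_1 !vec3_2.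
  by rewrite dot2E -!expr2 -/(graph3 x); ring.
exact: (congr1 fine (etrans E EY)).
Qed.

Let cap_open : open [set w : V | dot w w < S ^+ 2].
Proof.
have := @open_comp _ _ (fun w : V => dot w w) [set x : R | x < S ^+ 2].
apply; last exact: open_lt.
by move=> w _; exact: continuous_dotw.
Qed.

(** The formula of [potential_newton] holds on an open set around [y], so the potential has the
    derivatives of the formula there; the additive constant drops out. *)
Let potential_derive (v y : V) : dot v v <= 1 -> dot y y < S ^+ 2 ->
  is_derive y v (potential f theta) (S / 2 * newton (fun w => 'D_v g w) y).
Proof.
move=> v1 yS; have [K0 E] := potential_newton; have [r r1 vg] := g_vanishes.
have D := is_derive_newton_cur r1 vg (diffn_g 1) v1 (ltW (lt_le_trans yS S1)).
apply: (@near_eq_is_derive _ _ _ ((S / 2) \*: newton g + cst K0)).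
  have := open_nbhs_nbhs (conj cap_open (yS : [set w : V | dot w w < S ^+ 2] y)).
  by apply: filterS => w /E ->.
have := is_deriveD (is_deriveZ (S / 2) D) (is_derive_cst K0 y v).
by rewrite addr0.
Qed.

Let potential_derive2 (v y : V) : dot v v <= 1 -> dot y y < S ^+ 2 ->
  is_derive y v (fun y => 'D_v (potential f theta) y)
    (S / 2 * newton (fun w => 'D_v (fun w => 'D_v g w) w) y).
Proof.
move=> v1 yS; have [r r1 vg] := g_vanishes.
have dDg : diffn U 1 (fun w => 'D_v g w) by have [_] := diffn_g 2; exact.
have D := is_derive_newton_cur r1 (vanishes_derive v vg) dDg v1 (ltW (lt_le_trans yS S1)).
apply: (@near_eq_is_derive _ _ _ ((S / 2) \*: newton (fun w => 'D_v g w))).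
  have := open_nbhs_nbhs (conj cap_open (yS : [set w : V | dot w w < S ^+ 2] y)).
  by apply: filterS => w wS; have [_ ->] := potential_derive v1 wS.
Qed.

Let e1_le1 : dot (e1' R) (e1' R) <= 1.
Proof. by rewrite /e1' dot_vec2 expr1n expr0n addr0. Qed.

Let e2_le1 : dot (e2' R) (e2' R) <= 1.
Proof. by rewrite /e2' dot_vec2 expr1n expr0n add0r. Qed.

Lemma potential_inversion (x : V) : open_disc x -> Bcap theta (hlift x) ->
  (forall y, open_disc y -> Bcap theta (hlift y) ->
     derivable (potential f theta) y (e1' R) /\ derivable (potential f theta) y (e2' R)) /\
  derivable (fun y => derive (potential f theta) y (e1' R)) x (e1' R) /\
  derivable (fun y => derive (potential f theta) y (e2' R)) x (e2' R) /\
  f (hlift x) = x3 (hlift x) / (2 * pi * sin theta) * laplacian2 (potential f theta) x.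
Proof.
have cap y : open_disc y -> Bcap theta (hlift y) -> dot y y < S ^+ 2.
  by move=> y1 [_]; rewrite dot_e3; exact: hlift_cap.
move=> x1 xB; have xS := cap _ x1 xB.
have [d1 D1] := potential_derive2 e1_le1 xS; have [d2 D2] := potential_derive2 e2_le1 xS.
split.
  move=> y y1 /(cap _ y1) yS.
  by have [? _] := potential_derive e1_le1 yS; have [? _] := potential_derive e2_le1 yS.
split => //; split => //.
have [r r1 vg] := g_vanishes.
(* The product [S / 2 * 4 pi] is [2 pi S], the inverse of the prefactor, and the remaining [x3]
   cancels the [kappa] contained in [g]. *)
have -> : laplacian2 (potential f theta) x = S / 2 * (4 * pi * g x).
  apply: (etrans (f_equal2 +%R D1 D2)); rewrite -mulrDr; congr (_ * _).
  exact: (newton_laplacian r1 vg (diffn_g 2) x1).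
rewrite /g /kappa /x3 vec3_2 -/S -/(k x).
have s0 : Num.sqrt (1 - dot x x) != 0 by rewrite gt_eqF // sqrtr_gt0 subr_gt0.
move: (Num.sqrt _) s0 (@pi R) (lt0r_neq0 pi0) S (lt0r_neq0 S0) (k x) => s s0 q q0 T T0 y.
by field; rewrite s0 q0 T0.
Qed.

End inversion.

Theorem theorem5p5 (R : realType) (theta : R) (f : 'rV[R]_3 -> R) :
  0 < theta -> theta <= pi / 2 ->
  smooth_on_S2_supp_upper f ->
  supp_in f (Bcap theta) ->
  forall x' : 'rV[R]_2, open_disc x' -> Bcap theta (hlift x') ->
    (* the Laplacian exists *)
    (forall y, open_disc y -> Bcap theta (hlift y) ->
       derivable (potential f theta) y (e1' R) /\
       derivable (potential f theta) y (e2' R)) /\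
    derivable (fun y => derive (potential f theta) y (e1' R)) x' (e1' R) /\
    derivable (fun y => derive (potential f theta) y (e2' R)) x' (e2' R) /\
    (* the inversion formula *)
    f (hlift x') = x3 (hlift x') / (2 * pi * sin theta)
                  * laplacian2 (potential f theta) x'.
Proof. by move=> t0 t1 fs fc x' x1 xB; exact: potential_inversion. Qed.
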